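(* Assume hypotheses (A1)–(A9) listed in the context hold. For $\epsilon>0$ let $(u^\epsilon,m^\epsilon)$ be a solution of the regularized system described in the context, and let $p>d$. Then \begin{align*} \|Du^\epsilon\|_{L^\infty(0,T;L^\infty(\mathbb{T}^d))}\le{}& C+C\|u^\epsilon\|_{L^\infty(0,T;L^\infty(\mathbb{T}^d))}\\ &+C\|g_\epsilon(m^\epsilon)\|_{L^\infty(0,T;L^p(\mathbb{T}^d))}\|Du^\epsilon\|^\mu_{L^\infty(0,T;L^\infty(\mathbb{T}^d))}\big(1+\|u^\epsilon\|_{L^\infty(0,T;L^\infty(\mathbb{T}^d))}\big), \end{align*} where $\mu$ is the exponent in (A7)–(A9) and $C$ is independent of $\epsilon$.
   Context: $\mathbb{T}^d$ is the $d$-dimensional flat torus, $T>0$ fixed. Data: $H:\mathbb{T}^d\times\mathbb{R}^d\to\mathbb{R}$, $g:[0,\infty)\to\mathbb{R}$, $u_T,m_0:\mathbb{T}^d\to\mathbb{R}$. Hypotheses: (A1) $H$ is $C^\infty$; $p\mapsto H(x,p)$ strictly convex; $\lim_{|p|\to\infty}H(x,p)/|p|=+\infty$; $H\ge1$. (A2) $g$ non-negative and increasing; $u_T,m_0\in C^\infty(\mathbb{T}^d)$, $m_0\ge0$, $\int m_0=1$. (A3) With $\hat L(x,p)=D_pH(x,p)\cdot p-H(x,p)$, there are $c,C>0$ with $\hat L\ge cH-C$. (A4) $g(z)=z^\alpha$, $\alpha>0$. (A5) $|D_xH|,|D^2_{xx}H|\le CH+C$, and for every symmetric matrix $M$ and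 $\delta>0$ there is $C_\delta$ with $\operatorname{tr}(D^2_{px}H M)\le\delta\operatorname{tr}(D^2_{pp}HM^2)+C_\delta H$. (A6) $m_0\ge\kappa_0>0$ for a constant $\kappa_0$. (A7) For some $0<\mu<1$ and non-negative constants: $c_1|p|^{2+\mu}+C_1\le H\le c_2|p|^{2+\mu}+C_2$. (A8) $|D_pH(x,p)|^2\le C|p|^\mu H(x,p)+C$. (A9) $|D^2_{xp}H|^2\le CH^{\frac{2+2\mu}{2+\mu}}$ and, for every symmetric $M$, $|D^2_{pp}HM|^2\le CH^{\frac{\mu}{2+\mu}}\operatorname{tr}(D^2_{pp}HMM)$. Regularized system: $\eta_\epsilon$ is a standard symmetric mollifying kernel and $g_\epsilon(m)=\eta_\epsilon*g(\eta_\epsilon*m)$. A solution is a pair of smooth functions $u^\epsilon,m^\epsilon$ on $\mathbb{T}^d\times[0,T]$ with $-u^\epsilon_t+H(x,Du^\epsilon)=\Delta u^\epsilon+g_\epsilon(m^\epsilon)$, $m^\epsilon_t-\operatorname{div}(D_pH(x,Du^\epsilon)m^\epsilon)=\Delta m^\epsilon$, $u^\epsilon(x,T)=u_T(x)$, $m^\epsilon(x,0)=m_0(x)$. *)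

(* Defs.v *)
From mathcomp Require Import all_boot all_algebra.
From mathcomp Require Import all_classical all_reals all_analysis.
Set Implicit Arguments. Unset Strict Implicit. Unset Printing Implicit Defensive.
Import GRing.Theory Num.Theory.
Local Open Scope ring_scope.

Section MFGDefs.
Variable R : realType.

Fixpoint smooth_dirs (V : normedModType R) (vs : seq V) (f : V -> R^o) : Prop :=
  match vs with
  | [::] => continuous f
  | v :: vs' => (forall x, derivable f x v) /\ smooth_dirs vs' ('D_v f)
  end.
Definition smoothC (V : normedModType R) (f : V -> R^o) : Prop :=
  forall vs : seq V, smooth_dirs vs f.

Variable d : nat.
Notation vec := 'rV[R]_d.
Notation mat := 'M[R]_d.

Definition ev (i : 'I_d) : vec := delta_mx 0 i.

Definition enorm (v : vec) : R := Num.sqrt (\sum_i v 0 i ^+ 2).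
Definition fnorm (A : mat) : R := Num.sqrt (\sum_i \sum_j A i j ^+ 2).

Definition pd (i : 'I_d) (f : vec -> R) (x : vec) : R := 'D_(ev i) f x.
Definition grad (f : vec -> R) (x : vec) : vec := \row_i pd i f x.
Definition lap (f : vec -> R) (x : vec) : R := \sum_i pd i (pd i f) x.
Definition tdiv (b : vec -> vec) (x : vec) : R := \sum_i pd i (fun y => b y 0 i) x.

(* periodicity: functions on R^d that are Z^d-tperiodic = functions on the flat torus *)
Definition tperiodic (f : vec -> R) : Prop := forall x i, f (x + ev i) = f x.

Definition Hp (H : vec -> vec -> R) i x p : R := pd i (H x) p.
Definition DpH (H : vec -> vec -> R) x p : vec := \row_i Hp H i x p.
Definition DxH (H : vec -> vec -> R) x p : vec := \row_i pd i (fun y => H y p) x.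
Definition DppH (H : vec -> vec -> R) x p : mat :=
  \matrix_(i, j) pd j (fun q => Hp H i x q) p.
Definition DpxH (H : vec -> vec -> R) x p : mat :=
  \matrix_(i, j) pd j (fun y => Hp H i y p) x.
Definition DxxH (H : vec -> vec -> R) x p : mat :=
  \matrix_(i, j) pd j (pd i (fun y => H y p)) x.
Definition Lhat (H : vec -> vec -> R) x p : R :=
  \sum_i Hp H i x p * p 0 i - H x p.

Definition setc (x : vec) (k : nat) (t : R) : vec :=
  \row_j (if (j : nat) == k then t else x 0 j).
Fixpoint iint (n : nat) (a b : R) (f : vec -> R) (x : vec) : R :=
  match n with
  | 0 => f x
  | k.+1 => Rintegral (@lebesgue_measure R) `[a, b]%classic
              (fun t => iint k a b f (setc x k t))
  end.
Definition box_int (a b : R) (f : vec -> R) : R := iint d a b f 0.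

Definition is_mollifier (eta : vec -> R) : Prop :=
  [/\ smoothC eta, (forall x, 0 <= eta x),
      (forall x, 1 <= enorm x -> eta x = 0),
      (forall x, eta (- x) = eta x) & box_int (-1) 1 eta = 1].
Definition eta_eps (eta : vec -> R) (eps : R) (x : vec) : R :=
  eps ^- d * eta (eps^-1 *: x).
(* (eta_eps * f)(x) = int_{R^d} eta_eps(y) f(x-y) dy ; supp eta_eps is in [-eps,eps]^d *)
Definition conv (eta : vec -> R) (eps : R) (f : vec -> R) (x : vec) : R :=
  box_int (- eps) eps (fun y => eta_eps eta eps y * f (x - y)).
Definition g_eps (alpha : R) (eta : vec -> R) (eps : R) (m : vec -> R) : vec -> R :=
  conv eta eps (fun y => conv eta eps m y `^ alpha).

Definition unc (u : vec -> R -> R) : (vec * R)%type -> R := fun z => u z.1 z.2.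
Definition dt (u : vec -> R -> R) (x : vec) (t : R) : R := 'D_(1 : R) (u x) t.

Definition is_solution (H : vec -> vec -> R) (alpha : R) (eta : vec -> R)
    (eps : R) (uT m0 : vec -> R) (T : R) (u m : vec -> R -> R) : Prop :=
  [/\ smoothC (unc u), smoothC (unc m),
      (forall t, tperiodic (u ^~ t)) /\ (forall t, tperiodic (m ^~ t)),
      (forall x t, 0 <= t <= T ->
         - dt u x t + H x (grad (u ^~ t) x)
         = lap (u ^~ t) x + g_eps alpha eta eps (m ^~ t) x) /\
      (forall x t, 0 <= t <= T ->
         dt m x t - tdiv (fun y => m y t *: DpH H y (grad (u ^~ t) y)) x
         = lap (m ^~ t) x)
    & (forall x, u x T = uT x) /\ (forall x, m x 0 = m0 x)].

(* || f ||_{L^oo(0,T; L^oo(T^d))} for continuous f *)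
Definition supnorm (T : R) (f : vec -> R -> R) : R :=
  sup [set r | exists x t, 0 <= t <= T /\ r = `|f x t|].
Definition grad_supnorm (T : R) (u : vec -> R -> R) : R :=
  sup [set r | exists x t, 0 <= t <= T /\ r = enorm (grad (u ^~ t) x)].
(* || f ||_{L^oo(0,T; L^p(T^d))} for continuous f, T^d = [0,1]^d *)
Definition Lp_supnorm (T p : R) (f : vec -> R -> R) : R :=
  sup [set r | exists t, 0 <= t <= T /\
                 r = box_int 0 1 (fun x => `|f x t| `^ p) `^ p^-1].

End MFGDefs.

(* Main.v *)
Require Import Defs.
From mathcomp Require Import all_boot all_order all_algebra.
From mathcomp Require Import all_classical all_reals all_analysis.
From mathcomp Require Import ring lra.
Import Order.TTheory GRing.Theory Num.Theory.
Import numFieldNormedType.Exports.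
Local Open Scope ring_scope.

(** Write F for the coupling g_eps(m), which enters only through F >= 0 and its
    L^p norm, and let h solve the backward heat equation -h_t = Lap h + F with
    h(T) = 0. Since p > d, the heat kernel bounds give |Dh| <= C |F| where |F| is
    the norm of F in L^oo(L^p). The difference y = u - h solves
    -y_t = Lap y - H(x, Du), free of F, and its Lipschitz constant is bounded by
    doubling variables in a coordinate direction: one shows that
      y(x + s e_i, t) - y(x, t) <= phi(s) + s a (u(x + s e_i, t) + |u|_oo)
    for small s >= 0, with phi(s) = B (2 s - Lam s^2). At an interior maximum of
    the difference of the two sides, moving the two points together in the
    directions e_j, j <> i, and oppositely in the direction e_i gains
    -4 phi''(s) = 8 B Lam. The first order condition makes
    (1 - s a) Du(x + s e_i) and Du(x) differ by at most 2 |Dh|, so H costs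
    O(K^(1+mu) |Dh|) by (A8), where K = |Du|_oo; the remaining dependence of H on
    x is O(s H) by (A5), and it is absorbed by the term in a, because (A3) gives
    H(r q) + (1 - r) (c H(r q) - C) <= r H(q). Take Lam ~ 1 + |F| K^mu and
    B = beta K with beta small. If B >= C (1 + |u|_oo) Lam, the maximum is not
    attained at s = 1 / (2 Lam), so that Du is bounded by a small multiple of K
    plus C (1 + |u|_oo + |F|); in the opposite case
    K <= C (1 + |u|_oo) (1 + |F| K^mu) directly.

    Heat potentials are replaced by their discretization: binomial random walks
    on a grid of step 1/N, with the maximum principle run along the time grid
    of step 1/(4 N^2). The kernel bounds then reduce to the binomial
    distribution, and the L^p norm enters through Riemann sums. *)

Set Implicit Arguments.
Unset Strict Implicit.
Unset Printing Implicit Defensive.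

(** * Binomial averages *)

Section BinomialAverage.
Context {R : realType}.

(** Expectation of [phi] under the binomial law with n fair tosses, unrolled one toss at a time so
    that no binomial coefficient appears. *)
Fixpoint binavg (n : nat) (phi : nat -> R) : R :=
  if n is m.+1 then (binavg m phi + binavg m (fun l => phi l.+1)) / 2 else phi 0%N.

Lemma binavgS n phi :
  binavg n.+1 phi = (binavg n phi + binavg n (fun l => phi l.+1)) / 2.
Proof. by []. Qed.

Lemma eq_binavg n phi psi : phi =1 psi -> binavg n phi = binavg n psi.
Proof.
elim: n phi psi => [|n IH] phi psi e /=; first exact: e.
by congr (_ / 2); congr (_ + _); apply: IH => l; exact: e.
Qed.

Lemma binavgD n phi psi :
  binavg n (fun l => phi l + psi l) = binavg n phi + binavg n psi.
Proof.
elim: n phi psi => [|n IH] phi psi //=.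
by rewrite !IH; ring.
Qed.

Lemma binavgZ n c phi : binavg n (fun l => c * phi l) = c * binavg n phi.
Proof.
by elim: n phi => [|n IH] phi //=; rewrite !IH; ring.
Qed.

Lemma binavg_cst n c : binavg n (fun=> c) = c.
Proof. by elim: n => [|n IH] //=; rewrite !IH; field. Qed.

Lemma binavg_sum n N (phi : nat -> nat -> R) :
  binavg n (fun l => \sum_(a < N) phi l a) = \sum_(a < N) binavg n (phi ^~ a).
Proof.
elim: N => [|N IH].
  rewrite big_ord0 -[RHS](binavg_cst n 0); apply: eq_binavg => l.
  by rewrite big_ord0.
rewrite big_ord_recr /= -IH -binavgD; apply: eq_binavg => l.
by rewrite big_ord_recr.
Qed.

Lemma le_binavg n phi psi : (forall l, phi l <= psi l) ->
  binavg n phi <= binavg n psi.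
Proof.
elim: n phi psi => [|n IH] phi psi e /=; first exact: e.
by rewrite ler_pM2r ?invr_gt0 // lerD // IH.
Qed.

Lemma ler_norm_binavg n phi : `|binavg n phi| <= binavg n (fun l => `|phi l|).
Proof.
elim: n phi => [|n IH] phi //=.
rewrite normrM (ger0_norm (x := 2^-1)) ?invr_ge0 // ler_pM2r ?invr_gt0 //.
by rewrite (le_trans (ler_normD _ _)) // lerD.
Qed.

Lemma binavg_var n : binavg n (fun l => (2 * l%:R - n%:R) ^+ 2) = n%:R.
Proof.
elim: n => [|n IH]; first by rewrite /= mulr0 subrr expr0n.
rewrite /= -binavgD -(mulr1 (n.+1)%:R).
rewrite (@eq_binavg _ _ (fun l => 2 * ((2 * l%:R - n%:R) ^+ 2 + 1))); last first.
  by move=> l; rewrite -!natr1; ring.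
by rewrite binavgZ binavgD IH binavg_cst -natr1; field.
Qed.

(* Integration by parts against the binomial distribution. *)
Lemma binavg_stein n phi :
  binavg n (fun l => phi l.+1) - binavg n phi =
  2 / n.+1%:R * binavg n.+1 (fun l => (2 * l%:R - n.+1%:R) * phi l).
Proof.
elim: n phi => [|n IH] phi; first by rewrite /=; field.
set D := LHS.
have n1 : (n.+1%:R : R) != 0 by rewrite pnatr_eq0.
have n2 : (n.+2%:R : R) != 0 by rewrite pnatr_eq0.
pose a := binavg n.+1 (fun l => (2 * l%:R - n.+1%:R) * phi l).
pose a' := binavg n.+1 (fun l => (2 * l%:R - n.+1%:R) * phi l.+1).
have Daa : D = (a + a') / n.+1%:R.
  have -> : D = ((binavg n (fun l => phi l.+1) - binavg n phi)
    + (binavg n (fun l => phi l.+2) - binavg n (fun l => phi l.+1))) / 2.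
    by rewrite /D /=; ring.
  rewrite IH (IH (fun l => phi l.+1)) -/a -/a'.
  by move: n1; move: (n.+1%:R : R) => z z0; field.
(* Conditioning on one toss turns the weight [2 l - (n+2)] into [2 l - (n+1)] minus or plus one. The
   average is thus half of [a + a' + D], and [a + a' = (n+1) D]. *)
rewrite [X in _ * X](_ : _ = (a - binavg n.+1 phi + (a' + binavg n.+1 (fun l => phi l.+1))) / 2).
  have -> : a - binavg n.+1 phi + (a' + binavg n.+1 (fun l => phi l.+1)) = (a + a') + D.
    by rewrite /D; ring.
  move: n1 n2; rewrite Daa -(natr1 n.+1); move: (n.+1%:R : R) => z z0 z1.
  by field; rewrite z0 z1.
rewrite (binavgS n.+1); congr (_ / 2); congr (_ + _).
  have -> : a - binavg n.+1 phi =
      binavg n.+1 (fun l => (2 * l%:R - n.+1%:R) * phi l + (-1) * phi l).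
    by rewrite binavgD binavgZ mulN1r.
  apply: eq_binavg => l.
  by rewrite -!natr1; ring.
rewrite /a' -binavgD; apply: eq_binavg => l.
by rewrite -!natr1; ring.
Qed.

(** First moment from the second, by [2 s |z| <= z^2 + s^2] with [s] the square root of n: both
    terms on the right average to n. *)
Lemma binavg_absdev n : binavg n (fun l => `|2 * l%:R - n%:R|) <= Num.sqrt n%:R.
Proof.
case: n => [|n]; first by rewrite /= mulr0 subrr normr0 sqrtr0.
set s := Num.sqrt _; have s0 : 0 < s by rewrite sqrtr_gt0 ltr0n.
have e : s ^+ 2 = n.+1%:R by rewrite sqr_sqrtr ?ler0n.
rewrite (@le_trans _ _ (binavg n.+1 (fun l => (2 * s)^-1 * ((2 * l%:R - n.+1%:R) ^+ 2 + s ^+ 2)))) //.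
  apply: le_binavg => l.
  rewrite ler_pdivlMl ?mulr_gt0 // -(real_normK (num_real (_ - _))) -subr_ge0.
  set z := `|_|; have -> : z ^+ 2 + s ^+ 2 - 2 * s * z = (z - s) ^+ 2 by ring.
  exact: sqr_ge0.
rewrite binavgZ binavgD binavg_var binavg_cst -e le_eqVlt; apply/orP; left; apply/eqP.
by field; rewrite gt_eqF.
Qed.

(** The smoothing effect of the walk: [binavg_stein] moves the difference from [phi] to the weight,
    whose first absolute moment is at most the square root of n+1. *)
Lemma binavg_diff n phi c : (forall l, `|phi l| <= c) ->
  `|binavg n (fun l => phi l.+1) - binavg n phi| <= 2 / Num.sqrt n.+1%:R * c.
Proof.
move=> hc; have c0 : 0 <= c by exact: le_trans (hc 0%N).
have s0 : 0 < Num.sqrt (n.+1%:R : R) by rewrite sqrtr_gt0 ltr0n.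
rewrite binavg_stein normrM ger0_norm ?divr_ge0 //.
have -> : 2 / Num.sqrt n.+1%:R * c = 2 / n.+1%:R * (c * Num.sqrt n.+1%:R) :> R.
  have e : Num.sqrt n.+1%:R ^+ 2 = n.+1%:R :> R by rewrite sqr_sqrtr ?ler0n.
  move: s0; rewrite -{3}e; move: (Num.sqrt _) => s s0; field.
  by rewrite gt_eqF.
rewrite ler_pM2l ?divr_gt0 // (le_trans (ler_norm_binavg _ _)) //.
rewrite (le_trans _ (ler_wpM2l c0 (binavg_absdev n.+1))) // -binavgZ.
by apply: le_binavg => l; rewrite normrM mulrC ler_wpM2r.
Qed.

Lemma sum_periodic N (phi : nat -> R) b : (forall l, phi (l + N)%N = phi l) ->
  \sum_(a < N) phi (b + a)%N = \sum_(a < N) phi a.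
Proof.
move=> per; elim: b => [|b IH]; first by apply: eq_bigr => a _.
rewrite -IH; case: N per {IH} => [|N] per; first by rewrite !big_ord0.
rewrite big_ord_recr /= [RHS]big_ord_recl /= addn0 addSnnS per addrC.
by congr (_ + _); apply: eq_bigr => a _; rewrite /bump /= add1n addSnnS.
Qed.

Lemma le_telescope (psi : nat -> R) b :
  psi 0%N <= psi b + \sum_(a < b) `|psi a.+1 - psi a|.
Proof.
elim: b => [|b IH]; first by rewrite big_ord0 addr0.
rewrite (le_trans IH) // big_ord_recr /=.
have := ler_norm (psi b - psi b.+1); rewrite distrC.
by move: (\sum_(a < b) _) => s; lra.
Qed.

(* A nonnegative function exceeds its mean by at most its total variation, and
   by binavg_stein averaging makes the total variation small. *)
Lemma binavg_sup N n phi : (0 < N)%N -> (forall l, 0 <= phi l) ->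
  (forall l, phi (l + N)%N = phi l) ->
  binavg n phi <= (N%:R^-1 + 2 / Num.sqrt n.+1%:R) * \sum_(a < N) phi a.
Proof.
move=> N0 p0 per; set S := \sum_(a < N) phi a.
have N0' : 0 < N%:R :> R by rewrite ltr0n.
have s0 : 0 < Num.sqrt (n.+1%:R : R) by rewrite sqrtr_gt0 ltr0n.
pose psi a := binavg n (fun l => phi (l + a)%N).
pose TV := \sum_(a < N) `|psi a.+1 - psi a|.
have tv b : psi 0%N <= psi b + \sum_(a < b) `|psi a.+1 - psi a| by exact: le_telescope.
have tv' (b : 'I_N) : psi 0%N <= psi b + TV.
  rewrite (le_trans (tv b)) // lerD2l.
  have : \sum_(a < b) `|psi a.+1 - psi a| <= \sum_(a < b + (N - b)) `|psi a.+1 - psi a|.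
    by rewrite big_split_ord /= lerDl sumr_ge0.
  by rewrite subnKC // ltnW.
have sumpsi : \sum_(a < N) psi a = S.
  rewrite /psi -(binavg_sum n N (fun l a => phi (l + a)%N)).
  rewrite (@eq_binavg _ _ (fun=> S)) ?binavg_cst // => l; exact: sum_periodic.
(* Each increment of [psi] is a weighted average of shifts of [phi]. Summed over a period, every
   shift gives the same [S], so only the first absolute moment of the weight remains. *)
have TVle : TV <= 2 / Num.sqrt n.+1%:R * S.
  have -> : 2 / Num.sqrt n.+1%:R * S = 2 / n.+1%:R * (S * Num.sqrt n.+1%:R) :> R.
    have e : Num.sqrt n.+1%:R ^+ 2 = n.+1%:R :> R by rewrite sqr_sqrtr ?ler0n.
    move: s0; rewrite -{3}e; move: (Num.sqrt _) => s s0; field.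
    by rewrite gt_eqF.
  have S0 : 0 <= S by apply: sumr_ge0.
  rewrite (le_trans _ (ler_wpM2l _ (ler_wpM2l S0 (binavg_absdev n.+1)))) ?divr_ge0 //.
  rewrite -binavgZ (@eq_binavg _ _ (fun l => \sum_(a < N) (`|2 * l%:R - n.+1%:R| * phi (l + a)%N))); last first.
    by move=> l; rewrite -mulr_sumr sum_periodic // mulrC.
  rewrite (binavg_sum n.+1 N (fun l a => `|2 * l%:R - n.+1%:R| * phi (l + a)%N)).
  rewrite mulr_sumr; apply: ler_sum => a _.
  have -> : psi a.+1 = binavg n (fun l => phi (l.+1 + a)%N).
    by apply: eq_binavg => l; rewrite addnS addSn.
  rewrite (binavg_stein n (fun l => phi (l + a)%N)) normrM ger0_norm ?divr_ge0 //.
  rewrite ler_wpM2l ?divr_ge0 // (le_trans (ler_norm_binavg _ _)) //.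
  by apply: le_binavg => l; rewrite normrM [X in _ * X]ger0_norm.
have -> : binavg n phi = psi 0%N by apply: eq_binavg => l; rewrite addn0.
have : \sum_(a < N) psi 0%N <= \sum_(a < N) (psi a + TV) by apply: ler_sum.
rewrite big_split /= !sumr_const card_ord sumpsi -[leLHS]mulr_natl -[X in _ + X]mulr_natl => h.
rewrite -(ler_pM2l N0') (le_trans h) // mulrDl mulrDr mulrA divff ?gt_eqF // mul1r.
by rewrite lerD2l ler_pM2l.
Qed.

End BinomialAverage.

(** * Random walks on a grid *)

Section Averaging.
Context {R : realType} {d : nat}.
Notation vec := 'rV[R]_d.
Notation op := ((vec -> R) -> (vec -> R)).
Implicit Types (A B : op) (f g : vec -> R) (x v : vec) (i j : 'I_d) (r : seq 'I_d).

(** Finite convex combinations of translations, kept as a list of weights and shifts. Positivity,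
    contraction in sup norm and commutation with translations and with each other are read off that
    list. *)
Definition averaging A := exists L : seq (R * vec),
  [/\ (forall l, l \in L -> 0 <= l.1), \sum_(l <- L) l.1 = 1 &
      forall f x, A f x = \sum_(l <- L) l.1 * f (x + l.2)].

Definition avg2 (s : R) (j : 'I_d) : op := fun f x => (f x + f (x + s *: ev R j)) / 2.

Definition prodop (A : 'I_d -> op) r : op := fun f => foldr (fun j g => A j g) f r.

Lemma averaging_id : averaging id.
Proof.
exists [:: (1, 0)]; split => [l|| f x]; last by rewrite big_seq1 mul1r addr0.
  by rewrite inE => /eqP ->.
by rewrite big_seq1.
Qed.

Lemma averaging_avg2 s j : averaging (avg2 s j).
Proof.
exists [:: (2^-1, 0); (2^-1, s *: ev R j)]; split => [l|| f x].
- by rewrite !inE => /orP[] /eqP -> /=; rewrite invr_ge0 ler0n.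
- by rewrite big_cons big_seq1 /=; field.
- by rewrite big_cons big_seq1 /= addr0 /avg2; field.
Qed.

Lemma averaging_comp A B : averaging A -> averaging B ->
  averaging (fun f => A (B f)).
Proof.
move=> [K [K0 K1 KE]] [L [L0 L1 LE]].
exists [seq (k.1 * l.1, k.2 + l.2) | k <- K, l <- L]; split => [m||f x].
- by case/allpairsP => -[k l] /= [kK lL ->] /=; apply: mulr_ge0; [exact: K0|exact: L0].
- rewrite big_allpairs_dep /=.
  under eq_bigr do rewrite -mulr_sumr L1 mulr1.
  by [].
- rewrite KE big_allpairs_dep /=; apply: eq_bigr => k _.
  rewrite LE mulr_sumr; apply: eq_bigr => l _.
  by rewrite mulrA addrA.
Qed.

Lemma averaging_iter n A : averaging A -> averaging (iter n A).
Proof.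
move=> hA; elim: n => [|n IH]; first exact: averaging_id.
exact: averaging_comp hA IH.
Qed.

Lemma averaging_prodop (A : 'I_d -> op) r : (forall j, averaging (A j)) -> averaging (prodop A r).
Proof.
move=> hA; elim: r => [|j r IH]; first exact: averaging_id.
exact: averaging_comp (hA j) IH.
Qed.

Lemma averagingC A B f : averaging A -> averaging B -> A (B f) = B (A f).
Proof.
move=> [K [_ _ KE]] [L [_ _ LE]]; apply/funext => x.
rewrite KE LE; under eq_bigr do rewrite LE mulr_sumr.
rewrite exchange_big; apply: eq_bigr => l _ /=.
rewrite KE mulr_sumr; apply: eq_bigr => k _.
by rewrite mulrCA -!addrA [l.2 + _]addrC.
Qed.

Section Properties.
Variable A : op.
Hypothesis hA : averaging A.

Lemma averaging_le f g x : (forall y, f y <= g y) -> A f x <= A g x.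
Proof.
case: hA => K [K0 _ KE] fg; rewrite !KE big_seq [leRHS]big_seq.
by apply: ler_sum => l lK; rewrite ler_wpM2l ?K0.
Qed.

Lemma averaging_cst (c : R) x : A (fun=> c) x = c.
Proof. by case: hA => K [_ K1 KE]; rewrite KE -mulr_suml K1 mul1r. Qed.

Lemma averaging_bound f c x : (forall y, `|f y| <= c) -> `|A f x| <= c.
Proof.
move=> fc; rewrite ler_norml; apply/andP; split.
  rewrite -[leLHS](averaging_cst (- c) x); apply: averaging_le => y.
  by have := fc y; rewrite ler_norml => /andP[].
rewrite -[leRHS](averaging_cst c x); apply: averaging_le => y.
by have := fc y; rewrite ler_norml => /andP[].
Qed.

Lemma averaging_lin f g c x : A (fun y => f y + c * g y) x = A f x + c * A g x.
Proof.
case: hA => K [_ _ KE]; rewrite !KE mulr_sumr -big_split /=.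
by apply: eq_bigr => l _; ring.
Qed.

Lemma averagingB f g x : A (fun y => f y - g y) x = A f x - A g x.
Proof.
rewrite -(mulN1r (A g x)) -averaging_lin; congr (A _ x).
by apply/funext => y; rewrite mulN1r.
Qed.

Lemma averaging_shift f v x : A f (x + v) = A (fun y => f (y + v)) x.
Proof.
case: hA => K [_ _ KE]; rewrite !KE; apply: eq_bigr => l _.
by rewrite addrAC.
Qed.

Lemma averaging_sum n (f : nat -> vec -> R) (c : R) x :
  A (fun y => \sum_(l < n) c * f l y) x = \sum_(l < n) c * A (f l) x.
Proof.
elim: n => [|n IH].
  rewrite big_ord0 -[RHS](averaging_cst 0 x); congr (A _ x).
  by apply/funext => y; rewrite big_ord0.
rewrite big_ord_recr /= -IH -averaging_lin; congr (A _ x).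
by apply/funext => y; rewrite big_ord_recr.
Qed.

End Properties.

Lemma prodop_comp (A B : 'I_d -> op) r f : (forall j, averaging (A j)) -> (forall j, averaging (B j)) ->
  prodop (fun j f => A j (B j f)) r f = prodop A r (prodop B r f).
Proof.
move=> hA hB; elim: r => [|j r IH] //=.
by rewrite IH (averagingC _ (hB j) (averaging_prodop r hA)).
Qed.

Lemma iter_comp n A B f : averaging A -> averaging B ->
  iter n (fun f => A (B f)) f = iter n A (iter n B f).
Proof.
move=> hA hB; elim: n => [|n IH] //=.
by rewrite IH (averagingC _ hB (averaging_iter n hA)).
Qed.

(** The lazy walk with weights 1/4, 1/2, 1/4. Its variance is [h^2 / 2], so that one step is a heat
    step of duration [h^2 / 4]. The factorization into a forward and a backward average is what
    [heat_split] exploits. *)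
Definition walk (h : R) j : op := fun f => avg2 (- h) j (avg2 h j f).

Lemma averaging_walk h j : averaging (walk h j).
Proof. by apply: averaging_comp; exact: averaging_avg2. Qed.

Lemma walkE h j f x :
  walk h j f x = (f (x + h *: ev R j) + f (x + (- h) *: ev R j) + 2 * f x) / 4.
Proof.
by rewrite /walk /avg2 scaleNr subrK; field.
Qed.

Definition heat (h : R) (m : nat) : op :=
  prodop (fun j => iter m (walk h j)) (enum 'I_d).

Lemma averaging_heat h m : averaging (heat h m).
Proof. by apply: averaging_prodop => j; apply: averaging_iter; exact: averaging_walk. Qed.

Lemma heat0 h f : heat h 0 f = f.
Proof. by rewrite /heat; elim: (enum _). Qed.

Lemma heatS h m f : heat h m.+1 f = heat h 1 (heat h m f).
Proof.
rewrite /heat -prodop_comp //= => j; first exact: averaging_walk.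
by apply: averaging_iter; exact: averaging_walk.
Qed.

(** The two factors have different tasks in [heat_diff]: the backward one absorbs the derivative,
    the forward one turns an L^p norm into a sup norm. *)
Lemma heat_split h m f : heat h m f =
  prodop (fun j => iter m (avg2 (- h) j)) (enum 'I_d)
    (prodop (fun j => iter m (avg2 h j)) (enum 'I_d) f).
Proof.
rewrite -prodop_comp => [|j|j]; last 2 first.
- by apply: averaging_iter; exact: averaging_avg2.
- by apply: averaging_iter; exact: averaging_avg2.
rewrite /heat /prodop; elim: (enum _) => //= j r ->.
by rewrite iter_comp //; exact: averaging_avg2.
Qed.

Lemma iter_avg2E m s j f x :
  iter m (avg2 s j) f x = binavg m (fun l => f (x + (l%:R * s) *: ev R j)).
Proof.
elim: m x => [|m IH] x /=; first by rewrite mul0r scale0r addr0.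
rewrite {1}/avg2 !IH; congr ((_ + _) / 2); apply: eq_binavg => l.
by rewrite -addrA -scalerDl -natr1; congr (f (_ + _ *: _)); ring.
Qed.

Lemma backward_diff h m r g i c x : i \in r -> (forall y, `|g y| <= c) ->
  `|prodop (fun j => iter m (avg2 (- h) j)) r g (x + h *: ev R i)
    - prodop (fun j => iter m (avg2 (- h) j)) r g x| <= 2 / Num.sqrt m.+1%:R * c.
Proof.
move=> + gc; elim: r x => [|j r IH] x //.
have av k : averaging (iter m (avg2 (- h) k)).
  by apply: averaging_iter; exact: averaging_avg2.
rewrite inE; case: (eqVneq i j) => [<- _|_ /= ir] /=.
  set g' := prodop _ r g; have g'c y : `|g' y| <= c.
    by apply: averaging_bound gc; exact: averaging_prodop.
  (* Seen from [x + h e_i], the point [x] is one more backward step away, so the two values are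
     averages over consecutive arguments, as in [binavg_diff]. *)
  have : x = x + h *: ev R i + (- h) *: ev R i by rewrite scaleNr addrK.
  move: (x + h *: ev R i) => y ->; rewrite -normrN opprB !iter_avg2E.
  rewrite (@eq_binavg _ m (fun l => g' (y + (- h) *: ev R i + (l%:R * - h) *: ev R i))
    (fun l => g' (y + (l.+1%:R * - h) *: ev R i))); last first.
    by move=> l; rewrite -addrA -scalerDl -natr1; congr (g' (_ + _ *: _)); ring.
  by apply: (@binavg_diff _ m (fun l => g' (y + (l%:R * - h) *: ev R i)) c) => l.
rewrite averaging_shift // -averagingB //.
by apply: averaging_bound => // y; exact: IH.
Qed.

Definition perN (h : R) (N : nat) f := forall x j, f (x + (N%:R * h) *: ev R j) = f x.

Definition gridsum (h : R) N j : op := fun f x => \sum_(a < N) f (x + (a%:R * h) *: ev R j).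

Lemma perN_gridsum h N j f : perN h N f -> perN h N (gridsum h N j f).
Proof.
by move=> pf x k; apply: eq_bigr => a _; rewrite addrAC pf.
Qed.

Lemma gridsum_ge0 h N j f : (forall x, 0 <= f x) -> forall x, 0 <= gridsum h N j f x.
Proof. by move=> f0 x; apply: sumr_ge0. Qed.

(** One use of [binavg_sup] per coordinate trades the binomial average for a sum over a full period
    of the grid. *)
Lemma prodop_le_gridsum h N m r f x : (0 < N)%N -> perN h N f -> (forall x, 0 <= f x) ->
  prodop (fun j => iter m (avg2 h j)) r f x <=
  (N%:R^-1 + 2 / Num.sqrt m.+1%:R) ^+ size r * prodop (gridsum h N) r f x.
Proof.
move=> N0 pf f0; elim: r x => [|j r IH] x /=; first by rewrite mul1r.
set th := _ + _ in IH *; set E := prodop (gridsum h N) r f in IH *.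
have th0 : 0 <= th by rewrite addr_ge0 // ?invr_ge0 // divr_ge0.
have [E0 pE] : (forall x, 0 <= E x) /\ perN h N E.
  rewrite /E; elim: {IH E} r => [|k r [IH1 IH2]] //=; split.
    exact: gridsum_ge0.
  exact: perN_gridsum.
have av : averaging (iter m (avg2 h j)) by apply: averaging_iter; exact: averaging_avg2.
rewrite (le_trans (averaging_le av _ IH)) //.
have -> : iter m (avg2 h j) (fun y => th ^+ size r * E y) x = th ^+ size r * iter m (avg2 h j) E x.
  by rewrite !iter_avg2E binavgZ.
rewrite exprSr -mulrA ler_wpM2l ?exprn_ge0 // iter_avg2E.
apply: (binavg_sup _ N0) => // l.
by rewrite natrD mulrDl scalerDl addrA pE.
Qed.

Lemma powR_avg (p a b : R) : 1 <= p -> `|(a + b) / 2| `^ p <= (`|a| `^ p + `|b| `^ p) / 2.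
Proof.
move=> p1; have p0 : 0 <= p by exact: le_trans p1.
apply: (@le_trans _ _ ((2^-1 * `|a| + 2^-1 * `|b|) `^ p)).
  rewrite ge0_ler_powR ?nnegrE //.
  by rewrite mulrC mulrDr (le_trans (ler_normD _ _)) // !normrM ger0_norm.
rewrite [leRHS]mulrC mulrDr {2 4}(_ : 2^-1 = 1 - 2^-1); last by field.
by apply: (convex_powR p1 (Itv01 _ _)) => //=;
  rewrite ?inE /= ?in_itv /= ?normr_ge0 // ?invr_ge0 // invf_le1 ?ler1n.
Qed.

End Averaging.

(** * Gradient and consistency bounds for the discrete heat flow *)

Section HeatBounds.
Context {R : realType} {d : nat}.
Notation vec := 'rV[R]_d.
Implicit Types (f g : vec -> R) (x v : vec) (i j : 'I_d) (r : seq 'I_d).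

Lemma powR_avg2 p s j f g : 1 <= p -> (forall x, `|f x| `^ p <= g x) ->
  forall x, `|avg2 s j f x| `^ p <= avg2 s j g x.
Proof.
move=> p1 fg x; rewrite (le_trans (powR_avg _ _ p1)) // /avg2.
by rewrite ler_pM2r ?invr_gt0 // lerD.
Qed.

Lemma powR_prodop p s m r f g x : 1 <= p -> (forall x, `|f x| `^ p <= g x) ->
  `|prodop (fun j => iter m (avg2 s j)) r f x| `^ p <=
  prodop (fun j => iter m (avg2 s j)) r g x.
Proof.
move=> p1 fg; elim: r x => [|j r IH] //=.
elim: m {IH}(prodop _ r f) (prodop _ r g) IH => [|m IH] f' g' fg' x //=.
by apply: powR_avg2 => // y; exact: IH.
Qed.

(** Discrete smoothing from L^p to Lipschitz. The backward half of [heat_split] is differenced by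
    [backward_diff]. The sup of the forward half is controlled through its p-th power, by Jensen
    ([powR_prodop]) and then [prodop_le_gridsum]. *)
Lemma heat_diff (N m : nat) f i p S x (h := (N%:R : R)^-1) :
  (0 < N)%N -> 1 <= p -> perN h N f ->
  (forall y, prodop (gridsum h N) (enum 'I_d) (fun y => `|f y| `^ p) y <= S) ->
  `|heat h m f (x + h *: ev R i) - heat h m f x| <=
  2 / Num.sqrt m.+1%:R * ((N%:R^-1 + 2 / Num.sqrt m.+1%:R) ^+ d * S) `^ p^-1.
Proof.
move=> N0 p1 pf fS; have p0 : 0 < p by exact: lt_le_trans p1.
rewrite heat_split; apply: backward_diff; first by rewrite mem_enum.
move=> y; set P := prodop _ _ f y.
have PS : `|P| `^ p <= (N%:R^-1 + 2 / Num.sqrt m.+1%:R) ^+ d * S.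
  rewrite (le_trans (powR_prodop h m (enum 'I_d) (g := fun y => `|f y| `^ p) y p1 _)) //.
  have pf' : perN h N (fun y => `|f y| `^ p) by move=> z j; rewrite pf.
  rewrite (le_trans (prodop_le_gridsum m _ _ N0 pf' _)) //.
  rewrite size_enum_ord ler_wpM2l // exprn_ge0 // addr_ge0 ?invr_ge0 // divr_ge0 //.
have -> : `|P| = (`|P| `^ p) `^ p^-1 by rewrite -powRrM divff ?gt_eqF // powRr1.
rewrite ge0_ler_powR ?nnegrE //.
- by rewrite invr_ge0 ltW.
- exact: le_trans (powR_ge0 _ _) PS.
Qed.

(* [D1] and [D2] are the first and pure second derivatives of [f] along the
   coordinate axes, known only through uniform Taylor bounds.  Unlike
   differentiability, this is visibly inherited by averages of translates. *)
Definition taylor (B : R) f (D1 D2 : 'I_d -> vec -> R) :=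
  [/\ forall i t x, `|f (x + t *: ev R i) - f x - t * D1 i x| <= B * t ^+ 2,
      forall i t x, `|f (x + t *: ev R i) + f (x - t *: ev R i) - 2 * f x - t ^+ 2 * D2 i x|
                    <= B * `|t| ^+ 3,
      forall i j t x, `|D2 i (x + t *: ev R j) - D2 i x| <= B * `|t| &
      forall i x, `|D2 i x| <= B].

Lemma averaging_taylor A B f D1 D2 : averaging A -> taylor B f D1 D2 ->
  taylor B (A f) (fun i => A (D1 i)) (fun i => A (D2 i)).
Proof.
move=> hA [h1 h2 h3 h4]; split => [i t x|i t x|i j t x|i x].
- rewrite averaging_shift // -averagingB // -mulNr -averaging_lin //.
  by apply: averaging_bound => // y; rewrite mulNr.
- pose k y := f (y + t *: ev R i) + 1 * f (y - t *: ev R i) + (-2) * f y + (- t ^+ 2) * D2 i y.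
  have -> : A f (x + t *: ev R i) + A f (x - t *: ev R i) - 2 * A f x - t ^+ 2 * A (D2 i) x = A k x.
    by rewrite /k !averaging_lin // !averaging_shift //; ring.
  apply: averaging_bound => // y.
  by rewrite /k mul1r !mulNr.
- rewrite averaging_shift // -averagingB //.
  exact: averaging_bound.
- exact: averaging_bound.
Qed.

Lemma taylorD (B B' c : R) f g D1 D2 E1 E2 : 0 <= c ->
  taylor B f D1 D2 -> taylor B' g E1 E2 ->
  taylor (B + c * B') (fun x => f x + c * g x) (fun i x => D1 i x + c * E1 i x)
    (fun i x => D2 i x + c * E2 i x).
Proof.
move=> c0 [h1 h2 h3 h4] [k1 k2 k3 k4].
have comb (a b a' b' : R) : `|a| <= a' -> `|b| <= b' -> `|a + c * b| <= a' + c * b'.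
  move=> aa bb; rewrite (le_trans (ler_normD _ _)) // lerD //.
  by rewrite normrM (ger0_norm c0) ler_wpM2l.
split => [i t x|i t x|i j t x|i x].
- have := comb _ _ _ _ (h1 i t x) (k1 i t x).
  rewrite mulrA -mulrDl; by congr (`|_| <= _); ring.
- have := comb _ _ _ _ (h2 i t x) (k2 i t x).
  rewrite mulrA -mulrDl; by congr (`|_| <= _); ring.
- have := comb _ _ _ _ (h3 i j t x) (k3 i j t x).
  rewrite mulrA -mulrDl; by congr (`|_| <= _); ring.
- exact: comb.
Qed.

Lemma taylor_le B B' f D1 D2 : B <= B' -> taylor B f D1 D2 -> taylor B' f D1 D2.
Proof.
move=> BB [h1 h2 h3 h4]; split => [i t x|i t x|i j t x|i x].
- by rewrite (le_trans (h1 _ _ _)) // ler_wpM2r // sqr_ge0.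
- by rewrite (le_trans (h2 _ _ _)) // ler_wpM2r // exprn_ge0.
- by rewrite (le_trans (h3 _ _ _ _)) // ler_wpM2r.
- exact: le_trans (h4 _ _) BB.
Qed.

Lemma prodop_walk_osc (h L : R) r f x : 0 <= h ->
  (forall j t x, `|f (x + t *: ev R j) - f x| <= L * `|t|) ->
  `|prodop (walk h) r f x - f x| <= (size r)%:R * (L * h).
Proof.
move=> h0 fL; elim: r x => [|j r IH] x /=; first by rewrite subrr normr0 mul0r.
set g := prodop _ _ f in IH *.
have -> : walk h j g x - f x = walk h j (fun y => g y - f y) x + (walk h j f x - f x).
  by rewrite averagingB ?addrA ?subrK //; exact: averaging_walk.
rewrite (le_trans (ler_normD _ _)) // -natr1 mulrDl mul1r lerD //.
  by apply: averaging_bound => //; exact: averaging_walk.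
rewrite walkE; have := fL j h x; have := fL j (- h) x; rewrite normrN (ger0_norm h0).
rewrite !ler_norml; lra.
Qed.

(** Consistency of the scheme: a step of the walk is the identity plus [h^2 / 4] times the
    Laplacian, up to a cubic error. Each coordinate adds its own Taylor error and the cost of moving
    [D2 j] back from an averaged point to [x]. *)
Lemma prodop_walk_taylor (h B : R) r f D1 D2 x : 0 <= h -> taylor B f D1 D2 ->
  `|prodop (walk h) r f x - f x - h ^+ 2 / 4 * \sum_(j <- r) D2 j x|
  <= (size r)%:R * (1 + (size r)%:R) * (B * h ^+ 3).
Proof.
move=> h0 tf; have [_ _ h3 _] := tf.
elim: r x => [|j r IH] x /=.
  by rewrite big_nil mulr0 subr0 subrr normr0 !mul0r.
rewrite big_cons.
have avr : averaging (prodop (walk h) r) by apply: averaging_prodop; exact: averaging_walk.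
have [_ k2 _ _] := averaging_taylor avr tf.
set g := prodop (walk h) r f in IH k2 *.
have o := prodop_walk_osc r x h0 (h3 j).
have e1 := k2 j h x; have e2 := IH x.
rewrite walkE -(natr1 (size r)) scaleNr.
set n : R := (size r)%:R in e2 o *; set W := prodop (walk h) r (D2 j) x in o e1.
set S := \sum_(i <- r) _ in e2 *.
have n0 : 0 <= n by exact: ler0n.
rewrite (ger0_norm h0) in e1.
have -> : (g (x + h *: ev R j) + g (x - h *: ev R j) + 2 * g x) / 4 - f x
   - h ^+ 2 / 4 * (D2 j x + S) =
  (g (x + h *: ev R j) + g (x - h *: ev R j) - 2 * g x - h ^+ 2 * W) / 4
  + h ^+ 2 / 4 * (W - D2 j x) + (g x - f x - h ^+ 2 / 4 * S) by field.
have Bh0 : 0 <= B * h ^+ 3 by exact: le_trans e1.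
rewrite (le_trans (ler_normD _ _)) // (le_trans (lerD (ler_normD _ _) e2)) //.
have e3 : `|h ^+ 2 / 4 * (W - D2 j x)| <= n * (B * h ^+ 3) / 4.
  rewrite normrM ger0_norm ?divr_ge0 ?sqr_ge0 //.
  rewrite (le_trans (ler_wpM2l _ o)) ?divr_ge0 ?sqr_ge0 //.
  by rewrite le_eqVlt; apply/orP; left; apply/eqP; field.
rewrite normrM (ger0_norm (x := 4^-1)) ?invr_ge0 //.
have nz := mulr_ge0 n0 Bh0; move: e1 e3 Bh0 nz.
have -> : (n + 1) * (1 + (n + 1)) * (B * h ^+ 3) =
  n * (1 + n) * (B * h ^+ 3) + 2 * (n * (B * h ^+ 3)) + 2 * (B * h ^+ 3) by ring.
move: (B * h ^+ 3) => z; move: (n * (1 + n) * z) => nn; move: (n * z) => nz.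
by move: `|_| => a; move: `|_| => b; lra.
Qed.

End HeatBounds.

(** * Discrete heat potentials *)

Section Potential.
Context {R : realType} {d : nat}.
Notation vec := 'rV[R]_d.
Implicit Types (f g : vec -> R) (x v : vec) (i j : 'I_d) (F G : nat -> vec -> R).

(** Explicit scheme for the heat equation with source [F] and time step [h^2 / 4]; [k] counts steps
    backwards from the terminal time, where the potential vanishes. *)
Fixpoint potential (h : R) F (k : nat) : vec -> R :=
  if k is k'.+1 then fun x => heat h 1 (potential h F k') x + h ^+ 2 / 4 * F k x
  else fun=> 0.

(** Duhamel's formula. *)
Lemma potentialE h F k x :
  potential h F k x = \sum_(l < k) h ^+ 2 / 4 * heat h l (F (k - l)%N) x.
Proof.
elim: k x => [|k IH] x; first by rewrite big_ord0.
rewrite big_ord_recl /= subn0 heat0 addrC; congr (_ + _).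
have -> : potential h F k = fun x => \sum_(l < k) h ^+ 2 / 4 * heat h l (F (k - l)%N) x.
  by apply/funext.
rewrite (averaging_sum (averaging_heat h 1) k (fun l => heat h l (F (k - l)%N))).
by apply: eq_bigr => l _; rewrite /bump /= add1n -heatS.
Qed.

Lemma potential_taylor h F D1 D2 B k : (forall k, taylor B (F k) (D1 k) (D2 k)) ->
  taylor (k%:R * (h ^+ 2 / 4) * B) (potential h F k)
    (fun i => potential h (fun k => D1 k i) k) (fun i => potential h (fun k => D2 k i) k).
Proof.
move=> tF; elim: k => [|k IH].
  split => *; rewrite /= !(mul0r, mulr0, subr0, addr0, normr0, oppr0) //.
have := taylorD _ (averaging_taylor (averaging_heat h 1) IH) (tF k.+1).
move=> /(_ (h ^+ 2 / 4)); rewrite divr_ge0 ?sqr_ge0 // => /(_ isT).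
by apply: taylor_le; rewrite -(natr1 k) le_eqVlt; apply/orP; left; apply/eqP; ring.
Qed.

(** The residual is expressed with second derivatives at the new level [k.+1], since that is where
    the maximum principle looks at the potential. Passing there from level [k] costs one more factor
    [h]. *)
Lemma potential_step h F D1 D2 (B B1 : R) k x : 0 <= h <= 1 -> 0 <= B ->
  (forall k, taylor B (F k) (D1 k) (D2 k)) -> k%:R * (h ^+ 2 / 4) * B <= B1 ->
  `|potential h F k.+1 x - potential h F k x - h ^+ 2 / 4 *
     (\sum_j potential h (fun k => D2 k j) k.+1 x + F k.+1 x)|
  <= h ^+ 2 / 4 * (h * (d%:R * (4 * (1 + d%:R) * B1 + d%:R * B1 + B))).
Proof.
move=> /andP[h0 h1] B0 tF BB; set dl := h ^+ 2 / 4.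
have dl0 : 0 <= dl by rewrite divr_ge0 ?sqr_ge0.
have tk := taylor_le BB (potential_taylor h k tF).
have e1 := prodop_walk_taylor (enum 'I_d) x h0 tk.
have [_ _ t3 _] := tk; have [_ _ _ F4] := tF k.+1.
have e2 j : `|potential h (fun k => D2 k j) k.+1 x - potential h (fun k => D2 k j) k x|
    <= d%:R * (B1 * h) + dl * B.
  rewrite /= addrAC (le_trans (ler_normD _ _)) // lerD //.
    have := prodop_walk_osc (enum 'I_d) x h0 (t3 j).
    by rewrite size_enum_ord.
  by rewrite normrM (ger0_norm dl0) ler_wpM2l.
rewrite size_enum_ord -/dl big_enum /= in e1.
set S1 := \sum_j _; set S0 := \sum_(j : 'I_d) _ in e1.
have e3 : `|S1 - S0| <= d%:R * (d%:R * (B1 * h) + dl * B).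
  rewrite /S1 /S0 -sumrB (le_trans (ler_norm_sum _ _ _)) //.
  rewrite (le_trans (ler_sum _ (fun j _ => e2 j))) // sumr_const card_ord.
  by rewrite -[leLHS]mulr_natl.
have -> : potential h F k.+1 x - potential h F k x - dl * (S1 + F k.+1 x) =
  (heat h 1 (potential h F k) x - potential h F k x - dl * S0) - dl * (S1 - S0).
  by rewrite /= -/dl; ring.
rewrite (le_trans (ler_normB _ _)) //.
have e4 : `|dl * (S1 - S0)| <= dl * (d%:R * (d%:R * (B1 * h) + dl * B)).
  by rewrite normrM (ger0_norm dl0) ler_wpM2l.
rewrite (le_trans (lerD e1 e4)) //.
rewrite -subr_ge0; set X := _ - _.
have -> : X = dl * d%:R * B * (h - dl) by rewrite /X /dl; field.
rewrite !mulr_ge0 // subr_ge0 /dl expr2.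
have := ler_wpM2l h0 h1; lra.
Qed.

(** Comparison with the integral of [t^(-ga)], integrable at 0 because [ga < 1]. The inductive step
    is the concavity of [t^(1-ga)], in the form of Young's inequality [q^th <= th q + 1 - th]. *)
Lemma sum_powR_le (ga dl : R) k : 0 < ga < 1 -> 0 < dl ->
  \sum_(l < k) dl * (l.+1%:R * dl) `^ (- ga) <= (k%:R * dl) `^ (1 - ga) / (1 - ga).
Proof.
move=> /andP[g0 g1] dl0; elim: k => [|k IH].
  by rewrite big_ord0 divr_ge0 ?powR_ge0 // subr_ge0 ltW.
rewrite big_ord_recr /= (le_trans (lerD IH (lexx _))) //.
set th : R := 1 - ga; have th0 : 0 < th by rewrite subr_gt0.
rewrite ler_pdivlMr // mulrDl divfK ?gt_eqF //.
set a := k.+1%:R * dl; have a0 : 0 < a by rewrite mulr_gt0 // ltr0n.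
have ab : k%:R * dl = a * (k%:R / k.+1%:R).
  by rewrite /a; field; rewrite nat1r pnatr_eq0.
set q := k%:R / k.+1%:R in ab; have q0 : 0 <= q by rewrite divr_ge0.
have a1 : dl = a * (1 - q).
  by rewrite /a /q -(natr1 k); field; rewrite natr1 pnatr_eq0.
rewrite ab powRM // ?(ltW a0) //.
have -> : dl * a `^ (- ga) * th = a `^ th * (th * (1 - q)).
  rewrite {1}a1 /th powRD ?gt_eqF ?implybT // powRr1 ?(ltW a0) //; ring.
rewrite -mulrDr -[leRHS]mulr1 ler_pM2l ?powR_gt0 //.
have := @conjugate_powR R (q `^ th) 1 th^-1 ga^-1 (powR_ge0 _ _) ler01.
rewrite !invr_gt0 th0 g0 !invrK /th subrK => /(_ isT isT erefl).
rewrite -powRrM divff ?gt_eqF // powRr1 // mulr1 powR1 -/th mul1r.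
rewrite (_ : ga = 1 - th); last by rewrite /th; ring.
by move: (q `^ th) => z; clearbody th; lra.
Qed.

End Potential.

(** * Lipschitz bound for the discrete heat potential *)

Section PotentialGradient.
Context {R : realType} {d : nat}.
Notation vec := 'rV[R]_d.
Implicit Types (f g : vec -> R) (x v : vec) (i j : 'I_d) (F G : nat -> vec -> R).

(** The gradient of the heat semigroup from L^p to L^oo blows up like [t^(-heat_exp p)]; the
    exponent is below 1 exactly when p > d. [heat_cst] contains the integral of this power over
    [0, T]. *)
Definition heat_exp (p : R) : R := (1 + d%:R / p) / 2.
Definition heat_cst (p T : R) : R :=
  (1 + Num.sqrt T) `^ (d%:R / p) * (T `^ (1 - heat_exp p) / (1 - heat_exp p)).

Lemma heat_exp_itv p : d%:R < p -> 0 < heat_exp p < 1.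
Proof.
move=> dp; have p0 : 0 < p by apply: le_lt_trans dp.
have q0 : 0 <= d%:R / p by rewrite divr_ge0 // ltW.
have q1 : d%:R / p < 1 by rewrite ltr_pdivrMr // mul1r.
rewrite /heat_exp; apply/andP; split; lra.
Qed.

Lemma heat_cst_ge0 p T : d%:R < p -> 0 <= heat_cst p T.
Proof.
move=> /heat_exp_itv /andP[_ g1].
by rewrite mulr_ge0 ?powR_ge0 // divr_ge0 ?powR_ge0 // subr_ge0 ltW.
Qed.

(** Duhamel's formula with [heat_diff] at each heat time [s = (l+1) h^2 / 4]. The number [N^d] of
    grid points cancels the factor [h^d] from the binomial bounds, so the estimate is uniform in
    N. *)
Lemma potential_diff (N : nat) F p (L T : R) i k x (h := (N%:R : R)^-1) :
  (0 < N)%N -> d%:R < p -> 0 <= L -> k%:R * (h ^+ 2 / 4) <= T ->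
  (forall k, perN h N (F k)) ->
  (forall k y, prodop (gridsum h N) (enum 'I_d) (fun y => `|F k y| `^ p) y <=
     N%:R ^+ d * L `^ p) ->
  `|potential h F k (x + h *: ev R i) - potential h F k x| <= h * (heat_cst p T * L).
Proof.
move=> N0 dp L0 kT pF FL.
(* The index [i] witnesses that d is positive, hence p > 1. *)
have d1 : 1 <= d%:R :> R by case: {+}d i => [[]//|d' _]; rewrite ler1n.
have p1 : 1 <= p by rewrite (le_trans d1) // ltW.
have p0 : 0 < p by exact: lt_le_trans p1.
have N0' : 0 < N%:R :> R by rewrite ltr0n.
have h0 : 0 < h by rewrite invr_gt0.
have dl0 : 0 < h ^+ 2 / 4 by rewrite divr_gt0 ?exprn_gt0.
set dl := h ^+ 2 / 4 in kT dl0 *.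
have sdl : Num.sqrt dl = h / 2.
  have -> : dl = (h / 2) ^+ 2 by rewrite /dl; field.
  by rewrite sqrtr_sqr ger0_norm // divr_ge0 // ltW.
rewrite !potentialE -/dl -sumrB.
rewrite (le_trans (ler_norm_sum _ _ _)) //.
pose Cp := (1 + Num.sqrt T) `^ (d%:R / p).
apply: (@le_trans _ _ (\sum_(l < k) h * (Cp * L) * (dl * (l.+1%:R * dl) `^ (- heat_exp p)))).
  apply: ler_sum => l _.
  rewrite -mulrBr normrM (ger0_norm (ltW dl0)) mulrCA ler_pM2l //.
  rewrite (le_trans (heat_diff l i x N0 p1 (pF _) (FL _))) //.
  set s := l.+1%:R * dl.
  have s0 : 0 < s by rewrite mulr_gt0 // ltr0n.
  have sT : s <= T by rewrite (le_trans _ kT) // ler_pM2r // ler_nat.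
  have ss0 : 0 < Num.sqrt s by rewrite sqrtr_gt0.
  have l0 : 0 < Num.sqrt (l.+1%:R : R) by rewrite sqrtr_gt0 ltr0n.
  have hs : 2 / Num.sqrt l.+1%:R = h / Num.sqrt s.
    rewrite /s sqrtrM ?ler0n // sdl; field.
    by rewrite !gt_eqF.
  rewrite hs -[N%:R^-1]/h.
  have thE : h + h / Num.sqrt s = h * (1 + (Num.sqrt s)^-1) by rewrite mulrDr mulr1.
  rewrite thE exprMn -!mulrA mulrCA [_ * (N%:R ^+ d * _)]mulrCA [h ^+ d * _]mulrA -exprMn mulVf ?gt_eqF // expr1n mul1r.
  set w := (Num.sqrt s)^-1; have w0 : 0 < w by rewrite invr_gt0.
  have wE : w = s `^ (- 2^-1) by rewrite powRN powR12_sqrt ?ltW.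
  have w1 : 0 <= 1 + w by rewrite addr_ge0 // ltW.
  have -> : ((1 + w) ^+ d * L `^ p) `^ p^-1 = (1 + w) `^ (d%:R / p) * L.
    rewrite powRM ?exprn_ge0 ?powR_ge0 // -powR_mulrn // -!powRrM.
    by rewrite divff ?gt_eqF // powRr1.
  rewrite [leRHS]mulrCA ler_pM2l //.
  (* The summand 1 comes from the term [1 / N] of [binavg_sup], that is, from the mean over the
     torus. On times [s <= T] it is absorbed into [w], the inverse square root of [s]. *)
  have ww : 1 + w <= (1 + Num.sqrt T) * w.
    rewrite mulrDl mul1r addrC lerD2l ler_pdivlMr // mul1r.
    exact: ler_wsqrtr.
  have dp0 : 0 <= d%:R / p by rewrite divr_ge0 // ltW.
  have : (1 + w) `^ (d%:R / p) <= Cp * w `^ (d%:R / p).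
    rewrite /Cp -powRM ?addr_ge0 ?sqrtr_ge0 ?(ltW w0) //.
    by rewrite ge0_ler_powR ?nnegrE // mulr_ge0 ?addr_ge0 ?sqrtr_ge0 // ltW.
  have -> : s `^ (- heat_exp p) = w * w `^ (d%:R / p).
    rewrite -{1}(powRr1 (ltW w0)) -powRD ?(gt_eqF w0) ?implybT // {1}wE -powRrM.
    by congr (_ `^ _); rewrite /heat_exp; field; rewrite gt_eqF.
  move=> h2.
  have -> : Cp * (L * (w * w `^ (d%:R / p))) = w * (Cp * w `^ (d%:R / p) * L) by ring.
  by rewrite ler_pM2l // ler_wpM2r.
rewrite -mulr_sumr -!mulrA ler_pM2l // /heat_cst -/Cp.
rewrite ler_wpM2l ?powR_ge0 // mulrA [leLHS]mulrC ler_wpM2r //.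
have := sum_powR_le k (heat_exp_itv dp) dl0; move/le_trans; apply.
have /andP[g0 g1] := heat_exp_itv dp.
have kd0 : 0 <= k%:R * dl by rewrite mulr_ge0 // ltW.
have T0 : 0 <= T by exact: le_trans kT.
by rewrite ler_pM2r ?invr_gt0 ?subr_gt0 // ge0_ler_powR ?nnegrE ?subr_ge0 // ltW.
Qed.

End PotentialGradient.

(** * Riemann sums and iterated integrals *)

Section RiemannSums.
Context {R : realType}.
Notation mu := (@lebesgue_measure R).
Implicit Types (psi : R -> R) (a b L : R).

Definition lip L psi := forall a b, `|psi a - psi b| <= L * `|a - b|.

Lemma lip_continuous L psi : lip L psi -> continuous (psi : R -> R^o).
Proof.
move=> lp x; apply/cvgrPdist_le => e e0.
have [L0|L0] := leP L 0.
  exists 1 => //= t _.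
  by rewrite (le_trans (lp _ _)) // (le_trans _ (ltW e0)) // mulr_le0_ge0.
exists (e / L); rewrite /= ?divr_gt0 // => t /= /ltW.
by rewrite ler_pdivlMr // mulrC; exact: le_trans.
Qed.

Lemma lip_integrable L psi a b : lip L psi ->
  mu.-integrable `[a, b]%classic (EFin \o psi).
Proof.
move=> /lip_continuous cp; apply: continuous_compact_integrable.
  exact: segment_compact.
exact: continuous_subspaceT.
Qed.

Lemma Rintegral_itv_cst a b (c : R) : a <= b ->
  (\int[mu]_(t in `[a, b]%classic) c = c * (b - a))%R.
Proof.
move=> ab; rewrite Rintegral_cst //= lebesgue_measure_itv /= lte_fin.
case: ltP => //= ba; have -> : b = a by apply/le_anti; rewrite ba ab.
by rewrite subrr.
Qed.

Lemma Rintegral_le_cst L psi (c : R) : lip L psi ->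
  (forall t, 0 <= t <= 1 -> psi t <= c) -> Rintegral mu `[0, 1]%classic psi <= c.
Proof.
move=> lp pc; rewrite -[leRHS]mulr1 -[X in _ * X](subr0 1) -Rintegral_itv_cst //.
apply: le_Rintegral => //.
- exact: lip_integrable lp.
- by apply: (@lip_integrable 0) => x y; rewrite subrr normr0 mul0r.
Qed.

Lemma Rintegral_dist L1 L2 psi1 psi2 (c : R) : lip L1 psi1 -> lip L2 psi2 ->
  (forall t, `|psi1 t - psi2 t| <= c) ->
  `|Rintegral mu `[0, 1]%classic psi1 - Rintegral mu `[0, 1]%classic psi2| <= c.
Proof.
move=> l1 l2 h; have i1 := lip_integrable 0 1 l1; have i2 := lip_integrable 0 1 l2.
have lB : lip (L1 + L2) (fun t => psi1 t - psi2 t).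
  move=> a b; have -> : psi1 a - psi2 a - (psi1 b - psi2 b) = (psi1 a - psi1 b) - (psi2 a - psi2 b) by ring.
  by rewrite (le_trans (ler_normB _ _)) // mulrDl lerD.
rewrite -RintegralB // (le_trans (le_normr_Rintegral _ _)) //.
  exact: lip_integrable lB.
apply: (@Rintegral_le_cst (L1 + L2)) => // a b.
exact: le_trans (ler_dist_dist _ _) (lB a b).
Qed.

Lemma Rintegral_itv_incr L psi a b (c : R) : lip L psi -> 0 <= a <= b ->
  (forall t, a <= t <= b -> c <= psi t) ->
  c * (b - a) <= Rintegral mu `[0, b]%classic psi - Rintegral mu `[0, a]%classic psi.
Proof.
move=> lp /andP[a0 ab] h.
rewrite Rintegral_itvB ?bnd_simp //; last exact: lip_integrable lp.
rewrite Rintegral_itv_obnd_cbnd; last first.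
  apply: integrableS (lip_integrable a b lp) => //; apply: subset_itvr.
  by rewrite bnd_simp.
rewrite -Rintegral_itv_cst //; apply: le_Rintegral => //.
- by apply: (@lip_integrable 0) => x y; rewrite subrr normr0 mul0r.
- exact: lip_integrable lp.
Qed.

Lemma periodicz psi : (forall t, psi (t + 1) = psi t) -> forall (k : int) t, psi (t + k%:~R) = psi t.
Proof.
move=> per; have pern (n : nat) t : psi (t + n%:R) = psi t.
  by elim: n => [|n IH]; rewrite ?addr0 // -natr1 addrA per.
case=> n t; first exact: pern.
by rewrite NegzE mulrNz -[in RHS](subrK (n.+1%:R) t) pern.
Qed.

(** By periodicity the grid may start at an offset [rho] in [0, 1/N]; each sample is then compared
    with the integral over its own cell, at distance at most 1/N. *)
Lemma riemann_sum_le L psi (N : nat) x : (0 < N)%N -> lip L psi ->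
  (forall t, psi (t + 1) = psi t) ->
  \sum_(a < N) psi (x + a%:R * N%:R^-1) <=
  N%:R * (Rintegral mu `[0, 1]%classic psi + L / N%:R).
Proof.
move=> N0 lp per; have N0' : 0 < N%:R :> R by rewrite ltr0n.
have N1 : N%:R != 0 :> R by rewrite gt_eqF.
set h := N%:R^-1; have h0 : 0 < h by rewrite invr_gt0.
pose k := Num.floor (x * N%:R); pose rho := x - k%:~R * h.
have rho0 : 0 <= rho.
  by rewrite subr_ge0 /h ler_pdivrMr // floor_le.
have rhoh : rho <= h.
  rewrite lerBlDr /h -[X in X + _]mul1r -mulrDl ler_pdivlMr // ltW //.
  by have := floorD1_gt (x * N%:R); rewrite -/k intrD addrC.
have step n : (n <= N)%N -> \sum_(a < n) (psi (rho + a%:R * h) - L * h) * h <=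
   Rintegral mu `[0, n%:R * h]%classic psi.
  elim: n => [|n IH] nN.
    by rewrite big_ord0 mul0r set_itv1 Rintegral_set1.
  rewrite big_ord_recr /=.
  have H : (psi (rho + n%:R * h) - L * h) * (n.+1%:R * h - n%:R * h) <=
      Rintegral mu `[0, n.+1%:R * h]%classic psi - Rintegral mu `[0, n%:R * h]%classic psi.
    apply: (Rintegral_itv_incr lp).
      by rewrite mulr_ge0 ?(ltW h0) //= ler_pM2r // ler_nat.
    move=> t /andP[t1 t2].
    have := le_trans (ler_norm _) (lp (rho + n%:R * h) t).
    have L0 : 0 <= L by have := lp 1 0; rewrite subr0 normr1 mulr1; exact: le_trans.
    have : L * `|rho + n%:R * h - t| <= L * h.
      rewrite ler_wpM2l // ler_norml; apply/andP.
      move: t2; rewrite -(natr1 n) mulrDl mul1r; split; lra.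
    by lra.
  have e : n.+1%:R * h - n%:R * h = h by rewrite -(natr1 n); ring.
  rewrite e in H; have := IH (ltnW nN); lra.
pose phi (l : nat) := psi (x + l%:R * h).
have pphi l : phi (l + N)%N = phi l.
  by rewrite /phi natrD mulrDl divff // addrA per.
(* The summation index is a natural number, so the shift by [-k] is replaced by [|k| N - k >= 0],
   which differs from it by whole periods. *)
have [q qE] : exists q : nat, q%:Z = (absz k)%:Z * N%:Z - k.
  exists (absz ((absz k)%:Z * N%:Z - k)%R); rewrite gez0_abs // subr_ge0.
  rewrite (le_trans (ler_norm k)) // -abszE ler_peMr // lez_nat //.
rewrite -[leLHS](sum_periodic q pphi) (_ : \sum_(a < N) _ = \sum_(a < N) psi (rho + a%:R * h)); last first.
  apply: eq_bigr => l _; rewrite /phi natrD.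
  have -> : (q%:R : R) = (absz k)%:R * N%:R - k%:~R.
    by rewrite -[LHS]/((q%:Z)%:~R) qE intrB intrM.
  have -> : x + ((absz k)%:R * N%:R - k%:~R + l%:R) * h = (rho + l%:R * h) + (absz k)%:Z%:~R.
    by rewrite -[(absz k)%:Z%:~R]/((absz k)%:R : R) /rho /h; field.
  by rewrite periodicz.
have := step N (leqnn N); rewrite divff // -mulr_suml big_split /= sumr_const card_ord.
rewrite -[X in _ + X]mulr_natl; set S := \sum_(a < N) _ => H.
rewrite -(ler_pM2r h0); have -> : N%:R * (Rintegral mu `[0, 1]%classic psi + L / N%:R) * h =
  Rintegral mu `[0, 1]%classic psi + L * h by rewrite /h; field.
move: H; rewrite mulrDl mulrN mulNr -mulrA [N%:R * _]mulrC mulfVK //; lra.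
Qed.

End RiemannSums.

(** * Grid sums against iterated integrals *)

Section IteratedIntegral.
Context {R : realType} {d : nat}.
Notation vec := 'rV[R]_d.
Implicit Types (f phi : vec -> R) (x y : vec) (i j : 'I_d) (r : seq 'I_d).

Definition coordlip (L : R) phi := forall j t x, `|phi (x + t *: ev R j) - phi x| <= L * `|t|.

Lemma setc_shift x j s : setc x j (x 0 j + s) = x + s *: ev R j.
Proof.
apply/rowP => k; rewrite !mxE; case: eqVneq => [e|ne].
  have -> : k = j by apply/val_inj.
  by rewrite !eqxx mulr1.
have /negbTE -> : k != j by apply: contraNneq ne => ->.
by rewrite andbF mulr0 addr0.
Qed.

Lemma setc_move x j s t : setc x j t = setc x j s + (t - s) *: ev R j.
Proof.
apply/rowP => k; rewrite !mxE; case: (eqVneq k j) => [->|ne].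
  by rewrite !eqxx mulr1 addrC subrK.
by rewrite (negbTE (ne : (k : nat) != j)) andbF mulr0 addr0.
Qed.

Lemma setc_other x i j s t : i != j -> setc (x + s *: ev R i) j t = setc x j t + s *: ev R i.
Proof.
move=> ij; apply/rowP => k; rewrite !mxE; case: eqVneq => // e.
have -> : k = j by apply/val_inj.
by rewrite eq_sym (negbTE ij) andbF mulr0 addr0.
Qed.

Lemma setc_same x j s t : setc (x + s *: ev R j) j t = setc x j t.
Proof.
apply/rowP => k; rewrite !mxE; case: eqVneq => // ne.
have /negbTE -> : k != j by apply: contraNneq ne => ->.
by rewrite andbF mulr0 addr0.
Qed.

Lemma coordlip_setc L phi x j : coordlip L phi -> lip L (fun t => phi (setc x j t)).
Proof. by move=> lp s t; rewrite (setc_move x j t s). Qed.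

Lemma coordlip_iint L phi n : (n <= d)%N -> coordlip L phi -> coordlip L (iint n 0 1 phi).
Proof.
move=> nd lp; elim: n nd => [|n IH] nd //= j t x.
have {}IH := IH (ltnW nd).
pose jn := Ordinal nd; have jnE : n = jn :> nat by [].
rewrite {1 2}jnE; case: (eqVneq j jn) => [->|ne].
  under eq_Rintegral do rewrite setc_same.
  by rewrite subrr normr0 (le_trans (normr_ge0 _) (lp j t x)).
under eq_Rintegral do rewrite setc_other //.
apply: (Rintegral_dist (L1 := L) (L2 := L)) => [||s]; last exact: IH.
- have -> : (fun s => iint n 0 1 phi (setc x jn s + t *: ev R j)) =
    (fun s => iint n 0 1 phi (setc (x + t *: ev R j) jn s)).
    by apply/funext => s; rewrite setc_other.
  exact: (coordlip_setc _ jn IH).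
- exact: (coordlip_setc _ jn IH).
Qed.

Lemma iint_per phi n : (n <= d)%N -> (forall x j, phi (x + ev R j) = phi x) ->
  forall x j, iint n 0 1 phi (x + ev R j) = iint n 0 1 phi x.
Proof.
move=> nd pp; elim: n nd => [|n IH] nd //= x j.
pose jn := Ordinal nd; have jnE : n = jn :> nat by [].
apply: eq_Rintegral => t _; rewrite {2 4}jnE -(scale1r (ev R j)).
case: (eqVneq j jn) => [->|ne]; first by rewrite setc_same.
by rewrite setc_other // scale1r IH // ltnW.
Qed.

Lemma iint_indep phi n x y : (forall j, (n <= j)%N -> x 0 j = y 0 j) ->
  iint n 0 1 phi x = iint n 0 1 phi y.
Proof.
elim: n x y => [|n IH] x y xy /=.
  by congr phi; apply/rowP => j; exact: xy.
apply: eq_Rintegral => t _; apply: IH => j nj; rewrite !mxE.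
by case: eqVneq => // ne; apply: xy; rewrite ltn_neqAle eq_sym ne.
Qed.

Lemma iint_ge0 (a b : R) phi n x : (forall x, 0 <= phi x) -> 0 <= iint n a b phi x.
Proof.
move=> p0; elim: n x => [|n IH] x /=; first exact: p0.
by apply: Rintegral_ge0.
Qed.

Lemma iint_le L phi n (c : R) x : (n <= d)%N -> coordlip L phi ->
  (forall x, phi x <= c) -> iint n 0 1 phi x <= c.
Proof.
move=> nd lp pc; elim: n nd x => [|n IH] nd x /=; first exact: pc.
apply: (@Rintegral_le_cst _ L); last by move=> t _; apply: IH; exact: ltnW.
exact: (coordlip_setc x (Ordinal nd) (coordlip_iint (ltnW nd) lp)).
Qed.

(** One Riemann sum per coordinate. The list [r] is decreasing because the outermost integral in
    [iint] is over the coordinate of largest index. *)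
Lemma gridsum_iint_le L phi (N n : nat) r x : (0 < N)%N -> (n <= d)%N ->
  coordlip L phi -> (forall x j, phi (x + ev R j) = phi x) ->
  map val r = rev (iota 0 n) ->
  prodop (gridsum N%:R^-1 N) r phi x <=
  N%:R ^+ n * (iint n 0 1 phi x + n%:R * (L / N%:R)).
Proof.
move=> N0 + lp pp; elim: n r x => [|n IH] r x nd.
  by case: r => //= _; rewrite mul1r mul0r addr0.
rewrite -addn1 iotaD add0n rev_cat /= addn1; case: r => //= j r [jn rE].
have jE : n = j :> nat by [].
have lp' := coordlip_iint (ltnW nd) lp.
pose psi t := iint n 0 1 phi (setc x j t).
apply: (@le_trans _ _ (\sum_(a < N) N%:R ^+ n * (psi (x 0 j + a%:R * N%:R^-1) + n%:R * (L / N%:R)))).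
  apply: ler_sum => a _; rewrite /psi setc_shift.
  by apply: IH => //; exact: ltnW.
have per t : psi (t + 1) = psi t.
  rewrite /psi (setc_move x j t (t + 1)) (_ : t + 1 - t = 1); last by ring.
  by rewrite scale1r iint_per // ltnW.
have := riemann_sum_le (x 0 j) N0 (coordlip_setc x j lp' : lip L psi) per.
rewrite -mulr_sumr exprSr -mulrA => H; rewrite ler_wpM2l ?exprn_ge0 //.
rewrite big_split /= sumr_const card_ord -[X in _ + X]mulr_natl.
have -> : Rintegral lebesgue_measure `[0, 1]%classic (fun t => iint n 0 1 phi (setc x n t)) =
  Rintegral lebesgue_measure `[0, 1]%classic psi by rewrite /psi -jE.
by rewrite (le_trans (lerD H (lexx _))) // -mulrDr -(natr1 n) mulrDl mul1r -addrA [L / _ + _]addrC.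
Qed.

Lemma gridsumC h N i j f : gridsum h N i (gridsum h N j f) = gridsum h N j (gridsum h N i f).
Proof.
apply/funext => x; rewrite /gridsum exchange_big; apply: eq_bigr => a _ /=.
by apply: eq_bigr => b _; rewrite addrAC.
Qed.

Lemma prodop_gridsum_rev h N r f : prodop (gridsum h N) (rev r) f = prodop (gridsum h N) r f.
Proof.
elim: r => [|j r IH] //; rewrite rev_cons -cats1 [RHS]/= -/(prodop _ r f) -IH.
rewrite /prodop foldr_cat /=.
by elim: (rev r) => [|k s] //= ->; rewrite gridsumC.
Qed.

Lemma gridsum_box_le L phi (N : nat) x : (0 < N)%N ->
  coordlip L phi -> (forall x j, phi (x + ev R j) = phi x) ->
  prodop (gridsum N%:R^-1 N) (enum 'I_d) phi x <=
  N%:R ^+ d * (box_int 0 1 phi + d%:R * (L / N%:R)).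
Proof.
move=> N0 lp pp; rewrite -prodop_gridsum_rev.
rewrite (le_trans (gridsum_iint_le (n := d) x N0 _ lp pp _)) //.
  by rewrite map_rev val_enum_ord.
by rewrite /box_int (@iint_indep phi d x 0) // => j; rewrite leqNgt ltn_ord.
Qed.

End IteratedIntegral.

(** * Derivatives and smooth functions *)

Section LineDerivatives.
Local Open Scope classical_set_scope.
Context {R : realType}.

(** The endpoints come in either order, so that increments of both signs are covered at once. *)
Definition btw (a b c : R) := (a <= c <= b) || (b <= c <= a).

Lemma btw_dist a b c : btw a b c -> `|c - a| <= `|b - a|.
Proof.
case/orP => /andP[h1 h2].
  by rewrite !ger0_norm ?subr_ge0 ?(le_trans h1) // lerD2r.
by rewrite !ler0_norm ?subr_le0 ?(le_trans h1) // lerN2 lerD2r.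
Qed.

Lemma btw_norm a b c M : btw a b c -> `|a| <= M -> `|b| <= M -> `|c| <= M.
Proof.
by rewrite !ler_norml => /orP[] /andP[h1 h2] /andP[h3 h4] /andP[h5 h6];
  apply/andP; split; lra.
Qed.

Lemma mvt_between (g dg : R -> R) (t : R) : (forall s : R, is_derive s 1 g (dg s)) ->
  exists2 s, btw 0 t s & g t - g 0 = t * dg s.
Proof.
move=> dgg.
have cg : continuous (g : R -> R^o).
  move=> s; apply/differentiable_continuous/derivable1_diffP.
  exact: ex_derive.
have [t0|t0] := leP 0 t.
  have [//|c ct e] := @MVT_segment R g dg 0 t t0 (fun s _ => dgg s).
    exact: continuous_subspaceT.
  exists c; last by rewrite e subr0 mulrC.
  by rewrite /btw; move: ct; rewrite in_itv /= => ->.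
have [//|c ct e] := @MVT_segment R g dg t 0 (ltW t0) (fun s _ => dgg s).
  exact: continuous_subspaceT.
exists c; last by rewrite -opprB e sub0r mulrN opprK mulrC.
by rewrite /btw; move: ct; rewrite in_itv /= => ->; rewrite orbT.
Qed.

Section Line.
Context {V : normedModType R}.
Implicit Types (f : V -> R) (x v : V).

Lemma line_is_derive f x v t : derivable f (x + t *: v) v ->
  is_derive t 1 (fun s => f (x + s *: v)) ('D_v f (x + t *: v)).
Proof.
move=> df.
have E : (fun h => h^-1 *: (((fun s => f (x + s *: v)) \o shift t) (h *: 1) - f (x + t *: v)))
  = (fun h => h^-1 *: ((f \o shift (x + t *: v)) (h *: v) - f (x + t *: v))).
  apply/funext => h /=; congr (_ *: (f _ - _)).
  by rewrite [_%:A]mulr1 scalerDl addrCA.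
by apply: DeriveDef; rewrite /derivable /derive E.
Qed.

Lemma line_mvt f x v t : (forall y, derivable f y v) ->
  exists2 s, btw 0 t s & f (x + t *: v) - f x = t * 'D_v f (x + s *: v).
Proof.
move=> df; have [s st e] := mvt_between t (fun s => @line_is_derive f x v s (df _)).
by exists s => //; rewrite -e scale0r addr0.
Qed.

End Line.

Lemma cvg_row d (T : Type) (F : set_system T) {FF : Filter F} (f : T -> 'rV[R]_d) (l : 'rV[R]_d) :
  (forall k, (fun t => f t 0 k) @ F --> l 0 k) -> f @ F --> l.
Proof.
move=> fl; apply/cvgrPdist_le => /= e e0; near=> x.
rewrite /Num.Def.normr/= mx_normrE (bigmax_le _ (ltW e0))//= => -[i j] _.
rewrite !mxE/= ord1.
move: j; near: x; apply: filter_forall => /= j.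
by move/cvgrPdist_le : (fl j); exact.
Unshelve. all: by end_near. Qed.

(** The mean value theorem along a path that changes one coordinate at a time: partial derivatives
    suffice, and the intermediate points stay in the box spanned by [q] and [q']. *)
Lemma coord_path d (f : 'rV[R]_d -> R) (q q' : 'rV[R]_d) :
  (forall k x, derivable f x (ev R k)) ->
  exists2 xi : 'I_d -> 'rV[R]_d, (forall k j, btw (q 0 j) (q' 0 j) (xi k 0 j)) &
    f q' - f q = \sum_k (q' 0 k - q 0 k) * pd k f (xi k).
Proof.
move=> df.
have btwl a b : btw a b a by rewrite /btw !lexx andbT /= le_total.
have btwr a b : btw a b b by rewrite /btw !lexx andbT /= le_total.
pose mix (r : seq 'I_d) : 'rV[R]_d := \row_j (if j \in r then q' 0 j else q 0 j).
suff H r : uniq r -> exists2 xi : 'I_d -> 'rV[R]_d,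
    (forall k j, btw (q 0 j) (q' 0 j) (xi k 0 j)) &
    f (mix r) - f q = \sum_(k <- r) (q' 0 k - q 0 k) * pd k f (xi k).
  have [xi h1 h2] := H _ (enum_uniq 'I_d); exists xi => //.
  rewrite big_enum /= in h2; rewrite -h2; congr (f _ - _).
  by apply/rowP => j; rewrite mxE mem_enum.
elim: r => [_|k r IH /= /andP[kr ur]].
  exists (fun=> q) => //; rewrite big_nil (_ : mix [::] = q) ?subrr //.
  by apply/rowP => j; rewrite mxE.
have [xi h1 h2] := IH ur.
have mixE : mix (k :: r) = mix r + (q' 0 k - q 0 k) *: ev R k.
  apply/rowP => j; rewrite !mxE inE.
  case: (eqVneq j k) => [->|jk] /=; last by rewrite mulr0 addr0.
  by rewrite (negbTE kr) mulr1 addrC subrK.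
have [s sb e] := line_mvt (mix r) (q' 0 k - q 0 k) (df k).
pose y := mix r + s *: ev R k.
exists (fun l => if l == k then y else xi l).
  move=> l j; case: eqVneq => [_|_]; last exact: h1.
  rewrite !mxE; case: (eqVneq j k) => [->|jk] /=; last first.
    by rewrite mulr0 addr0; case: ifP.
  rewrite (negbTE kr) mulr1; move: sb; rewrite /btw => /orP[] /andP[a b].
    by apply/orP; left; apply/andP; split; lra.
  by apply/orP; right; apply/andP; split; lra.
rewrite big_cons eqxx mixE -(subrK (f (mix r)) (f (_ + _))) -addrA e h2 -/y; congr (_ + _).
rewrite big_seq [RHS]big_seq; apply: eq_bigr => l lr.
by case: (eqVneq l k) => // lk; move: kr; rewrite -lk lr.
Qed.

Section Partial.
Context {V W : normedModType R}.

Lemma quot_fst (K : V * W -> R) x y v :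
  (fun h => h^-1 *: ((fun x => K (x, y)) (h *: v + x) - K (x, y))) =
  (fun h : R => h^-1 *: (K (h *: (v, 0) + (x, y)) - K (x, y))).
Proof.
apply/funext => h; congr (_ *: (K _ - _)).
by apply/pair_equal_spec; rewrite /= scaler0 add0r.
Qed.

Lemma quot_snd (K : V * W -> R) x y v :
  (fun h => h^-1 *: ((fun y => K (x, y)) (h *: v + y) - K (x, y))) =
  (fun h : R => h^-1 *: (K (h *: (0, v) + (x, y)) - K (x, y))).
Proof.
apply/funext => h; congr (_ *: (K _ - _)).
by apply/pair_equal_spec; rewrite /= scaler0 add0r.
Qed.

Lemma derivable_fst (K : V * W -> R) x y v : derivable K (x, y) (v, 0) ->
  derivable (fun x => K (x, y)) x v.
Proof. by rewrite /derivable /= quot_fst. Qed.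

Lemma derive_fst (K : V * W -> R) x y v :
  'D_v (fun x => K (x, y)) x = 'D_(v, 0) K (x, y).
Proof. by rewrite /derive /= quot_fst. Qed.

Lemma derivable_snd (K : V * W -> R) x y v : derivable K (x, y) (0, v) ->
  derivable (fun y => K (x, y)) y v.
Proof. by rewrite /derivable /= quot_snd. Qed.

Lemma derive_snd (K : V * W -> R) x y v :
  'D_v (fun y => K (x, y)) y = 'D_(0, v) K (x, y).
Proof. by rewrite /derive /= quot_snd. Qed.

End Partial.

End LineDerivatives.

(** * Smoothness of compositions *)

Section Smooth.
Local Open Scope classical_set_scope.
Context {R : realType}.

Section General.
Context {V : normedModType R}.
Implicit Types (f g : V -> R^o) (x v : V).

Lemma smoothC_continuous f : smoothC f -> continuous f.
Proof. by move=> /(_ [::]). Qed.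

Lemma smoothC_derivable f x v : smoothC f -> derivable f x v.
Proof. by move=> /(_ [:: v]) [+ _]; exact. Qed.

Lemma smoothC_derive f v : smoothC f -> smoothC ('D_v f).
Proof. by move=> sf vs; have [] := sf (v :: vs). Qed.

(** [smoothC] is the greatest class of continuous functions closed under directional derivatives, so
    any such class proves its members smooth. *)
Lemma smoothC_coind (P : (V -> R^o) -> Prop) :
  (forall f, P f -> continuous f /\ forall v, exists2 g, P g & forall x, is_derive x v f (g x)) ->
  forall f, P f -> smoothC f.
Proof.
move=> HP f Pf vs; elim: vs f Pf => [|v vs IH] f Pf /=.
  by have [] := HP _ Pf.
have [_ /(_ v) [g Pg fg]] := HP _ Pf; split=> [x|]; first by have [] := fg x.
have -> : 'D_v f = g by apply/funext => x; have [] := fg x.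
exact: IH.
Qed.

Lemma smoothC_cst (c : R) : smoothC (cst c : V -> R^o).
Proof.
apply: (@smoothC_coind (fun f => exists c, f = cst c)); last by exists c.
move=> _ [b ->]; split; first by move=> x; exact: cvg_cst.
by move=> v; exists (cst 0); [exists 0|move=> x; exact: is_derive_cst].
Qed.

End General.

Section Composition.
Context {d : nat}.
Notation vec := 'rV[R]_d.
Notation V := (vec * R)%type.
Variable (G : 'I_d -> V -> R^o).
Hypothesis smG : forall k, smoothC (G k).

(** With [G] the spatial gradient of u, composition with this map produces H(x, Du(x, t)). *)
Definition graphmap (z : V) : (vec * vec)%type := (z.1, \row_k G k z).

Lemma continuous_graphmap : continuous graphmap.
Proof.
move=> [x t].
have h1 : (fst : V -> vec) @ ((x, t) : V) --> x by exact: cvg_fst.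
have h2 : (fun z => \row_k G k z) @ ((x, t) : V) --> (\row_k G k (x, t) : vec).
  apply: cvg_row => k; rewrite mxE; under eq_fun do rewrite mxE.
  exact: smoothC_continuous.
exact: (cvg_pair h1 h2).
Qed.

(** Chain rule from continuous directional derivatives. The increment of [K] is split into a move in
    the first argument and coordinate moves in the second; the mean value points [th] and [xi]
    converge to the base point. *)
Lemma is_derive_graphmap (K : (vec * vec)%type -> R^o) z v : smoothC K ->
  is_derive z v (K \o graphmap)
    ('D_(v.1, 0) K (graphmap z) +
     \sum_k 'D_(0, ev R k) K (graphmap z) * 'D_v (G k) z).
Proof.
move=> sK.
set D := _ + _.
have main : (fun h => h^-1 *: (((K \o graphmap) \o shift z) (h *: v) - (K \o graphmap) z)) @ 0^' --> (D : R^o).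
  pose q (h : R) : vec := \row_k G k (h *: v + z).
  pose q0 : vec := \row_k G k z.
  have dK1 y x : derivable (fun x => K (x, y)) x v.1.
    by apply: derivable_fst; exact: smoothC_derivable.
  have dK2 k y : derivable (fun y => K (z.1, y)) y (ev R k).
    by apply: derivable_snd; exact: smoothC_derivable.
  have /choice [th thP] : forall h : R, exists s, btw 0 h s /\
      K (z.1 + h *: v.1, q h) - K (z.1, q h) = h * 'D_(v.1, 0) K (z.1 + s *: v.1, q h).
    move=> h; have [s sb e] := @line_mvt R _ (fun x => K (x, q h)) z.1 v.1 h
      (fun y => dK1 _ y).
    by exists s; split; [exact: sb | rewrite e derive_fst].
  have /choice [xi xiP] : forall h : R, exists xi : 'I_d -> vec,
      (forall k j, btw (q0 0 j) (q h 0 j) (xi k 0 j)) /\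
      K (z.1, q h) - K (z.1, q0) = \sum_k (q h 0 k - q0 0 k) * 'D_(0, ev R k) K (z.1, xi k).
    move=> h; have [xi x1 x2] := @coord_path R d (fun y => K (z.1, y)) q0 (q h)
      (fun k y => dK2 k y).
    exists xi; split; [exact: x1|]; rewrite x2; apply: eq_bigr => k _.
    by rewrite /pd derive_snd.
  have E : (fun h => h^-1 *: (((K \o graphmap) \o shift z) (h *: v) - (K \o graphmap) z)) =
    (fun h => h^-1 * h * 'D_(v.1, 0) K (z.1 + th h *: v.1, q h) +
      \sum_k 'D_(0, ev R k) K (z.1, xi h k) * (h^-1 * (G k (h *: v + z) - G k z))).
    apply/funext => h.
    have -> : ((K \o graphmap) \o shift z) (h *: v) - (K \o graphmap) z =
      (K (z.1 + h *: v.1, q h) - K (z.1, q h)) + (K (z.1, q h) - K (z.1, q0)).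
      by rewrite addrA subrK /= /graphmap /= [h *: v.1 + _]addrC.
    rewrite (thP h).2 (xiP h).2 [LHS]mulrDr mulrA mulr_sumr; congr (_ + _).
    by apply: eq_bigr => k _; rewrite !mxE; ring.
  have cz : (fun h : R => h *: v + z) @ 0^' --> z.
    have : {for 0, continuous (fun h : R => h *: v + z)}.
      by apply: cvgD; [apply: cvgZr_tmp; exact: cvg_id|exact: cvg_cst].
    by move/continuous_withinNx; rewrite scale0r add0r.
  have cq k : (fun h => q h 0 k) @ 0^' --> q0 0 k.
    rewrite mxE; under eq_fun do rewrite mxE.
    apply: (@cvg_comp _ _ _ (fun h : R => h *: v + z) (G k)).
      exact: cz.
    exact: smoothC_continuous (smG k) z.
  have cq' : q @ 0^' --> q0 by apply: cvg_row.
  have cth : (fun h => th h) @ 0^' --> (0 : R^o).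
    apply/cvgrPdist_le => /= e e0; near=> h.
    rewrite sub0r normrN (le_trans _ (_ : `|h| <= e)) //.
      by have := btw_dist (thP h).1; rewrite !subr0.
    by near: h; exact: dnbhs0_le.
  rewrite E; apply: cvgD.
    rewrite -[X in _ --> X]mul1r; apply: cvgM.
      apply: cvg_near_cst; near=> h; rewrite mulVf //.
      by near: h; exact: nbhs_dnbhs_neq.
    apply: (@cvg_comp _ _ _ (fun h => (z.1 + th h *: v.1, q h)) ('D_(v.1, 0) K) _ (nbhs (graphmap z)) _); last first.
      exact: (@smoothC_continuous _ _ (smoothC_derive (v.1, 0) sK) (graphmap z)).
    have h1 : (fun h => z.1 + th h *: v.1) @ 0^' --> z.1.
      rewrite -[X in _ --> X]addr0 -(scale0r v.1); apply: cvgD; first exact: cvg_cst.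
      exact: cvgZr_tmp.
    exact: (cvg_pair h1 cq').
  apply: cvg_big => [|k _]; first exact: add_continuous.
  apply: cvgM.
    apply: (@cvg_comp _ _ _ (fun h => (z.1, xi h k)) ('D_(0, ev R k) K) _ (nbhs (graphmap z)) _); last first.
      exact: (@smoothC_continuous _ _ (smoothC_derive (0, ev R k) sK) (graphmap z)).
    have h1 : (fun h : R => z.1) @ 0^' --> z.1 by exact: cvg_cst.
    suff h2 : (fun h => xi h k) @ 0^' --> q0 by exact: (cvg_pair h1 h2).
    apply: cvg_row => j.
    have /cvgrPdist_le cqj := cq j; apply/cvgrPdist_le => /= e e0.
    apply: filterS (cqj e e0) => h; apply: le_trans.
    rewrite distrC [leRHS]distrC; exact: btw_dist ((xiP h).1 k j).
  exact: (@smoothC_derivable _ (G k) z v (smG k)).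
by apply: DeriveDef; [apply/cvg_ex; exists D | exact: cvg_lim].
Unshelve. all: by end_near. Qed.


(** A class that contains the compositions with [graphmap] and is closed under differentiation by
    the chain and product rules, as [smoothC_coind] demands. *)
Inductive graphclass : (V -> R^o) -> Prop :=
| graphclass_smooth f : smoothC f -> graphclass f
| graphclass_comp K : smoothC K -> graphclass (K \o graphmap)
| graphclass_add f g : graphclass f -> graphclass g -> graphclass (f + g)
| graphclass_mul f g : graphclass f -> graphclass g -> graphclass (f * g).

Lemma graphclass_sum n (f : 'I_n -> V -> R^o) : (forall k, graphclass (f k)) ->
  graphclass (\sum_k f k).
Proof.
move=> fk; apply: (big_ind graphclass) => //; last exact: graphclass_add.
apply: graphclass_smooth; exact: smoothC_cst.
Qed.

Lemma graphclass_smoothC f : graphclass f -> smoothC f.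
Proof.
apply: smoothC_coind => {}f; elim => {f} [f sf|K sK|f g _ [cf df] _ [cg dg]|f g cF [cf df] cG [cg dg]].
- split; first exact: smoothC_continuous.
  move=> v; exists ('D_v f); first by apply: graphclass_smooth; exact: smoothC_derive.
  by move=> x; apply: derivableP; exact: smoothC_derivable.
- split.
    move=> z; apply: continuous_comp; first exact: continuous_graphmap.
    exact: smoothC_continuous.
  move=> v; exists (('D_(v.1, 0) K \o graphmap) + \sum_k (('D_(0, ev R k) K \o graphmap) * 'D_v (G k))).
    apply: graphclass_add; first by apply: graphclass_comp; exact: smoothC_derive.
    apply: graphclass_sum => k; apply: graphclass_mul.
      by apply: graphclass_comp; exact: smoothC_derive.
    by apply: graphclass_smooth; exact: smoothC_derive.
  move=> z; apply: is_derive_eq; first exact: is_derive_graphmap.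
  by rewrite /= fctE fct_sumE.
- split; first by move=> z; apply: cvgD; [exact: cf|exact: cg].
  move=> v; have [f' f1 f2] := df v; have [g' g1 g2] := dg v.
  by exists (f' + g'); [exact: graphclass_add | move=> z; exact: is_deriveD].
- split; first by move=> z; apply: cvgM; [exact: cf|exact: cg].
  move=> v; have [f' f1 f2] := df v; have [g' g1 g2] := dg v.
  exists (f * g' + g * f').
    by apply: graphclass_add; apply: graphclass_mul.
  by move=> z; exact: is_deriveM.
Qed.

End Composition.
End Smooth.

(** * Periodic functions *)

Section OneVariable.
Local Open Scope classical_set_scope.
Context {R : realType}.
Implicit Types g : R -> R.

Lemma taylor1_le g g1 g2 (B t : R) :
  (forall s : R, is_derive s 1 g (g1 s)) -> (forall s : R, is_derive s 1 g1 (g2 s)) ->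
  (forall s, btw 0 t s -> `|g2 s| <= B) -> `|g t - g 0 - t * g1 0| <= B * t ^+ 2.
Proof.
move=> d1 d2 gB.
have btw00 a b : btw 0 a b -> btw 0 t a -> btw 0 t b.
  by rewrite /btw => /orP[] /andP[h1 h2] /orP[] /andP[h3 h4]; apply/orP;
    (have [t0|t0] := leP 0 t; [left|right]); apply/andP; split; lra.
have [s st ->] := mvt_between t d1.
have [r rs e] := mvt_between s d2.
rewrite -mulrBr e !normrM expr2 -[t * t]ger0_norm -?expr2 ?sqr_ge0 // expr2 normrM mulrCA mulrA.
rewrite [`|t| * _]mulrC -!mulrA; have := gB _ (btw00 _ _ rs st).
have := btw_dist st; rewrite !subr0 => st' gr.
have B0 : 0 <= B by exact: le_trans gr.
rewrite mulrCA [leRHS]mulrCA ler_wpM2l // mulrC.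
by apply: ler_pM.
Qed.

(** [taylor1_le] applied to [K s = g s + g (- s) - s^2 g2 0], whose first derivative vanishes at 0
    and whose second derivative is at most [2 B |s|]. *)
Lemma taylor2_le g g1 g2 (B t : R) :
  (forall s : R, is_derive s 1 g (g1 s)) -> (forall s : R, is_derive s 1 g1 (g2 s)) ->
  (forall s, `|g2 s - g2 0| <= B * `|s|) -> 0 <= B ->
  `|g t + g (- t) - 2 * g 0 - t ^+ 2 * g2 0| <= 2 * B * `|t| ^+ 3.
Proof.
move=> d1 d2 gB B0.
have dN (k k' : R -> R) : (forall s : R, is_derive s 1 k (k' s)) ->
    forall s : R, is_derive s 1 (k \o -%R) (- k' (- s)).
  move=> dk s; have := @is_derive1_comp _ k -%R s _ _ (dk (- s)) (is_deriveNid s 1).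
  by rewrite mulrN1.
have dsq (c s : R) : is_derive s 1 (id * id * cst c : R -> R) (2 * s * c).
  apply: is_derive_eq; rewrite /GRing.scale /= /cst; ring.
have dlin (c s : R) : is_derive s 1 (cst 2 * id * cst c : R -> R) (2 * c).
  apply: is_derive_eq; rewrite /GRing.scale /= /cst; ring.
pose K : R -> R := g + (g \o -%R) - (id * id * cst (g2 0)).
pose K1 : R -> R := g1 - (g1 \o -%R) - (cst 2 * id * cst (g2 0)).
pose K2 : R -> R := fun s => g2 s + g2 (- s) - 2 * g2 0.
have dK (s : R) : is_derive s 1 K (K1 s).
  have dNg := dN _ _ d1 s; have dg := d1 s; have ds := dsq (g2 0) s.
  exact: is_deriveB.
have dK1 (s : R) : is_derive s 1 K1 (K2 s).
  have dNg := dN _ _ d2 s; have dg := d2 s; have ds := dlin (g2 0) s.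
  apply: is_derive_eq; rewrite /K2 opprK //.
have := @taylor1_le K K1 K2 (2 * B * `|t|) t dK dK1.
have KE r : K r = g r + g (- r) - r * r * g2 0 by [].
have K10 : K1 0 = 0 by rewrite -[K1 0]/(g1 0 - g1 (- 0) - 2 * 0 * g2 0) oppr0; ring.
rewrite !KE K10 oppr0 !mul0r mulr0 !subr0.
have -> : g t + g (- t) - t * t * g2 0 - (g 0 + g 0) = g t + g (- t) - 2 * g 0 - t ^+ 2 * g2 0 by ring.
have -> : 2 * B * `|t| ^+ 3 = 2 * B * `|t| * t ^+ 2 by rewrite -(real_normK (num_real t)); ring.
apply => s /btw_dist; rewrite !subr0 => st.
have -> : K2 s = (g2 s - g2 0) + (g2 (- s) - g2 0) by rewrite /K2; ring.
rewrite (le_trans (ler_normD _ _)) //.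
have := gB s; have := gB (- s); rewrite normrN.
have := ler_wpM2l B0 st; lra.
Qed.

End OneVariable.

Section Torus.
Local Open Scope classical_set_scope.
Context {R : realType} {d : nat}.
Notation vec := 'rV[R]_d.
Notation V := (vec * R)%type.
Implicit Types (f : V -> R^o) (x y : vec) (t T : R) (i j : 'I_d).

Definition tper f := forall x t j, f (x + ev R j, t) = f (x, t).

Lemma tper_derive f v : tper f -> tper ('D_v f).
Proof.
move=> pf x t j.
have E : (fun h => h^-1 *: ((f \o shift (x + ev R j, t)) (h *: v) - f (x + ev R j, t))) =
    (fun h => h^-1 *: ((f \o shift (x, t)) (h *: v) - f (x, t))).
  apply/funext => h /=; rewrite pf; congr (_ *: (_ - _)).
  case: v => v s; rewrite -[RHS](pf (h *: v + x) (h * s + t) j); congr (f _).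
  by apply/pair_equal_spec; rewrite /= addrA.
by rewrite /derive E.
Qed.

Lemma periodic_shift (f : vec -> R) (z : 'I_d -> int) x :
  (forall x j, f (x + ev R j) = f x) -> f (x + \sum_j (z j)%:~R *: ev R j) = f x.
Proof.
move=> pf; elim: (index_enum _) x => [|j r IH] x; first by rewrite big_nil addr0.
rewrite big_cons addrA IH.
have := @periodicz R (fun s => f (x + s *: ev R j)) _ (z j) 0.
rewrite add0r scale0r addr0; apply=> s.
by rewrite scalerDl scale1r addrA pf.
Qed.

Lemma torus_repr x : exists y, exists2 z : 'I_d -> int,
  (forall j, 0 <= y 0 j <= 1) & x = y + \sum_j (z j)%:~R *: ev R j.
Proof.
pose z j := Num.floor (x 0 j).
exists (\row_j (x 0 j - (z j)%:~R)); exists z => [j|].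
  rewrite mxE /z; have /andP[h1 h2] := floor_itv (x 0 j).
  by rewrite intrD in h2; apply/andP; split; lra.
apply/rowP => j; rewrite !mxE summxE (bigD1 j) //= big1 => [|k kj].
  by rewrite !mxE !eqxx mulr1 addr0 subrK.
by rewrite !mxE eq_sym (negbTE kj) andbF mulr0.
Qed.

Definition box T : set V := [set z : V | (forall j, 0 <= z.1 0 j <= 1) /\ 0 <= z.2 <= T].

Lemma compact_box T : compact (box T).
Proof.
have -> : box T = [set v : vec | forall j, `[0, 1]%classic (v ord0 j)] `*` `[0, T]%classic.
  apply/seteqP; split => -[v s] /=.
    by case=> h1 h2; split; [move=> j; rewrite /= in_itv /=; exact: h1 | rewrite in_itv].
  by case=> h1; rewrite in_itv => h2; split => // j; have := h1 j; rewrite /= in_itv.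
apply: compact_setX; last exact: segment_compact.
exact: (@rV_compact R d (fun=> (`[(0 : R), 1]%classic : set R)) (fun=> @segment_compact R 0 1)).
Qed.

Lemma tper_bounded f T : continuous f -> tper f ->
  exists2 B, 0 <= B & forall x t, 0 <= t <= T -> `|f (x, t)| <= B.
Proof.
move=> cf pf.
have cb : compact (f @` box T).
  by apply: continuous_compact; [exact: continuous_subspaceT | exact: compact_box].
have [M [_ /(_ (Num.max 0 M + 1))]] := compact_bounded cb.
set B := _ + 1; have BM : M < B.
  by rewrite /B (le_lt_trans (_ : M <= Num.max 0 M)) ?le_max ?lexx ?orbT // ltrDl.
move=> /(_ BM) h; exists B.
  by rewrite addr_ge0 // le_max lexx.
move=> x t tT; have [y [z yb ->]] := torus_repr x.
rewrite (@periodic_shift (fun x => f (x, t))) //.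
by apply: h; exists (y, t).
Qed.

Lemma family_bound (P : 'I_d -> R -> Prop) :
  (forall i B B', P i B -> B <= B' -> P i B') ->
  (forall i, exists2 B, 0 <= B & P i B) -> exists2 B, 0 <= B & forall i, P i B.
Proof.
move=> mono h; have /choice [B BP] : forall i, exists B, 0 <= B /\ P i B.
  by move=> i; have [B] := h i; exists B.
exists (\sum_i B i); first by apply: sumr_ge0 => i _; have [] := BP i.
move=> i; have [_ Pi] := BP i; apply: mono Pi _.
by rewrite (bigD1 i) //= lerDl sumr_ge0 // => j _; have [] := BP j.
Qed.

Lemma space_line f i x t (s : R) : smoothC f ->
  is_derive s 1 (fun s => f (x + s *: ev R i, t)) ('D_(ev R i, 0) f (x + s *: ev R i, t)).
Proof.
move=> sf; have E r : (x, t) + r *: (ev R i, 0 : R) = (x + r *: ev R i, t) :> V.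
  by apply/pair_equal_spec; rewrite /= scaler0 addr0.
have := @line_is_derive R V f (x, t) (ev R i, 0) s (@smoothC_derivable R V f _ _ sf).
by rewrite E; under [X in is_derive _ _ X _ -> _]eq_fun do rewrite E.
Qed.

Lemma time_line f x t (s : R) : smoothC f ->
  is_derive s 1 (fun s => f (x, t + s)) ('D_(0, 1) f (x, t + s)).
Proof.
move=> sf; have E r : (x, t) + r *: (0, 1 : R) = (x, t + r) :> V.
  by apply/pair_equal_spec; rewrite /= scaler0 addr0 [_ *: _]mulr1.
have := @line_is_derive R V f (x, t) (0, 1) s (@smoothC_derivable R V f _ _ sf).
by rewrite E; under [X in is_derive _ _ X _ -> _]eq_fun do rewrite E.
Qed.

Lemma space_osc f (B : R) j x t s : smoothC f ->
  (forall y, `|'D_(ev R j, 0) f (y, t)| <= B) ->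
  `|f (x + s *: ev R j, t) - f (x, t)| <= B * `|s|.
Proof.
move=> sf fB; have [r _] := mvt_between s (fun r => @space_line f j x t r sf).
by rewrite scale0r addr0 => ->; rewrite normrM mulrC ler_wpM2r.
Qed.

Lemma smoothC_taylor f T : smoothC f -> tper f -> exists2 B, 0 <= B &
  forall t, 0 <= t <= T -> taylor B (fun x => f (x, t))
    (fun i x => 'D_(ev R i, 0) f (x, t))
    (fun i x => 'D_(ev R i, 0) ('D_(ev R i, 0) f) (x, t)).
Proof.
move=> sf pf.
have sm (g : V -> R^o) (v : V) : smoothC g -> smoothC ('D_v g) by move=> sg; exact: smoothC_derive.
have [B B0 hB] : exists2 B, 0 <= B & forall i x t, 0 <= t <= T ->
    `|'D_(ev R i, 0) ('D_(ev R i, 0) f) (x, t)| <= B.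
  apply: (@family_bound (fun i B => forall x t, 0 <= t <= T -> `|'D_(ev R i, 0) ('D_(ev R i, 0) f) (x, t)| <= B)).
    by move=> i b b' hb bb x t tT; exact: le_trans (hb x t tT) bb.
  move=> i; apply: (@tper_bounded ('D_(ev R i, 0) ('D_(ev R i, 0) f))); last by do 2 apply: tper_derive.
  by apply: smoothC_continuous; do 2 apply: smoothC_derive.
have [C C0 hC] : exists2 C, 0 <= C & forall i j x t, 0 <= t <= T ->
    `|'D_(ev R j, 0) ('D_(ev R i, 0) ('D_(ev R i, 0) f)) (x, t)| <= C.
  apply: (@family_bound (fun i B => forall j x t, 0 <= t <= T -> `|'D_(ev R j, 0) ('D_(ev R i, 0) ('D_(ev R i, 0) f)) (x, t)| <= B)).
    by move=> i b b' hb bb j x t tT; exact: le_trans (hb j x t tT) bb.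
  move=> i; apply: (@family_bound (fun j B => forall x t, 0 <= t <= T -> `|'D_(ev R j, 0) ('D_(ev R i, 0) ('D_(ev R i, 0) f)) (x, t)| <= B)).
    by move=> j b b' hb bb x t tT; exact: le_trans (hb x t tT) bb.
  move=> j; apply: (@tper_bounded ('D_(ev R j, 0) ('D_(ev R i, 0) ('D_(ev R i, 0) f)))); last by do 3 apply: tper_derive.
  by apply: smoothC_continuous; do 3 apply: smoothC_derive.
exists (B + 2 * C); first by rewrite addr_ge0 // mulr_ge0.
move=> t tT.
have d1 i x := fun s => @space_line f i x t s sf.
have d2 i x := fun s => @space_line _ i x t s (sm _ (ev R i, 0) sf).
have osc i j x s : `|'D_(ev R i, 0) ('D_(ev R i, 0) f) (x + s *: ev R j, t) - 'D_(ev R i, 0) ('D_(ev R i, 0) f) (x, t)| <= C * `|s|.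
  apply: (@space_osc ('D_(ev R i, 0) ('D_(ev R i, 0) f))) => [|y]; first by do 2 apply: smoothC_derive.
  exact: hC.
split => [i s x|i s x|i j s x|i x].
- have := @taylor1_le R _ _ _ B s (d1 i x) (d2 i x) (fun r _ => hB i _ t tT).
  rewrite scale0r addr0 => /le_trans; apply.
  by rewrite ler_wpM2r ?sqr_ge0 // lerDl mulr_ge0.
- have := @taylor2_le R _ _ _ C s (d1 i x) (d2 i x) _ C0.
  rewrite scale0r addr0 scaleNr => /(_ (osc i i x)) /le_trans; apply.
  by rewrite ler_wpM2r ?exprn_ge0 // lerDr.
- rewrite (le_trans (osc i j x s)) // ler_wpM2r //; lra.
- rewrite (le_trans (hB i x t tT)) // lerDl mulr_ge0 //.
Qed.

Lemma smoothC_time f T : smoothC f -> tper f -> exists2 B, 0 <= B &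
  forall x t s, 0 <= t <= T -> 0 <= t + s <= T ->
   `|f (x, t + s) - f (x, t) - s * 'D_(0, 1) f (x, t)| <= B * s ^+ 2 /\ `|f (x, t + s) - f (x, t)| <= B * `|s|.
Proof.
move=> sf pf.
have sm (g : V -> R^o) (v : V) : smoothC g -> smoothC ('D_v g) by move=> sg; exact: smoothC_derive.
have [B1 B10 hB1] := tper_bounded T (smoothC_continuous (sm _ (0, 1) sf)) (tper_derive (0, 1) pf).
have [B2 B20 hB2] := tper_bounded T (smoothC_continuous (sm _ (0, 1) (sm _ (0, 1) sf))) (tper_derive (0, 1) (tper_derive (0, 1) pf)).
exists (B1 + B2); first by rewrite addr_ge0.
move=> x t s tT sT.
have inT r : btw 0 s r -> 0 <= t + r <= T.
  move: tT sT; rewrite /btw => /andP[h1 h2] /andP[h3 h4] /orP[] /andP[h5 h6]; apply/andP; split; lra.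
split.
  have := @taylor1_le R _ _ _ B2 s (fun r => @time_line f x t r sf)
    (fun r => @time_line _ x t r (sm _ (0, 1) sf)) (fun r rs => hB2 _ _ (inT r rs)).
  rewrite addr0 => /le_trans; apply.
  by rewrite ler_wpM2r ?sqr_ge0 // lerDr.
have [r rs] := mvt_between s (fun r => @time_line f x t r sf).
rewrite addr0 => ->; rewrite normrM mulrC ler_wpM2r //.
by rewrite (le_trans (hB1 _ _ (inT r rs))) // lerDl.
Qed.

End Torus.

(** * The Hamiltonian *)

Section Norms.
Local Open Scope classical_set_scope.
Context {R : realType} {d : nat}.
Notation vec := 'rV[R]_d.

Lemma enorm_coord (v : vec) j : `|v 0 j| <= enorm v.
Proof.
rewrite -sqrtr_sqr; apply: ler_wsqrtr; rewrite (bigD1 j) //= lerDl.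
by apply: sumr_ge0 => k _; exact: sqr_ge0.
Qed.

Lemma enorm_le (v : vec) (c : R) : 0 <= c -> (forall j, `|v 0 j| <= c) ->
  enorm v <= Num.sqrt d%:R * c.
Proof.
move=> c0 vc; rewrite -[X in _ * X]ger0_norm // -sqrtr_sqr -sqrtrM ?ler0n //.
apply: ler_wsqrtr; rewrite (_ : d%:R * c ^+ 2 = \sum_(j < d) c ^+ 2).
  2: by rewrite sumr_const card_ord mulr_natl.
apply: ler_sum => j _.
by rewrite -(real_normK (num_real (v 0 j))) lerXn2r ?nnegrE.
Qed.

End Norms.

Section Hamiltonian.
Local Open Scope classical_set_scope.
Context {R : realType} {d : nat}.
Notation vec := 'rV[R]_d.
Variable H : vec -> vec -> R.
Hypothesis sH : smoothC (fun z : (vec * vec)%type => H z.1 z.2).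
Hypothesis H1 : forall x q, 1 <= H x q.

Lemma H_derivable_p x k q : derivable (H x) q (ev R k).
Proof.
have := @derivable_snd R vec vec (fun z => H z.1 z.2) x q (ev R k).
by apply; exact: smoothC_derivable.
Qed.

Lemma H_derivable_x q k x : derivable (H ^~ q) x (ev R k).
Proof.
have := @derivable_fst R vec vec (fun z => H z.1 z.2) x q (ev R k).
by apply; exact: smoothC_derivable.
Qed.

Lemma HpE k x q : Hp H k x q = 'D_(0, ev R k) (fun z : (vec * vec)%type => H z.1 z.2) (x, q).
Proof. by rewrite -derive_snd. Qed.

Lemma H_lip_p (mu c2 C2 C8 : R) : 0 < mu -> 0 <= c2 -> 0 <= C2 ->
  (forall x q, H x q <= c2 * enorm q `^ (2 + mu) + C2) ->
  (forall x q, enorm (DpH H x q) ^+ 2 <= C8 * enorm q `^ mu * H x q + C8) ->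
  exists2 C, 0 <= C & forall (rho : R) x (q q' : vec), 1 <= rho ->
    (forall j, `|q 0 j| <= rho) -> (forall j, `|q' 0 j| <= rho) ->
    `|H x q' - H x q| <= C * rho `^ (1 + mu) * \sum_j `|q' 0 j - q 0 j|.
Proof.
move=> mu0 c20 C20 hc2 hC8.
(* [s] converts coordinate bounds into Euclidean ones; the added 1 ensures [s * rho >= 1], so that
   constants are dominated by powers of [s * rho]. *)
pose s : R := 1 + Num.sqrt d%:R; have s1 : 1 <= s by rewrite lerDl sqrtr_ge0.
pose A := `|C8| * (c2 + C2 + 1); have A0 : 0 <= A by rewrite mulr_ge0 // !addr_ge0.
exists (Num.sqrt A * s `^ (1 + mu)); first by rewrite mulr_ge0 ?sqrtr_ge0 ?powR_ge0.
move=> rho x q q' rho1 qr qr'.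
have rho0 : 0 <= rho by exact: le_trans rho1.
have [xi x1 ->] := coord_path q q' (@H_derivable_p x).
rewrite (le_trans (ler_norm_sum _ _ _)) // mulr_sumr; apply: ler_sum => k _.
rewrite normrM mulrC ler_wpM2r //.
have xr : enorm (xi k) <= s * rho.
  rewrite (le_trans (enorm_le rho0 (fun j => btw_norm (x1 k j) (qr j) (qr' j)))) //.
  by rewrite ler_wpM2r // lerDr.
have sr1 : 1 <= s * rho by rewrite -[1]mulr1 ler_pM.
have sr0 : 0 <= s * rho by exact: le_trans sr1.
have srn0 : s * rho != 0 by rewrite gt_eqF // (lt_le_trans ltr01 sr1).
have en0 : 0 <= enorm (xi k) by exact: sqrtr_ge0.
rewrite -mulrA -powRM ?(le_trans _ s1) //.
rewrite (le_trans (_ : _ <= enorm (DpH H x (xi k)))) //.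
  by have := enorm_coord (DpH H x (xi k)) k; rewrite mxE.
have e2 : (s * rho) `^ mu * (s * rho) `^ (2 + mu) = ((s * rho) `^ (1 + mu)) ^+ 2.
  rewrite -powRD; last by rewrite srn0 implybT.
  rewrite -powR_mulrn ?powR_ge0 // -powRrM; congr (_ `^ _); ring.
have pow1 (a : R) : 0 <= a -> 1 <= (s * rho) `^ a.
  move=> a0; have -> : 1 = 1 `^ a :> R by rewrite powR1.
  by rewrite ge0_ler_powR ?nnegrE.
have p1 : 1 <= ((s * rho) `^ (1 + mu)) ^+ 2.
  by rewrite exprn_ege1 // pow1 // addr_ge0 // ltW.
rewrite -[leLHS]ger0_norm ?sqrtr_ge0 // -sqrtr_sqr -[X in _ * X]ger0_norm ?powR_ge0 //.
rewrite -[X in _ * X]sqrtr_sqr -sqrtrM //; apply: ler_wsqrtr.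
rewrite (le_trans (hC8 _ _)) //.
have h1 : enorm (xi k) `^ mu <= (s * rho) `^ mu by rewrite ge0_ler_powR ?nnegrE // ltW.
have h2 : H x (xi k) <= (c2 + C2) * (s * rho) `^ (2 + mu).
  rewrite (le_trans (hc2 _ _)) // mulrDl lerD //.
    by rewrite ler_wpM2l // ge0_ler_powR ?nnegrE // addr_ge0 // ltW.
  by rewrite -[leLHS]mulr1 ler_wpM2l // pow1 // addr_ge0 // ltW.
have h3 : enorm (xi k) `^ mu * H x (xi k) <= (c2 + C2) * ((s * rho) `^ (1 + mu)) ^+ 2.
  rewrite -e2 mulrCA; apply: ler_pM => //.
  - exact: powR_ge0.
  - by rewrite (le_trans ler01).
move: p1 h3; set P := ((s * rho) `^ (1 + mu)) ^+ 2 => p1 h3.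
have -> : A * P = `|C8| * ((c2 + C2) * P) + `|C8| * P by rewrite /A; ring.
rewrite -mulrA lerD //.
  rewrite (le_trans (ler_norm _)) // normrM ler_wpM2l // ger0_norm //.
  by rewrite mulr_ge0 ?powR_ge0 // (le_trans _ (H1 _ _)).
by rewrite (le_trans (ler_norm _)) // -[leLHS]mulr1 ler_wpM2l.
Qed.

(** The tangent inequality of convexity, as the limit of difference quotients for l decreasing to 0.
    By [coord_path] the quotient is a combination of partial derivatives at points tending to
    [q]. *)
Lemma H_gradient_le x (q w : vec) :
  (forall l : R, 0 < l < 1 -> H x (q + l *: w) <= (1 - l) * H x q + l * H x (q + w)) ->
  \sum_k w 0 k * Hp H k x q <= H x (q + w) - H x q.
Proof.
move=> cvx.
have /choice [xi xiP] : forall l : R, exists xi : 'I_d -> vec,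
    (forall k j, btw (q 0 j) ((q + l *: w) 0 j) (xi k 0 j)) /\
    H x (q + l *: w) - H x q = \sum_k l * w 0 k * Hp H k x (xi k).
  move=> l; have [xi x1 x2] := coord_path q (q + l *: w) (@H_derivable_p x).
  exists xi; split=> [//|]; rewrite x2; apply: eq_bigr => k _.
  by rewrite !mxE [q 0 k + _]addrC addrK.
have cxi k : (fun l => xi l k) @ (0 : R)^'+ --> q.
  apply: cvg_row => j; apply/cvgrPdist_le => /= e e0; near=> l.
  rewrite distrC (le_trans (btw_dist ((xiP l).1 k j))) // !mxE [q 0 j + _]addrC addrK normrM.
  have w0 : 0 < 1 + `|w 0 j| by rewrite ltr_wpDr.
  rewrite (le_trans (_ : _ <= `|l| * (1 + `|w 0 j|))) //.
    by rewrite ler_wpM2l // lerDr.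
  rewrite -ler_pdivlMr // ger0_norm; last by near: l; exact: nbhs_right_ge.
  near: l; apply: nbhs_right_le; exact: divr_gt0.
have cs : (fun l => \sum_k w 0 k * Hp H k x (xi l k)) @ (0 : R)^'+ --> (\sum_k w 0 k * Hp H k x q : R^o).
  apply: cvg_big => [|k _]; first exact: add_continuous.
  apply: cvgM; first exact: cvg_cst.
  rewrite HpE; under eq_fun do rewrite HpE.
  apply: (@cvg_comp _ _ _ (fun l => (x, xi l k))
    ('D_(0, ev R k) (fun z : (vec * vec)%type => H z.1 z.2 : R^o)) _ (nbhs ((x, q) : (vec * vec)%type)) _).
    have h1 : (fun l : R => x) @ (0 : R)^'+ --> x by exact: cvg_cst.
    exact: (cvg_pair h1 (cxi k)).
  exact: (@smoothC_continuous _ _ _ (smoothC_derive (0, ev R k) sH) (x, q)).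
apply/ler_addgt0Pl => e e0.
move/cvgrPdist_le: cs => /(_ e e0) cs; near (0 : R)^'+ => l.
have l0 : 0 < l by near: l; exact: nbhs_right_gt.
have l1 : l < 1 by near: l; exact: nbhs_right_lt.
have : `|\sum_k w 0 k * Hp H k x q - \sum_k w 0 k * Hp H k x (xi l k)| <= e.
  by near: l; exact: cs.
rewrite ler_norml => /andP[_].
have -> : \sum_k w 0 k * Hp H k x (xi l k) = (H x (q + l *: w) - H x q) / l.
  rewrite (xiP l).2 mulr_suml; apply: eq_bigr => k _; field; exact: lt0r_neq0.
have : (H x (q + l *: w) - H x q) / l <= H x (q + w) - H x q.
  rewrite ler_pdivrMr // ; have := cvx l; rewrite l0 l1 => /(_ isT); lra.
lra.
Unshelve. all: by end_near. Qed.


(** Tangent inequality at [p = r q] in the direction [q - p = (1/r - 1) p], where D_pH . p is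
    [Lhat + H]. Multiplying by [r] leaves [H + (1 - r) Lhat], and (A3) bounds [Lhat] below. *)
Lemma H_scale_ge (c C : R) :
  (forall x q1 q2 (l : R), q1 != q2 -> 0 < l < 1 ->
     H x (l *: q1 + (1 - l) *: q2) < l * H x q1 + (1 - l) * H x q2) ->
  (forall x q, c * H x q - C <= Lhat H x q) ->
  forall x q (r : R), 0 < r <= 1 ->
    H x (r *: q) + (1 - r) * (c * H x (r *: q) - C) <= r * H x q.
Proof.
move=> cvx hL x q r /andP[r0 r1]; set p := r *: q.
have qE : q = p + (r^-1 - 1) *: p.
  by rewrite scalerBl scale1r addrCA subrr addr0 /p scalerA mulVf ?gt_eqF // scale1r.
set w := (r^-1 - 1) *: p in qE.
have wE : w = q - p by rewrite qE addrC addKr.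
have := @H_gradient_le x p w; rewrite -qE.
have -> : \sum_k w 0 k * Hp H k x p = (r^-1 - 1) * (Lhat H x p + H x p).
  by rewrite /Lhat subrK mulr_sumr; apply: eq_bigr => k _; rewrite !mxE; ring.
have h l : 0 < l < 1 -> H x (p + l *: w) <= (1 - l) * H x p + l * H x q.
  move=> l01; have -> : p + l *: w = l *: q + (1 - l) *: p.
    by rewrite wE scalerBr scalerBl scale1r addrCA.
  have [->|qp] := eqVneq q p; first by rewrite -scalerDl addrCA subrr addr0 scale1r -mulrDl subrK mul1r.
  by rewrite [leRHS]addrC; apply/ltW/cvx.
move=> /(_ h) h2; have := hL x p; move: h2; rewrite -(ler_pM2l r0).
have -> : r * ((r^-1 - 1) * (Lhat H x p + H x p)) = (1 - r) * (Lhat H x p + H x p).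
  by field; exact: lt0r_neq0.
have r10 : 0 <= 1 - r by rewrite subr_ge0.
move=> h2 h3; have := ler_wpM2l r10 h3; lra.
Qed.

(** Since H >= 1, (A5) gives |D_xH| <= D H, so ln H is D-Lipschitz along the axes. The inequality
    exp z <= 1 + 2 z on [0, 1/2] explains both [C' = 2 D] and the restriction on [s]. *)
Lemma H_growth_x (C : R) :
  (forall x q, enorm (DxH H x q) <= C * H x q + C) ->
  exists2 C', 0 < C' & forall i x q (s : R), C' * `|s| <= 1 ->
    H (x + s *: ev R i) q <= (1 + C' * `|s|) * H x q.
Proof.
move=> hC; pose D : R := 2 * `|C| + 1; have D0 : 0 < D by rewrite ltr_wpDl // mulr_ge0.
exists (2 * D); first by rewrite mulr_gt0.
move=> i x q s sD.
have dH x' : `|pd i (H ^~ q) x'| <= D * H x' q.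
  have := enorm_coord (DxH H x' q) i; rewrite mxE => /le_trans; apply.
  rewrite (le_trans (hC _ _)) //; have := H1 x' q; have := ler_norm C.
  have h0 : 0 <= H x' q by exact: le_trans (H1 _ _).
  move=> CC h1; have := ler_wpM2r h0 CC; have := ler_wpM2l (normr_ge0 C) h1; rewrite /D; lra.
pose g r := H (x + r *: ev R i) q.
have g0 r : 0 < g r by rewrite (lt_le_trans ltr01) // H1.
have dg (r : R) : is_derive r 1 g (pd i (H ^~ q) (x + r *: ev R i)).
  exact: (@line_is_derive R vec (H ^~ q) x (ev R i) r (@H_derivable_x q i _)).
have dlng (r : R) : is_derive r 1 (@ln R \o g) ((g r)^-1 * pd i (H ^~ q) (x + r *: ev R i)).
  exact: (@is_derive1_comp R (@ln R) g r _ _ (is_derive1_ln (g0 r)) (dg r)).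
have [r _ e] := mvt_between s dlng.
have : `|ln (g s) - ln (g 0)| <= `|s| * D.
  rewrite -[ln (g s)]/((@ln R \o g) s) -[ln (g 0)]/((@ln R \o g) 0) e normrM ler_wpM2l //.
  rewrite normrM gtr0_norm ?invr_gt0 // mulrC ler_pdivrMr //; exact: dH.
move=> /(le_trans (ler_norm _)) h.
have : ln (g s) <= ln (g 0) + `|s| * D by lra.
rewrite -ler_expR expRD !lnK ?posrE // => /le_trans; apply.
rewrite {1}/g scale0r addr0 mulrC ler_pM2r ?(lt_le_trans ltr01) //.
set z := `|s| * D; have z0 : 0 <= z by rewrite mulr_ge0 // ltW.
have z2 : z <= 1 / 2 by rewrite /z; move: sD; lra.
have : 1 - z <= expR (- z) by have := expR_ge1Dx (- z).
rewrite expRN => h1.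
have e0 := expR_gt0 z.
have : (1 - z) * expR z <= 1 by rewrite -ler_pdivlMr // div1r.
have -> : 2 * D * `|s| = 2 * z by rewrite /z; ring.
move=> h3; have h4 : 1 <= (1 + 2 * z) * (1 - z).
  have := mulr_ge0 z0 (_ : 0 <= 1 - 2 * z); rewrite subr_ge0; lra.
have z1 : 0 < 1 - z by lra.
rewrite -(ler_pM2l z1) (le_trans h3) // mulrC; exact: h4.
Qed.

End Hamiltonian.

(** * Doubling of variables *)

Section Limits.
Context {R : realType}.

Lemma le0_of_small (A B t0 : R) : 0 < t0 ->
  (forall t, 0 < t <= t0 -> t ^+ 2 * A <= B * t ^+ 3) -> A <= 0.
Proof.
move=> t00 h; rewrite leNgt; apply/negP => A0.
pose t := Num.min t0 (A / (2 * (1 + `|B|))).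
have B0 : 0 < 1 + `|B| by rewrite ltr_wpDr.
have tp : 0 < t by rewrite lt_min t00 divr_gt0 // mulr_gt0.
have := h t; rewrite tp ge_min lexx /= => /(_ isT).
have -> : B * t ^+ 3 = t ^+ 2 * (B * t) by ring.
rewrite ler_pM2l ?exprn_gt0 // leNgt => /negP; apply.
apply: (@le_lt_trans _ _ ((1 + `|B|) * t)).
  by rewrite ler_wpM2r ?(ltW tp) // (le_trans (ler_norm B)) // lerDr.
have : t <= A / (2 * (1 + `|B|)) by rewrite ge_min lexx orbT.
rewrite ler_pdivlMr ?mulr_gt0 //; move: A0; lra.
Qed.

Lemma eq0_of_small (D B t0 : R) : 0 < t0 ->
  (forall t, `|t| <= t0 -> t * D <= B * t ^+ 2) -> D = 0.
Proof.
move=> t00 h; apply/le_anti/andP; split.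
  apply: (@le0_of_small _ B t0) => // t /andP[tp tt].
  have := h t; rewrite ger0_norm ?(ltW tp) // => /(_ tt) h1.
  have := ler_wpM2l (ltW tp) h1; rewrite (_ : t * (t * D) = t ^+ 2 * D); last by ring.
  by rewrite (_ : t * (B * t ^+ 2) = B * t ^+ 3); last by ring.
rewrite -oppr_le0; apply: (@le0_of_small _ B t0) => // t /andP[tp tt].
have := h (- t); rewrite normrN ger0_norm ?(ltW tp) // => /(_ tt) h1.
have := ler_wpM2l (ltW tp) h1; rewrite (_ : t * (- t * D) = t ^+ 2 * - D); last by ring.
by rewrite (_ : t * (B * (- t) ^+ 2) = B * t ^+ 3); last by ring.
Qed.

End Limits.

Section Doubling.
Context {R : realType} {d : nat}.
Notation vec := 'rV[R]_d.
Implicit Types (u h f : vec -> R) (x : vec) (i j : 'I_d).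

(** The increment is cut into n equal pieces: the quadratic Taylor errors add up to O(1/n), so the
    Lipschitz constant is [om] itself. *)
Lemma taylor_lip (B om : R) f D1 D2 i x (t : R) : taylor B f D1 D2 ->
  (forall i x, `|D1 i x| <= om) -> `|f (x + t *: ev R i) - f x| <= om * `|t|.
Proof.
move=> [h1 _ _ _] hom.
have step (n : nat) (s : R) y : `|f (y + (n%:R * s) *: ev R i) - f y| <= n%:R * (om * `|s| + B * s ^+ 2).
  elim: n => [|n IH]; first by rewrite !mul0r scale0r addr0 subrr normr0.
  rewrite -(natr1 n) mulrDl mul1r scalerDl addrA.
  set z := y + _ in IH *.
  have -> : f (z + s *: ev R i) - f y = (f (z + s *: ev R i) - f z - s * D1 i z) + s * D1 i z + (f z - f y) by ring.
  rewrite (le_trans (ler_normD _ _)) // [leRHS]mulrDl mul1r [leRHS]addrC lerD //.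
  rewrite (le_trans (ler_normD _ _)) // [leRHS]addrC lerD //.
  by rewrite normrM mulrC ler_wpM2r.
apply/ler_addgt0Pr => e e0.
pose n := (Num.trunc (B * t ^+ 2 / e)).+1.
have n0 : 0 < n%:R :> R by rewrite ltr0n.
have ne : B * t ^+ 2 / e <= n%:R by apply/ltW/truncnS_gt.
have := step n (t / n%:R) x.
rewrite mulrC divfK ?gt_eqF // => /le_trans; apply.
rewrite normrM normfV (gtr0_norm n0) mulrDr.
have -> : n%:R * (om * (`|t| / n%:R)) = om * `|t| by field; rewrite gt_eqF.
rewrite lerD2l.
have -> : n%:R * (B * (t / n%:R) ^+ 2) = (B * t ^+ 2) / n%:R by field; rewrite gt_eqF.
by rewrite ler_pdivrMr // [leRHS]mulrC -ler_pdivrMr.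
Qed.

(** The functional of the doubling argument. [sg] is 1 or -1, to bound the derivative from both
    sides; [M] stands for the sup norm of u and makes the last factor nonnegative. *)
Definition doubled (a M B Lam sg : R) i u h x (s : R) :=
  (u (x + (s * sg) *: ev R i) - h (x + (s * sg) *: ev R i)) - (u x - h x)
  - B * (2 * s - Lam * s ^+ 2) - s * a * (u (x + (s * sg) *: ev R i) + M).

(* At an interior maximum: first order condition in each coordinate of [x], and
   second order conditions along the reflection coupling, i.e. [x] and
   [x + s sg e_i] move together in the directions [e_j], [j != i], and
   oppositely in the direction [e_i]. *)
Lemma doubled_max (a M B Lam sg r0 Bu Bh : R) i u h Du D2u Dh D2h x s :
  taylor Bu u Du D2u -> taylor Bh h Dh D2h -> sg ^+ 2 = 1 -> 0 < s < r0 ->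
  (forall x' s', 0 <= s' <= r0 ->
     doubled a M B Lam sg i u h x' s' <= doubled a M B Lam sg i u h x s) ->
  let X := x + (s * sg) *: ev R i in
  (forall j, (1 - s * a) * Du j X - Dh j X = Du j x - Dh j x) /\
  (1 - s * a) * (\sum_j D2u j X) - \sum_j D2h j X - (\sum_j D2u j x - \sum_j D2h j x)
    + 8 * B * Lam - 4 * a * (sg * Du i X) <= 0.
Proof.
move=> [u1 u2 _ _] [h1 h2 _ _] sg2 /andP[s0 sr] mx X.
have Bu0 : 0 <= Bu by have := u1 i 1 x; rewrite expr1n mulr1; exact: le_trans.
have Bh0 : 0 <= Bh by have := h1 i 1 x; rewrite expr1n mulr1; exact: le_trans.
pose al := `|1 - s * a|.
have al0 : 0 <= al by exact: normr_ge0.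
have shX j t : x + t *: ev R j + (s * sg) *: ev R i = X + t *: ev R j by rewrite addrAC.
have s0r : 0 <= s <= r0 by rewrite !ltW.
have mxj j t : (1 - s * a) * u (X + t *: ev R j) - h (X + t *: ev R j) - (u (x + t *: ev R j) - h (x + t *: ev R j))
   <= (1 - s * a) * u X - h X - (u x - h x).
  have := mx (x + t *: ev R j) s s0r; rewrite /doubled shX -/X; lra.
have bnd (b z c : R) : `|z| <= c -> `|b * z| <= `|b| * c by move=> zc; rewrite normrM ler_wpM2l.
split=> [j|].
  apply/eqP; rewrite -subr_eq0; apply/eqP.
  apply: (@eq0_of_small _ _ (al * Bu + Bh + Bu + Bh) 1) => // t _.
  have := mxj j t; have := bnd (1 - s * a) _ _ (u1 j t X).
  have := u1 j t x; have := h1 j t X; have := h1 j t x.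
  rewrite !ler_norml -/al; lra.
have second j : j != i -> (1 - s * a) * D2u j X - D2h j X - (D2u j x - D2h j x) <= 0.
  move=> _; apply: (@le0_of_small _ _ (al * Bu + Bh + Bu + Bh) 1) => // t /andP[t0 _].
  have := mxj j t; have := mxj j (- t); rewrite !scaleNr.
  have := bnd (1 - s * a) _ _ (u2 j t X).
  have := u2 j t x; have := h2 j t X; have := h2 j t x.
  rewrite (ger0_norm (ltW t0)) !ler_norml -/al; lra.
have ui : (1 - s * a) * D2u i X - D2h i X - (D2u i x - D2h i x)
    + 8 * B * Lam - 4 * a * (sg * Du i X) <= 0.
  pose t0 := Num.min (s / 2) ((r0 - s) / 2).
  have t00 : 0 < t0 by rewrite lt_min !divr_gt0 // subr_gt0.
  apply: (@le0_of_small _ _ (al * Bu + Bh + Bu + Bh + 4 * `|a| * Bu) t0) => // t /andP[tp tt0].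
  have [ts tr] : t <= s / 2 /\ t <= (r0 - s) / 2.
    by move: tt0; rewrite /t0 le_min => /andP[].
  have mxt (r : R) : r = t \/ r = - t ->
     doubled a M B Lam sg i u h (x - (r * sg) *: ev R i) (s + 2 * r) <= doubled a M B Lam sg i u h x s.
    move=> rt; apply: mx; apply/andP; split; case: rt => ->; lra.
  have := mxt t (or_introl erefl); have := mxt (- t) (or_intror erefl).
  rewrite /doubled.
  (* Reflection: changing [s] by [2 r] while [x] moves by [- r sg e_i] moves the far point by
     [+ r sg e_i]. The second difference of phi at step [2 t] yields [8 B Lam], and the product of
     [s] with [u] yields the cross term [4 a sg Du]. *)
  have e1 r : x - (r * sg) *: ev R i + ((s + 2 * r) * sg) *: ev R i = X + (r * sg) *: ev R i.
    by rewrite /X -!addrA -scaleNr -[in LHS]scalerDl -[in RHS]scalerDl; congr (_ + _ *: _); ring.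
  rewrite !e1 -/X mulNr scaleNr opprK.
  have st2 : (t * sg) ^+ 2 = t ^+ 2 by rewrite exprMn sg2 mulr1.
  have sg1 : `|sg| = 1.
    by move/eqP: sg2; rewrite sqrf_eq1 => /orP[] /eqP ->; rewrite ?normrN normr1.
  have st3 : `|t * sg| ^+ 3 = t ^+ 3 by rewrite normrM sg1 mulr1 ger0_norm // ltW.
  have := bnd (1 - s * a) _ _ (u2 i (t * sg) X).
  have := u2 i (t * sg) x; have := h2 i (t * sg) X; have := h2 i (t * sg) x.
  have ua : `|u (X + (t * sg) *: ev R i) - u X - t * sg * Du i X| <= Bu * t ^+ 2.
    by have := u1 i (t * sg) X; rewrite st2.
  have ub : `|u (X - (t * sg) *: ev R i) - u X + t * sg * Du i X| <= Bu * t ^+ 2.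
    by have := u1 i (- (t * sg)) X; rewrite sqrrN st2 scaleNr mulNr opprK.
  have := bnd (2 * t * a) _ _ ua; have := bnd (2 * t * a) _ _ ub.
  have -> : `|2 * t * a| = 2 * t * `|a| by rewrite normrM (ger0_norm (x := 2 * t)) // mulr_ge0 // ltW.
  rewrite st2 st3 !ler_norml -/al; lra.
rewrite !(bigD1 (P := xpredT) i) //=.
have : \sum_(j | j != i) ((1 - s * a) * D2u j X - D2h j X - (D2u j x - D2h j x)) <= 0.
  by apply: sumr_le0 => j; exact: second.
rewrite !sumrB -mulr_sumr; lra.
Qed.

End Doubling.

(** * Existence of the maximum, by compactness and periodicity *)

Section Attained.
Local Open Scope classical_set_scope.
Context {R : realType} {d : nat}.
Notation vec := 'rV[R]_d.
Notation V := (vec * R)%type.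
Implicit Types (u h f : vec -> R^o) (x : vec) (i j : 'I_d).

Lemma doubled_attained (a M B Lam sg r0 : R) i u h :
  continuous u -> continuous h ->
  (forall x j, u (x + ev R j) = u x) -> (forall x j, h (x + ev R j) = h x) -> 0 <= r0 ->
  exists x s, 0 <= s <= r0 /\ forall x' s', 0 <= s' <= r0 ->
     doubled a M B Lam sg i u h x' s' <= doubled a M B Lam sg i u h x s.
Proof.
move=> cu ch pu ph r00.
pose D (z : V) : R^o := doubled a M B Lam sg i u h z.1 z.2.
have cX : continuous (fun z : V => z.1 + (z.2 * sg) *: ev R i).
  move=> [x s] /=; apply: cvgD; first exact: cvg_fst.
  apply: cvgZr_tmp; apply: cvgM; [exact: cvg_snd | exact: cvg_cst].
have c2 : continuous (snd : V -> R^o) by move=> [x s]; exact: cvg_snd.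
have c1 : continuous (fst : V -> vec) by move=> [x s]; exact: cvg_fst.
have cuX : continuous (fun z : V => u (z.1 + (z.2 * sg) *: ev R i)).
  by move=> z; apply: continuous_comp; [exact: cX | exact: cu].
have chX : continuous (fun z : V => h (z.1 + (z.2 * sg) *: ev R i)).
  by move=> z; apply: continuous_comp; [exact: cX | exact: ch].
have cux : continuous (fun z : V => u z.1).
  by move=> z; apply: continuous_comp; [exact: c1 | exact: cu].
have chx : continuous (fun z : V => h z.1).
  by move=> z; apply: continuous_comp; [exact: c1 | exact: ch].
have cD : continuous D.
  move=> z; rewrite /D /doubled; apply: cvgB; first apply: cvgB.
  - by apply: cvgB; apply: cvgB; [exact: cuX|exact: chX|exact: cux|exact: chx].
  - apply: cvgM; first exact: cvg_cst.
    apply: cvgB; first by apply: cvgM; [exact: cvg_cst|exact: c2].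
    apply: cvgM; first exact: cvg_cst.
    by rewrite expr2; under eq_fun do rewrite expr2; apply: cvgM; exact: c2.
  - apply: cvgM; first by apply: cvgM; [exact: c2|exact: cvg_cst].
    by apply: cvgD; [exact: cuX|exact: cvg_cst].
have [|[x s] + mx] := compact_EVT_max _ (@compact_box R d r0) (continuous_subspaceT cD).
  exists (0, 0); split => /=; last by rewrite lexx.
  by move=> j; rewrite mxE lexx ler01.
rewrite inE => -[_ /= sr]; exists x, s; split=> // x' s' s'r.
have [y [z yb ->]] := torus_repr x'.
rewrite (@periodic_shift R d (fun x => doubled a M B Lam sg i u h x s') z y); last first.
  by move=> w j; rewrite /doubled (addrAC w) !pu !ph.
by apply: (mx (y, s')); rewrite inE.
Qed.

Lemma continuous_avg2 (s : R) j f : continuous f -> continuous (avg2 s j f : vec -> R^o).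
Proof.
move=> cf; suff : continuous (fun x => (f x + f (x + s *: ev R j)) * 2^-1 : R^o) by [].
have ct : continuous (fun x => f (x + s *: ev R j)).
  move=> x; apply: (@continuous_comp _ _ _ (fun x => x + s *: ev R j) f); last exact: cf.
  by apply: (cvgD (F := nbhs (x : vec))); [exact: cvg_id|exact: cvg_cst].
move=> x; apply: (cvgM (F := nbhs (x : vec))); last exact: cvg_cst.
by apply: (cvgD (F := nbhs (x : vec))); [exact: cf|exact: ct].
Qed.

Lemma continuous_potential (e : R) (F : nat -> vec -> R^o) k :
  (forall k, continuous (F k)) -> continuous (potential e F k : vec -> R^o).
Proof.
move=> cF; elim: k => [|k IH]; first by move=> x; exact: (@cst_continuous vec R^o 0).
move=> x /=.
apply: (cvgD (F := nbhs (x : vec))); last first.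
  by apply: (cvgM (F := nbhs (x : vec))); [exact: cvg_cst | exact: cF].
suff : continuous (heat e 1 (potential e F k) : vec -> R^o) by exact.
rewrite /heat.
elim: (enum _) => //= j r IHr; do 2 apply: continuous_avg2; exact: IHr.
Qed.

Lemma periodic_potential (e : R) (F : nat -> vec -> R) k :
  (forall k x j, F k (x + ev R j) = F k x) ->
  forall x j, potential e F k (x + ev R j) = potential e F k x.
Proof.
move=> pF; elim: k => [|k IH] x j //=; rewrite pF (averaging_shift (averaging_heat e 1)).
congr (heat _ _ _ _ + _); apply/funext => y; exact: IH.
Qed.

End Attained.

(** * One time step of the maximum principle *)

Section MaximumPrinciple.
Context {R : realType} {d : nat}.
Notation vec := 'rV[R]_d.
Variables (H : vec -> vec -> R) (mu CL c C3 Cx : R).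
Hypothesis H1 : forall x q, 1 <= H x q.
Hypotheses (CL0 : 0 <= CL) (C30 : 0 < C3) (Cx0 : 0 < Cx).
Hypothesis Hlip : forall (rho : R) x (q q' : vec), 1 <= rho ->
  (forall j, `|q 0 j| <= rho) -> (forall j, `|q' 0 j| <= rho) ->
  `|H x q' - H x q| <= CL * rho `^ (1 + mu) * \sum_j `|q' 0 j - q 0 j|.
Hypothesis Hscale : forall x q (r : R), 0 < r <= 1 ->
  H x (r *: q) + (1 - r) * (c * H x (r *: q) - C3) <= r * H x q.
Hypothesis Hx : forall i x q (s : R), Cx * `|s| <= 1 ->
  H (x + s *: ev R i) q <= (1 + Cx * `|s|) * H x q.

(** [P] is first replaced by [(1 - s a) Q] at cost [D], by [Hlip]. Moving from [x] to [X] costs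
    [Cx s H], which the gain [s a c H] in [Hscale] absorbs because [Cx <= a c]. The factor 2 is a
    bound for [1 + Cx s]. *)
Lemma interior_ineq (a K om s sg : R) i x (P Q : vec) :
  let X := x + (s * sg) *: ev R i in
  `|sg| = 1 -> 0 <= s -> s * a <= 1 / 2 -> 0 <= a -> Cx * s <= 1 -> Cx <= a * c -> 1 <= K ->
  (forall j, `|P 0 j| <= K) -> (forall j, `|Q 0 j| <= K) ->
  (forall j, `|(1 - s * a) * Q 0 j - P 0 j| <= 2 * om) ->
  H x P <= (1 - s * a) * H X Q + C3 + 2 * (CL * K `^ (1 + mu) * (d%:R * (2 * om))).
Proof.
move=> X sg1 s0 sa a0 Cs ca K1 PK QK hom.
set r := 1 - s * a; set D := CL * _ * _.
have sa0 : 0 <= s * a by rewrite mulr_ge0.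
have r01 : 0 < r <= 1 by rewrite /r; apply/andP; split; lra.
have [r0 r1] : 0 < r /\ r <= 1 by move/andP: r01.
set P' := r *: Q.
have P'K j : `|P' 0 j| <= K.
  by rewrite mxE normrM (gtr0_norm r0) (le_trans _ (QK j)) // ler_piMl.
have hP : `|H X P' - H X P| <= D.
  rewrite (le_trans (Hlip X K1 PK P'K)) // ler_wpM2l //.
    by rewrite mulr_ge0 ?powR_ge0.
  have -> : d%:R * (2 * om) = \sum_(j < d) (2 * om).
    by rewrite sumr_const card_ord [LHS]mulr_natl.
  by apply: ler_sum => j _; rewrite mxE.
have D0 : 0 <= D by exact: le_trans hP.
have h1 : H x P <= (1 + Cx * s) * H X P.
  have ns : `|- (s * sg)| = s by rewrite normrN normrM sg1 mulr1 ger0_norm.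
  have := @Hx i X P (- (s * sg)); rewrite ns scaleNr addrK; exact.
have h2 : H X P <= H X P' + D by move: hP; rewrite ler_norml; lra.
have h3 := Hscale X Q r01; rewrite -/P' in h3.
have e1 : 1 - r = s * a by rewrite /r; ring.
rewrite e1 in h3.
have h4 : Cx * s * H X P' <= s * a * c * H X P'.
  rewrite ler_wpM2r ?(le_trans ler01) // -mulrA [leRHS]mulrC.
  by rewrite ler_wpM2r.
have Cs0 : 0 <= Cx * s by rewrite mulr_ge0 // ltW.
have h5 : (1 + Cx * s) * H X P <= (1 + Cx * s) * (H X P' + D).
  by rewrite ler_wpM2l // addr_ge0.
have h6 : Cx * s * D <= D by rewrite ler_piMl.
have h7 : s * a * C3 <= C3 by rewrite ler_piMl ?(ltW C30) //; lra.
rewrite (le_trans h1) // (le_trans h5) //.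
move: h3 h4 h6 h7; rewrite !mulrDl !mulrDr !mul1r mulrN; lra.
Qed.

(** [u1], [h1] belong to the later time and [u0], [h0] to the earlier one. A maximum of the earlier
    functional at s = 0 has a nonpositive value; at [r0] the penalty [3 B / (4 Lam)] exceeds the
    oscillation of u - h; inside, the value grows from the later time only by the four consistency
    errors, of [u] and [h] at [x] and [X]. *)
Lemma max_step (a K M om B Lam sg dl e1 E Bu Bh : R) i u0 u1 h0 h1 (F : vec -> R)
    Du D2u Dh D2h (r0 := (2 * Lam)^-1) :
  continuous (u0 : vec -> R^o) -> continuous (h0 : vec -> R^o) ->
  (forall x j, u0 (x + ev R j) = u0 x) -> (forall x j, h0 (x + ev R j) = h0 x) ->
  taylor Bu u0 Du D2u -> taylor Bh h0 Dh D2h -> (forall x, 0 <= F x) ->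
  (forall x, `|u1 x - u0 x - dl * (H x (\row_j Du j x) - \sum_j D2u j x - F x)| <= dl * e1) ->
  (forall x, `|h0 x - h1 x - dl * (\sum_j D2h j x + F x)| <= dl * e1) ->
  (forall j x, `|Du j x| <= K) -> (forall j x, `|Dh j x| <= om) -> (forall x, `|u0 x| <= M) ->
  sg ^+ 2 = 1 -> 0 <= dl -> 0 <= e1 -> 0 <= E -> 0 <= a -> 0 < Lam -> 1 <= K ->
  a <= Lam -> Cx <= Lam -> om <= Lam -> Cx <= a * c -> 2 * M + 1 <= 3 * B / (4 * Lam) ->
  C3 + 2 * (CL * K `^ (1 + mu) * (d%:R * (2 * om))) + 4 * a * K <= 8 * B * Lam ->
  (forall x s, 0 <= s <= r0 -> doubled a M B Lam sg i u1 h1 x s <= E) ->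
  forall x s, 0 <= s <= r0 -> doubled a M B Lam sg i u0 h0 x s <= E + 4 * (dl * e1).
Proof.
move=> cu ch pu ph tu th F0 eqU eqH DuK Dhom uM sg2 dl0 e10 E0 a0 Lam0 K1 aL CL' omL ca hB hBL IH x' s' s'r.
have r00 : 0 < r0 by rewrite invr_gt0 mulr_gt0.
have [x [s [sr mx]]] := doubled_attained a M B Lam sg i cu ch pu ph (ltW r00).
apply: le_trans (mx x' s' s'r) _.
have de0 : 0 <= dl * e1 by rewrite mulr_ge0.
have EE : 0 <= E + 4 * (dl * e1) by rewrite addr_ge0 // mulr_ge0.
have [sg1 s0] : `|sg| = 1 /\ 0 <= s.
  split; last by case/andP: sr.
  by move/eqP: sg2; rewrite sqrf_eq1 => /orP[] /eqP ->; rewrite ?normrN normr1.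
have Lr : Lam * r0 = 1 / 2 by rewrite /r0; field; exact: lt0r_neq0.
have le12 z : z <= Lam -> z * s <= 1 / 2.
  move=> zL; rewrite -Lr (le_trans (ler_wpM2r s0 zL)) //.
  by rewrite ler_wpM2l ?(ltW Lam0) //; case/andP: sr.
have [s00|sn0] := eqVneq s 0.
  apply: le_trans EE; rewrite /doubled s00 !mul0r scale0r addr0 expr0n /=; lra.
have [sr0|snr] := eqVneq s r0.
  apply: le_trans EE; rewrite /doubled.
  set X := x + _.
  have hX : `|h0 X - h0 x| <= 1 / 2.
    rewrite (le_trans (taylor_lip i x _ th (fun i x => Dhom i x))) //.
    by rewrite normrM sg1 mulr1 ger0_norm // le12.
  have uX := uM X; have ux := uM x.
  have hq : B * (2 * s - Lam * s ^+ 2) = 3 * B / (4 * Lam).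
    by rewrite sr0 /r0; field; exact: lt0r_neq0.
  have h3 : 0 <= s * a * (u0 X + M).
    by rewrite mulr_ge0 ?mulr_ge0 //; move: uX; rewrite ler_norml; lra.
  rewrite hq; move: hX uX ux; rewrite !ler_norml; lra.
have sin : 0 < s < r0.
  by case/andP: sr => s1 s2; rewrite lt_neqAle eq_sym sn0 s1 lt_neqAle snr.
have [g1 g2] := doubled_max tu th sg2 sin mx.
set X := x + _ in g1 g2.
have sa : s * a <= 1 / 2 by rewrite mulrC le12.
have sa0 : 0 <= s * a by rewrite mulr_ge0.
have := @interior_ineq a K om s sg i x (\row_j Du j x) (\row_j Du j X) sg1 s0 sa a0.
have Cs : Cx * s <= 1 by have := le12 _ CL'; lra.
move=> /(_ Cs ca K1) H'.
have {H'} := H' _ _ _.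
rewrite -/X => H'.
have {}H' : H x (\row_j Du j x) <= (1 - s * a) * H X (\row_j Du j X) + C3 +
    2 * (CL * K `^ (1 + mu) * (d%:R * (2 * om))).
  apply: H' => j; rewrite !mxE //.
  have -> : (1 - s * a) * Du j X - Du j x = Dh j X - Dh j x by have := g1 j; lra.
  rewrite (le_trans (ler_normB _ _)) //; have := Dhom j X; have := Dhom j x; lra.
have sD : `|sg * Du i X| <= K by rewrite normrM sg1 mul1r.
have aD : 4 * a * (sg * Du i X) <= 4 * a * K.
  by rewrite ler_wpM2l ?mulr_ge0 // (le_trans (ler_norm _)).
have hIH := IH x s sr.
have := eqU X; have := eqU x; have := eqH X; have := eqH x.
set HX := H X _ in H' *; set Hxx := H x _ in H' *.
set SX := \sum_j D2u j X in g2 *; set Sx := \sum_j D2u j x in g2 *.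
set TX := \sum_j D2h j X in g2 *; set Tx := \sum_j D2h j x in g2 *.
move=> k1 k2 k3 k4.
have k4' : `|(1 - s * a) * (u1 X - u0 X - dl * (HX - SX - F X))| <= dl * e1.
  rewrite normrM (le_trans _ k4) // ler_piMl // ger0_norm; lra.
(* The source cancels in u - h; what survives of it, through the factor [1 - s a] on [u], is
   [s a F(X)], of favourable sign because [F >= 0]. *)
have main : 0 <= dl * ((1 - s * a) * HX - Hxx + s * a * F X - ((1 - s * a) * SX - TX - (Sx - Tx))).
  rewrite mulr_ge0 //; have := mulr_ge0 sa0 (F0 X); lra.
move: hIH; rewrite /doubled -/X.
move: k1 k2 k3 k4' main; rewrite !ler_norml; lra.
Qed.

End MaximumPrinciple.

(** * The doubling estimate along the time grid *)

Section GridEstimate.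
Local Open Scope classical_set_scope.
Context {R : realType} {d : nat}.
Notation vec := 'rV[R]_d.
Notation V := (vec * R)%type.

Lemma powR_lip (p b x y : R) : 1 < p -> 0 <= x <= b -> 0 <= y <= b ->
  `|x `^ p - y `^ p| <= p * b `^ (p - 1) * `|x - y|.
Proof.
move=> p1; have p0 : 0 < p by exact: lt_trans p1.
have key z w : 0 <= w -> w <= z -> z <= b -> z `^ p - w `^ p <= p * b `^ (p - 1) * (z - w).
  move=> w0 wz zb; have z0 : 0 <= z by exact: le_trans wz.
  have pq : (p / (p - 1))^-1 + p^-1 = 1 by rewrite invf_div; field; rewrite gt_eqF.
  (* Young's inequality for [z^(p-1) w] is the tangent inequality of [z^p] at [z]. *)
  have := conjugate_powR (powR_ge0 z (p - 1)) w0 (divr_gt0 p0 _) p0 pq.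
  rewrite subr_gt0 => /(_ p1); rewrite -powRrM invf_div.
  have -> : (p - 1) * (p / (p - 1)) = p by field; rewrite gt_eqF // subr_gt0.
  move=> h; have zp := mulr_powRB1 z0 p0.
  have : z `^ p - w `^ p <= p * z `^ (p - 1) * (z - w).
    have := ler_wpM2l (ltW p0) h.
    have -> : p * (z `^ p * ((p - 1) / p) + w `^ p / p) = (p - 1) * z `^ p + w `^ p.
      by field; exact: lt0r_neq0.
    have -> : p * z `^ (p - 1) * (z - w) = p * (z * z `^ (p - 1)) - p * (z `^ (p - 1) * w) by ring.
    rewrite zp; lra.
  move=> /le_trans; apply; rewrite ler_wpM2r ?subr_ge0 // ler_wpM2l ?(ltW p0) //.
  by rewrite ge0_ler_powR ?nnegrE ?subr_ge0 ?(ltW p1) // (le_trans z0).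
move=> /andP[x0 xb] /andP[y0 yb]; have [xy|yx] := leP x y.
  rewrite distrC [`|x - y|]distrC !ger0_norm ?subr_ge0 ?ge0_ler_powR ?nnegrE ?(ltW p0) //.
  exact: key.
rewrite !ger0_norm ?subr_ge0 ?ge0_ler_powR ?nnegrE ?(ltW p0) ?(ltW yx) //.
by apply: key => //; exact: ltW.
Qed.

Lemma small_step (C e : R) : 0 <= C -> 0 < e -> exists2 N : nat, (0 < N)%N & C / N%:R <= e.
Proof.
move=> C0 e0; exists (Num.trunc (C / e)).+1 => //.
rewrite ler_pdivrMr ?ltr0n // mulrC -ler_pdivrMr //.
by apply/ltW/truncnS_gt.
Qed.

Lemma continuous_slice (f : V -> R^o) (t : R) : continuous f ->
  continuous (fun y : vec => f (y, t)).
Proof.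
move=> cf y; apply: (@continuous_comp _ _ _ (fun y : vec => (y, t) : V) f); last exact: cf.
have h1 : (fun y : vec => y) @ y --> y by exact: cvg_id.
have h2 : (fun y : vec => t) @ y --> t by exact: (@cst_continuous vec R t y).
exact: (cvg_pair h1 h2).
Qed.

Lemma powR_slice_lip (F : V -> R^o) (T p : R) : 1 < p -> smoothC F -> tper F ->
  exists b LF, [/\ 0 <= b, 0 <= LF & forall t, 0 <= t <= T ->
    (forall y, `|F (y, t)| <= b) /\ coordlip LF (fun y => `|F (y, t)| `^ p)].
Proof.
move=> p1 sF pF; have p0 : 0 <= p by rewrite (le_trans ler01) // ltW.
have [b b0 Fb] := tper_bounded T (smoothC_continuous sF) pF.
have [lF lF0 hlF] : exists2 B, 0 <= B & forall j x t, 0 <= t <= T -> `|'D_(ev R j, 0) F (x, t)| <= B.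
  apply: (@family_bound R d (fun j B => forall x t, 0 <= t <= T -> `|'D_(ev R j, 0) F (x, t)| <= B)).
    by move=> j b' b'' hb bb y r rT; exact: le_trans (hb y r rT) bb.
  by move=> j; apply: (@tper_bounded R d ('D_(ev R j, 0) F)); [apply: smoothC_continuous; exact: smoothC_derive | exact: tper_derive].
exists b, (p * b `^ (p - 1) * lF); split=> //; first by rewrite !mulr_ge0 ?powR_ge0.
move=> t tT; split=> [y|j r z]; first exact: Fb.
rewrite (le_trans (powR_lip (b := b) p1 _ _)) ?normr_ge0 ?Fb //.
rewrite -!mulrA ler_wpM2l // ler_wpM2l ?powR_ge0 // (le_trans (ler_dist_dist _ _)) //.
by apply: space_osc => // z'; exact: hlF.
Qed.

Section Estimate.
Variables (H : vec -> vec -> R) (mu CL c C3 Cx : R).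
Hypothesis H1 : forall x q, 1 <= H x q.
Hypotheses (CL0 : 0 <= CL) (C30 : 0 < C3) (Cx0 : 0 < Cx).
Hypothesis Hlip : forall (rho : R) x (q q' : vec), 1 <= rho ->
  (forall j, `|q 0 j| <= rho) -> (forall j, `|q' 0 j| <= rho) ->
  `|H x q' - H x q| <= CL * rho `^ (1 + mu) * \sum_j `|q' 0 j - q 0 j|.
Hypothesis Hscale : forall x q (r : R), 0 < r <= 1 ->
  H x (r *: q) + (1 - r) * (c * H x (r *: q) - C3) <= r * H x q.
Hypothesis Hx : forall i x q (s : R), Cx * `|s| <= 1 ->
  H (x + s *: ev R i) q <= (1 + Cx * `|s|) * H x q.

Variables (U F : V -> R^o) (T p L K M LT : R).
Hypotheses (sU : smoothC U) (pU : tper U) (sF : smoothC F) (pF : tper F).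
Hypothesis T0 : 0 < T.
Hypothesis eqU : forall x (t : R), 0 <= t <= T -> 'D_(0, 1) U (x, t) =
  H x (\row_j 'D_(ev R j, 0) U (x, t)) - \sum_j 'D_(ev R j, 0) ('D_(ev R j, 0) U) (x, t) - F (x, t).
Hypothesis F0 : forall x (t : R), 0 <= t <= T -> 0 <= F (x, t).
Hypothesis dp : d%:R < p.
Hypothesis L0 : 0 <= L.
Hypothesis FL : forall t : R, 0 <= t <= T -> box_int 0 1 (fun x => `|F (x, t)| `^ p) <= L `^ p.
Hypothesis K1 : 1 <= K.
Hypothesis UK : forall j x (t : R), 0 <= t <= T -> `|'D_(ev R j, 0) U (x, t)| <= K.
Hypothesis UM : forall x (t : R), 0 <= t <= T -> `|U (x, t)| <= M.
Hypothesis UT : forall x i (s : R), `|U (x + s *: ev R i, T) - U (x, T)| <= LT * `|s|.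

(** [om0] is slack for the discretization: Riemann sums see [L + om0] in place of [L], and passing
    from difference quotients of the potential to its derivative costs another [om0]. The grid is
    refined in terms of [om0] and of an error [e], which is arbitrary. *)
Lemma doubling_estimate (om0 a B Lam sg : R) i x t s
    (om := @heat_cst R d p T * (L + om0) + om0) :
  0 < om0 -> sg ^+ 2 = 1 -> 0 <= a -> 0 < Lam -> a <= Lam -> Cx <= Lam -> om <= Lam ->
  Cx <= a * c -> 2 * M + 1 <= 3 * B / (4 * Lam) ->
  C3 + 2 * (CL * K `^ (1 + mu) * (d%:R * (2 * om))) + 4 * a * K <= 8 * B * Lam ->
  0 <= B -> LT <= B -> 0 <= t <= T -> 0 <= s <= (2 * Lam)^-1 ->
  U (x + (s * sg) *: ev R i, t) - U (x, t) <= s * (2 * B + 2 * a * M + om).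
Proof.
move=> om00 sg2 a0 Lam0 aL CxL omL Cxa hB hBL B0 LTB tT sr.
have d1 : 1 <= d%:R :> R by case: {+}d i => [[]//|d' _]; rewrite ler1n.
have p1 : 1 < p by exact: le_lt_trans dp.
have [Bu Bu0 tU] := smoothC_taylor T sU pU.
have [BF BF0 tF] := smoothC_taylor T sF pF.
have [Bt Bt0 hBt] := smoothC_time T sU pU.
have [b [LF [b0 LF0 hLF]]] := powR_slice_lip T p1 sF pF.
pose B1 := T * BF; have B10 : 0 <= B1 by rewrite mulr_ge0 // ltW.
pose Cst := d%:R * (4 * (1 + d%:R) * B1 + d%:R * B1 + BF).
have Cst0 : 0 <= Cst.
  have dd : 0 <= d%:R :> R by exact: ler0n.
  have d4 : 0 <= 4 * (1 + d%:R) * B1 by rewrite mulr_ge0 //; lra.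
  by rewrite /Cst mulr_ge0 // addr_ge0 // addr_ge0 // mulr_ge0.
have gap : 0 < (L + om0) `^ p - L `^ p.
  by rewrite subr_gt0 gt0_ltr_powR ?nnegrE ?addr_ge0 ?(ltW om00) ?ltrDl // (lt_trans ltr01).
apply/ler_addgt0Pr => e e0.
(* The three errors of order 1/N: Riemann sums, Taylor expansion of the potential, and time
   stepping. *)
pose Ctot := d%:R * LF + B1 + (4 * T * (Bt + Cst) + 2 * Bt).
have Ce0 : 0 <= 4 * T * (Bt + Cst) + 2 * Bt.
  by rewrite addr_ge0 ?mulr_ge0 ?addr_ge0 // ltW.
have dLF0 : 0 <= d%:R * LF by rewrite mulr_ge0.
have Ctot0 : 0 <= Ctot by rewrite /Ctot addr_ge0 // addr_ge0.
have m0 : 0 < Num.min ((L + om0) `^ p - L `^ p) (Num.min om0 e) by rewrite !lt_min gap om00 e0.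
have [N N0] := small_step Ctot0 m0.
rewrite !le_min => /andP[n1 /andP[n2 n3]].
pose h := (N%:R : R)^-1; pose dl := h ^+ 2 / 4.
have N0' : 0 < N%:R :> R by rewrite ltr0n.
have h0 : 0 < h by rewrite invr_gt0.
have h1 : h <= 1 by rewrite invf_le1 // ler1n.
have dl0 : 0 < dl by rewrite divr_gt0 ?exprn_gt0.
have dlh : dl <= h.
  have := ler_wpM2l (ltW h0) h1; rewrite /dl expr2; lra.
(* Truncation at 0 keeps every level in [0, T], so that the bounds on the source hold for all k; the
   levels that matter satisfy [k dl <= T] and are not truncated. *)
pose tk (k : nat) : R := Num.max 0 (T - k%:R * dl).
have tkT k : 0 <= tk k <= T.
  rewrite /tk le_max lexx /= ge_max (ltW T0) /= gerBl mulr_ge0 //; exact: ltW.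
pose Fk k y : R^o := F (y, tk k).
have tFk k : taylor BF (Fk k) (fun i x => 'D_(ev R i, 0) F (x, tk k))
    (fun i x => 'D_(ev R i, 0) ('D_(ev R i, 0) F) (x, tk k)) by exact: tF (tkT k).
have perFk k y j : Fk k (y + ev R j) = Fk k y by exact: pF.
have perN' k : perN h N (Fk k).
  by move=> y j; rewrite /h divff ?gt_eqF // scale1r perFk.
have gridFk k y : prodop (gridsum h N) (enum 'I_d) (fun y => `|Fk k y| `^ p) y <=
    N%:R ^+ d * (L + om0) `^ p.
  have [_ lp] := hLF _ (tkT k).
  rewrite (le_trans (gridsum_box_le y N0 lp _)) //.
    by move=> z j; rewrite pF.
  rewrite ler_wpM2l ?exprn_ge0 //.
  rewrite (le_trans (lerD (FL (tkT k)) (lexx _))) // -lerBrDl (le_trans _ n1) // mulrA.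
  by rewrite ler_pM2r ?invr_gt0 // /Ctot -addrA lerDl addr_ge0.
have cFk k : continuous (Fk k) by apply: continuous_slice; exact: smoothC_continuous.
pose P k := potential h Fk k.
pose D1 k j := potential h (fun k x => 'D_(ev R j, 0) F (x, tk k)) k.
pose D2 k j := potential h (fun k x => 'D_(ev R j, 0) ('D_(ev R j, 0) F) (x, tk k)) k.
have tP k : k%:R * dl <= T -> taylor B1 (P k) (D1 k) (D2 k).
  move=> kT; apply: taylor_le (potential_taylor h k tFk).
  by rewrite /B1 ler_wpM2r.
have D1om k j y : k%:R * dl <= T -> `|D1 k j y| <= om.
  move=> kT; have [t1 _ _ _] := tP k kT.
  have q1 := potential_diff j y N0 dp (_ : 0 <= L + om0) kT perN' gridFk.
  have {}q1 := q1 (addr_ge0 L0 (ltW om00)).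
  have q2 := t1 j h y.
  have : `|h * D1 k j y| <= h * om.
    rewrite -/h in q1; have q3 : B1 * h <= om0.
      rewrite (le_trans _ n2) // ler_pM2r // /Ctot.
      by rewrite -addrA addrCA lerDl addr_ge0.
    have := ler_wpM2l (ltW h0) q3.
    move: q1 q2; rewrite -/(P k) /om !ler_norml; lra.
  by rewrite normrM (gtr0_norm h0) ler_pM2l.
pose e1 := h * (Bt + Cst).
have e10 : 0 <= e1 by rewrite mulr_ge0 ?addr_ge0 // ltW.
(* At k = 0 the potential vanishes and [LT <= B] gives the bound, as phi(s) >= B s. Each step then
   adds [4 dl e1], in total at most [4 T e1], which is O(h). *)
have ind k : k%:R * dl <= T -> forall x s, 0 <= s <= (2 * Lam)^-1 ->
   doubled a M B Lam sg i (fun y => U (y, tk k)) (P k) x s <= k%:R * (4 * (dl * e1)).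
  elim: k => [_ y r rr|k IH kT].
    have tk0 : tk 0%N = T by rewrite /tk mul0r subr0 max_r // ltW.
    have sg1 : `|sg| = 1.
      by move/eqP: sg2; rewrite sqrf_eq1 => /orP[] /eqP ->; rewrite ?normrN normr1.
    case/andP: rr => r0 r1.
    have Lr : Lam * r <= 1 / 2.
      rewrite (le_trans (ler_wpM2l (ltW Lam0) r1)) // le_eqVlt; apply/orP; left; apply/eqP.
      by field; exact: lt0r_neq0.
    rewrite mul0r /doubled tk0 /P /=.
    set X := y + _.
    have q1 : U (X, T) - U (y, T) <= B * r.
      rewrite (le_trans (ler_norm _)) // (le_trans (UT _ _ _)) //.
      by rewrite normrM sg1 mulr1 ger0_norm // ler_wpM2r.
    have q2 : 0 <= r * a * (U (X, T) + M).
      rewrite mulr_ge0 ?mulr_ge0 //; have := UM X (_ : 0 <= T <= T).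
      by rewrite lexx (ltW T0) => /(_ isT); rewrite ler_norml; lra.
    have q3 : B * r * (Lam * r) <= B * r * (1 / 2) by rewrite ler_wpM2l // mulr_ge0.
    have Br0 : 0 <= B * r by rewrite mulr_ge0.
    lra.
  have kT' : k%:R * dl <= T.
    by rewrite (le_trans _ kT) // ler_wpM2r ?(ltW dl0) // ler_nat.
  have tkE : tk k = tk k.+1 + dl.
    rewrite /tk !max_r ?subr_ge0 // -(natr1 k); ring.
  have dk : 0 <= tk k.+1 <= T by exact: tkT.
  have dk' : 0 <= tk k.+1 + dl <= T by rewrite -tkE; exact: tkT.
  have dl2 : dl ^+ 2 <= dl * h by rewrite expr2 ler_pM2l.
  have ms := @max_step R d H mu CL c C3 Cx H1 CL0 C30 Cx0 Hlip Hscale Hx a K M om B Lam sg dl e1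
    (k%:R * (4 * (dl * e1))) Bu B1 i (fun y => U (y, tk k.+1)) (fun y => U (y, tk k)) (P k.+1) (P k) (Fk k.+1)
    (fun j y => 'D_(ev R j, 0) U (y, tk k.+1)) (fun j y => 'D_(ev R j, 0) ('D_(ev R j, 0) U) (y, tk k.+1))
    (D1 k.+1) (D2 k.+1).
  have -> : k.+1%:R * (4 * (dl * e1)) = k%:R * (4 * (dl * e1)) + 4 * (dl * e1).
    by rewrite -(natr1 k); ring.
  apply: ms => //.
  - by apply: continuous_slice; exact: smoothC_continuous.
  - exact: continuous_potential.
  - exact: periodic_potential.
  - exact: tU.
  - exact: tP.
  - by move=> y; exact: F0.
  - move=> y; have [k1 _] := hBt y _ dl dk dk'.
    rewrite -(eqU y dk) tkE (le_trans k1) // /e1.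
    have := ler_wpM2l Bt0 dl2; have := mulr_ge0 (mulr_ge0 (ltW dl0) (ltW h0)) Cst0; lra.
  - move=> y; have hh : 0 <= h <= 1 by rewrite (ltW h0).
    have kB : k%:R * (h ^+ 2 / 4) * BF <= B1 by rewrite /B1 ler_wpM2r.
    have := potential_step y hh BF0 tFk kB; rewrite -/dl -/Cst => /le_trans; apply.
    by rewrite ler_pM2l // /e1 ler_pM2l // lerDr.
  - by move=> j y; exact: UK.
  - by move=> j y; exact: D1om.
  - by move=> y; exact: UM.
  - exact: ltW.
  - by rewrite mulr_ge0 // mulr_ge0 // mulr_ge0 // ltW.
  - exact: IH.
(* The grid time [tk k] is at or after [t], by at most [dl]; time regularity of [U] pays for the
   difference. *)
pose k := Num.trunc ((T - t) / dl).
case/andP: tT => t0 tT.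
have q0 : 0 <= (T - t) / dl by rewrite divr_ge0 ?subr_ge0 // ltW.
have kle : k%:R * dl <= T - t.
  by rewrite -ler_pdivlMr //; have /andP[] := trunc_itv q0.
have kge : T - t <= k%:R * dl + dl.
  have -> : k%:R * dl + dl = k.+1%:R * dl by rewrite -(natr1 k); ring.
  by rewrite -ler_pdivrMr //; exact/ltW/truncnS_gt.
have kT : k%:R * dl <= T by rewrite (le_trans kle) // gerBl.
have tkE : tk k = T - k%:R * dl by rewrite /tk max_r // subr_ge0.
have := ind k kT x s sr; rewrite /doubled; set X := x + _.
have tX y : `|U (y, tk k) - U (y, t)| <= Bt * dl.
  have [] := hBt y t (tk k - t).
  - by rewrite t0 tT.
  - by rewrite addrC subrK tkT.
  move=> _; rewrite [t + _]addrC subrK => /le_trans; apply; rewrite ler_wpM2l //.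
  rewrite ler_norml tkE; apply/andP; split; lra.
have tX1 := tX X; have tX2 := tX x.
have sg1 : `|sg| = 1.
  by move/eqP: sg2; rewrite sqrf_eq1 => /orP[] /eqP ->; rewrite ?normrN normr1.
case/andP: sr => s0 s1.
have PX : `|P k X - P k x| <= om * s.
  rewrite (le_trans (taylor_lip i x _ (tP k kT) (fun j y => D1om k j y kT))) //.
  by rewrite normrM sg1 mulr1 ger0_norm.
have UX : s * a * (U (X, tk k) + M) <= s * a * (2 * M).
  rewrite ler_wpM2l ?mulr_ge0 //; have := UM X (tkT k); rewrite ler_norml; lra.
have err : k%:R * (4 * (dl * e1)) + 2 * (Bt * dl) <= e.
  have z1 : k%:R * dl * (4 * e1) <= T * (4 * e1) by rewrite ler_wpM2r // mulr_ge0.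
  have z2 : Bt * dl <= Bt * h by rewrite ler_wpM2l.
  have z3 : (4 * T * (Bt + Cst) + 2 * Bt) * h <= e.
    by rewrite (le_trans _ n3) // ler_pM2r // /Ctot lerDr addr_ge0.
  move: z1 z3; rewrite /e1; lra.
have z4 : 0 <= B * (Lam * s ^+ 2) by rewrite mulr_ge0 // mulr_ge0 ?sqr_ge0 // ltW.
move: tX1 tX2 PX; rewrite !ler_norml; lra.
Qed.

End Estimate.
End GridEstimate.

(** * The gradient estimate *)

Ltac nonneg := repeat first
  [ done | exact: ltW | apply: addr_ge0 | apply: divr_ge0 | apply: mulr_ge0
  | exact: powR_ge0 | exact: sqrtr_ge0 | rewrite invr_ge0 ].

Section GradientEstimate.
Local Open Scope classical_set_scope.
Context {R : realType} {d : nat}.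
Notation vec := 'rV[R]_d.
Notation V := (vec * R)%type.
Variables (H : vec -> vec -> R) (mu CL c C3 Cx LT : R).
Hypothesis H1 : forall x q, 1 <= H x q.
Hypotheses (mu0 : 0 < mu) (CL0 : 0 <= CL) (c0 : 0 < c) (C30 : 0 < C3) (Cx0 : 0 < Cx) (LT0 : 0 <= LT).
Hypothesis Hlip : forall (rho : R) x (q q' : vec), 1 <= rho ->
  (forall j, `|q 0 j| <= rho) -> (forall j, `|q' 0 j| <= rho) ->
  `|H x q' - H x q| <= CL * rho `^ (1 + mu) * \sum_j `|q' 0 j - q 0 j|.
Hypothesis Hscale : forall x q (r : R), 0 < r <= 1 ->
  H x (r *: q) + (1 - r) * (c * H x (r *: q) - C3) <= r * H x q.
Hypothesis Hx : forall i x q (s : R), Cx * `|s| <= 1 ->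
  H (x + s *: ev R i) q <= (1 + Cx * `|s|) * H x q.

(** [beta] makes [sd * 2 B] equal to [K / 2] for [B = beta K]; [a] gives [Cx <= a c] with equality.
    [C2] is large enough that [Lam = C2 Q], with [Q = 1 + om K^mu], dominates [a], [Cx] and [om],
    and its last summand gives the interior condition on [8 B Lam]. *)
Let sd : R := 1 + Num.sqrt d%:R.
Let beta : R := (4 * sd)^-1.
Let a : R := Cx / c.
Let C2 : R := a + Cx + 1 + (C3 + 4 * a + 4 * d%:R * CL) / (8 * beta).
(** The first three summands serve the three alternatives in [gradient_estimate_om], in their order
    there. *)
Definition gradient_cst : R := 8 * C2 / (3 * beta) + LT / beta + 2 * sd * (2 * a + 1) + 1.

Lemma gradient_cst_ge1 : 1 <= gradient_cst.
Proof.
have sd0 : 0 < sd by rewrite ltr_pwDl // sqrtr_ge0.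
have b0 : 0 < beta by rewrite invr_gt0 mulr_gt0.
have a0 : 0 <= a by rewrite divr_ge0 // ltW.
have C20 : 0 <= C2.
  have h : 0 <= (C3 + 4 * a + 4 * d%:R * CL) / (8 * beta).
    by nonneg.
  rewrite /C2; move: (ltW Cx0); lra.
by rewrite lerDr; nonneg.
Qed.

Variables (U F : V -> R^o) (T p L K M : R).
Hypotheses (sU : smoothC U) (pU : tper U) (sF : smoothC F) (pF : tper F).
Hypothesis T0 : 0 < T.
Hypothesis eqU : forall x (t : R), 0 <= t <= T -> 'D_(0, 1) U (x, t) =
  H x (\row_j 'D_(ev R j, 0) U (x, t)) - \sum_j 'D_(ev R j, 0) ('D_(ev R j, 0) U) (x, t) - F (x, t).
Hypothesis F0 : forall x (t : R), 0 <= t <= T -> 0 <= F (x, t).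
Hypothesis dp : d%:R < p.
Hypothesis L0 : 0 <= L.
Hypothesis FL : forall t : R, 0 <= t <= T -> box_int 0 1 (fun x => `|F (x, t)| `^ p) <= L `^ p.
Hypothesis K1 : 1 <= K.
Hypothesis UK : forall j x (t : R), 0 <= t <= T -> `|'D_(ev R j, 0) U (x, t)| <= K.
Hypothesis KU : forall D, 0 <= D ->
  (forall j x (t : R), 0 <= t <= T -> `|'D_(ev R j, 0) U (x, t)| <= D) -> K <= Num.sqrt d%:R * D.
Hypothesis M0 : 0 <= M.
Hypothesis UM : forall x (t : R), 0 <= t <= T -> `|U (x, t)| <= M.
Hypothesis UT : forall x i (s : R), `|U (x + s *: ev R i, T) - U (x, T)| <= LT * `|s|.

Lemma gradient_estimate_om (om0 : R) (om := @heat_cst R d p T * (L + om0) + om0) : 0 < om0 ->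
  K <= gradient_cst * (1 + M) * (1 + om * K `^ mu).
Proof.
move=> om00.
have sd0 : 0 < sd by rewrite ltr_pwDl // sqrtr_ge0.
have b0 : 0 < beta by rewrite invr_gt0 mulr_gt0.
have a0 : 0 <= a by rewrite divr_ge0 // ltW.
have K0 : 0 < K by exact: lt_le_trans K1.
pose Cb := (C3 + 4 * a + 4 * d%:R * CL) / (8 * beta).
have Cb0 : 0 <= Cb by rewrite /Cb; nonneg.
have C21 : 1 <= C2 by rewrite /C2 -/Cb; move: (ltW Cx0); lra.
have C2a : a <= C2 by rewrite /C2 -/Cb; move: (ltW Cx0); lra.
have C2x : Cx <= C2 by rewrite /C2 -/Cb; move: (ltW Cx0); lra.
have C2b : Cb <= C2 by rewrite /C2 -/Cb; move: (ltW Cx0); lra.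
have C20 : 0 <= C2 by exact: le_trans C21.
have om1 : 0 <= om.
  by have := heat_cst_ge0 T dp; rewrite /om => hc; nonneg.
have Km1 : 1 <= K `^ mu.
  have -> : 1 = 1 `^ mu :> R by rewrite powR1.
  by rewrite ge0_ler_powR ?nnegrE // ltW.
set Q := 1 + om * K `^ mu.
have oK0 : 0 <= om * K `^ mu by rewrite mulr_ge0 // (le_trans ler01).
have Q1 : 1 <= Q by rewrite lerDl.
have Q0 : 0 < Q by exact: lt_le_trans Q1.
have omQ : om <= Q.
  by rewrite (le_trans (_ : om <= om * K `^ mu)) ?ler_peMr // lerDr.
pose Lam := C2 * Q; pose B := beta * K.
have Lam0 : 0 < Lam by rewrite mulr_gt0 // (lt_le_trans ltr01).
have LamQ : Q <= Lam by rewrite ler_peMl // ltW.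
have LamC : C2 <= Lam by rewrite ler_peMr.
have B0 : 0 <= B by rewrite mulr_ge0 // ltW.
have M1 : 1 <= 1 + M by rewrite lerDl.
have G1 := gradient_cst_ge1.
have g1 : 0 <= 8 * C2 / (3 * beta) by nonneg.
have g2 : 0 <= LT / beta by rewrite divr_ge0 // ltW.
have g3 : 0 <= 2 * sd * (2 * a + 1) by nonneg.
have MQ0 : 0 <= (1 + M) * Q by rewrite mulr_ge0 ?(ltW Q0) // (le_trans ler01).
have MQ1 : 1 <= (1 + M) * Q by rewrite -[leLHS]mulr1 ler_pM.
have fin z : 0 <= z -> z <= gradient_cst -> K <= z * ((1 + M) * Q) -> K <= gradient_cst * (1 + M) * Q.
  by move=> z0 zg h; rewrite (le_trans h) // -mulrA ler_wpM2r.
(* If the penalty at [r0] is too weak, then [B = beta K] is at most a multiple of [(1 + M) Lam],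
   which is already the claim. *)
have [hB|hB] := ltP (3 * B / (4 * Lam)) (2 * M + 1).
  apply: (fin _ g1); first by rewrite /gradient_cst; lra.
  rewrite mulrAC ler_pdivlMr ?mulr_gt0 //.
  have Lam40 : 0 < 4 * Lam by rewrite pmulr_rgt0.
  move: hB; rewrite ltr_pdivrMr // => /ltW.
  have := ltW Lam0; rewrite /B /Lam; lra.
(* Here K is controlled by the Lipschitz constant of the terminal datum. *)
have [hLT|hLT] := ltP B LT.
  apply: (fin _ g2); first by rewrite /gradient_cst; lra.
  rewrite (le_trans (_ : K <= LT / beta)) ?ler_peMr //.
  by rewrite ler_pdivlMr // mulrC ltW.
apply: (fin _ g3); first by rewrite /gradient_cst; lra.
have hBL : C3 + 2 * (CL * K `^ (1 + mu) * (d%:R * (2 * om))) + 4 * a * K <= 8 * B * Lam.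
  have -> : K `^ (1 + mu) = K * K `^ mu.
    by rewrite powRD ?(gt_eqF K0) ?implybT // powRr1 // ltW.
  have h1 : 8 * B * Lam = 8 * beta * C2 * (K * Q) by rewrite /B /Lam; ring.
  have h2 : 8 * beta * Cb * (K * Q) <= 8 * beta * C2 * (K * Q).
    by rewrite ler_wpM2r ?mulr_ge0 ?(ltW K0) ?(ltW Q0) // ler_wpM2l // mulr_ge0 // ltW.
  have h3 : 8 * beta * Cb = C3 + 4 * a + 4 * d%:R * CL.
    by rewrite /Cb; field; exact: lt0r_neq0.
  rewrite h1 (le_trans _ h2) // h3.
  have k1 : C3 <= C3 * K by rewrite ler_peMr // ltW.
  have k2 : 0 <= C3 * (K * (om * K `^ mu)) by nonneg.
  have k3 : 0 <= a * (K * (om * K `^ mu)) by nonneg.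
  have k4 : 0 <= d%:R * CL * K by nonneg.
  move: k1 k2 k3 k4; rewrite /Q; lra.
pose D := 2 * B + 2 * a * M + om.
have D0 : 0 <= D by rewrite /D; nonneg.
have KD : K <= Num.sqrt d%:R * D.
  apply: KU => // j x t tT.
  have [Bu Bu0 tU] := smoothC_taylor T sU pU.
  have [u1 _ _ _] := tU t tT.
  (* The doubling estimate divided by s, as s tends to 0. *)
  have oneside sg : sg ^+ 2 = 1 -> sg * 'D_(ev R j, 0) U (x, t) - D <= 0.
    move=> sg2; apply: (@le0_of_small _ _ Bu (2 * Lam)^-1); first by rewrite invr_gt0 mulr_gt0.
    move=> s /andP[s0 s1].
    have := @doubling_estimate R d H mu CL c C3 Cx H1 CL0 C30 Cx0 Hlip Hscale Hx U F T p L K M LT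
      sU pU sF pF T0 eqU F0 dp L0 FL K1 UK UM UT om0 a B Lam sg j x t s om00 sg2 a0 Lam0
      (le_trans C2a LamC) (le_trans C2x LamC) (le_trans omQ LamQ).
    rewrite -/om /a divfK ?gt_eqF // -/a => /(_ (lexx _) hB hBL B0 hLT tT).
    rewrite (ltW s0) s1 => /(_ isT) h.
    have := u1 j (s * sg) x; rewrite exprMn sg2 mulr1 ler_norml => /andP[h' _].
    have h2 : s * (sg * 'D_(ev R j, 0) U (x, t) - D) <= Bu * s ^+ 2.
      move: h h'; rewrite /D; lra.
    have := ler_wpM2l (ltW s0) h2.
    rewrite (_ : s * (s * _) = s ^+ 2 * (sg * 'D_(ev R j, 0) U (x, t) - D)); last by ring.
    by rewrite (_ : s * (Bu * s ^+ 2) = Bu * s ^+ 3); last by ring.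
  rewrite ler_norml; apply/andP; split.
    have := oneside (-1); rewrite sqrrN expr1n => /(_ erefl); lra.
  have := oneside 1; rewrite expr1n => /(_ erefl); lra.
have sdD : K <= sd * D by rewrite (le_trans KD) // ler_wpM2r // lerDr.
have e1 : sd * (2 * B) = K / 2 by rewrite /B /beta; field; exact: lt0r_neq0.
have h1 : K <= 2 * sd * (2 * a * M + om).
  move: sdD; rewrite /D mulrDr mulrDr e1; lra.
rewrite (le_trans h1) // -[leRHS]mulrA ler_wpM2l ?mulr_ge0 ?(ltW sd0) //.
have k1 : a * M <= a * ((1 + M) * Q).
  by rewrite ler_wpM2l // (le_trans (_ : M <= 1 + M)) ?lerDr // ler_peMr // (le_trans ler01).
have k2 : om <= (1 + M) * Q by rewrite (le_trans omQ) // ler_peMl // ltW.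
by move: k1 k2; lra.
Qed.

(** The slack [om0] tends to 0; at [om0 = e / (1 + G)] the excess is at most [e]. *)
Lemma gradient_estimate : K <= gradient_cst * (1 + M) * (1 + @heat_cst R d p T * L * K `^ mu).
Proof.
apply/ler_addgt0Pr => e e0.
have hc := heat_cst_ge0 T dp.
set hC := @heat_cst R d p T in hc *.
have G0 : 0 <= gradient_cst * (1 + M) * ((hC + 1) * K `^ mu).
  by have := le_trans ler01 gradient_cst_ge1 => g0; nonneg.
set G := gradient_cst * (1 + M) * ((hC + 1) * K `^ mu) in G0.
have g0 : 0 < 1 + G by rewrite ltr_pwDl.
have := gradient_estimate_om (divr_gt0 e0 g0); rewrite -/hC => /le_trans; apply.
have -> : gradient_cst * (1 + M) * (1 + (hC * (L + e / (1 + G)) + e / (1 + G)) * K `^ mu) =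
  gradient_cst * (1 + M) * (1 + hC * L * K `^ mu) + e / (1 + G) * G by rewrite /G; ring.
rewrite lerD2l mulrAC ler_pdivrMr // ler_wpM2l ?(ltW e0) //.
by rewrite lerDr.
Qed.

End GradientEstimate.

(** * Translation to the notions of the statement and conclusion *)

Section Assembly.
Local Open Scope classical_set_scope.
Context {R : realType} {d : nat}.
Notation vec := 'rV[R]_d.
Notation V := (vec * R)%type.

Lemma smoothC_fst (g : vec -> R^o) : smoothC g -> smoothC (fun z : V => g z.1 : R^o).
Proof.
move=> sg; apply: (@smoothC_coind R V (fun f => exists2 g, smoothC g & f = fun z => g z.1)); last by exists g.
move=> _ [{sg}g sg ->]; split.
  move=> z; apply: (@continuous_comp _ _ _ (fst : V -> vec) g); last exact: smoothC_continuous.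
  case: z => x t; exact: cvg_fst.
move=> v; exists (fun z => 'D_(v.1) g z.1).
  by exists ('D_(v.1) g) => //; exact: smoothC_derive.
move=> z; have dg := @smoothC_derivable R vec g z.1 v.1 sg.
by apply: DeriveDef; [exact: dg | reflexivity].
Qed.

Lemma tperiodic_derive (f : vec -> R) : tperiodic f -> tper (fun z : V => f z.1 : R^o).
Proof. by move=> pf x t j; exact: pf. Qed.

Lemma dtE (u : vec -> R -> R) x t : dt u x t = 'D_(0, 1) (unc u : V -> R^o) (x, t).
Proof. by rewrite -(derive_snd (unc u)). Qed.

Lemma pdE (f : V -> R^o) i x t : pd i (fun x => f (x, t)) x = 'D_(ev R i, 0) f (x, t).
Proof. by rewrite -(derive_fst f). Qed.

Lemma pd2E (f : V -> R^o) i x t : pd i (pd i (fun x => f (x, t))) x =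
  'D_(ev R i, 0) ('D_(ev R i, 0) f) (x, t).
Proof.
by rewrite -pdE; congr (pd i _ x); apply/funext => y; rewrite pdE.
Qed.

Lemma gradE (u : vec -> R -> R) x t :
  grad (u ^~ t) x = \row_i 'D_(ev R i, 0) (unc u : V -> R^o) (x, t).
Proof. by apply/rowP => i; rewrite !mxE -pdE. Qed.

Lemma lapE (u : vec -> R -> R) x t :
  lap (u ^~ t) x = \sum_i 'D_(ev R i, 0) ('D_(ev R i, 0) (unc u : V -> R^o)) (x, t).
Proof. by apply: eq_bigr => i _; rewrite -pd2E. Qed.

Lemma conv_ge0 (eta : vec -> R) (eps : R) (f : vec -> R) x : 0 < eps ->
  (forall y, 0 <= eta y) -> (forall y, 0 <= f y) -> 0 <= Defs.conv eta eps f x.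
Proof.
move=> e0 h f0; apply: iint_ge0 => y; rewrite mulr_ge0 // mulr_ge0 //.
by rewrite invr_ge0 exprn_ge0 // ltW.
Qed.

End Assembly.

Unset Implicit Arguments.

Theorem theorem6 (R : realType) (d : nat) (T : R)
    (H : 'rV[R]_d -> 'rV[R]_d -> R) (alpha mu : R)
    (uT m0 eta : 'rV[R]_d -> R) (p : R) :
  0 < T ->
  (* (A1) *)
  smoothC (fun z : ('rV[R]_d * 'rV[R]_d)%type => H z.1 z.2) ->
  (forall q, tperiodic (fun x => H x q)) ->
  (forall x q1 q2 (l : R), q1 != q2 -> 0 < l < 1 ->
     H x (l *: q1 + (1 - l) *: q2) < l * H x q1 + (1 - l) * H x q2) ->
  (forall x (M : R), exists r0 : R, forall q, r0 < enorm q -> M * enorm q < H x q) ->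
  (forall x q, 1 <= H x q) ->
  (* (A2) (with g(z) = z^alpha, which is non-negative and increasing by (A4)) *)
  smoothC uT -> tperiodic uT -> smoothC m0 -> tperiodic m0 ->
  (forall x, 0 <= m0 x) -> box_int 0 1 m0 = 1 ->
  (* (A3) *)
  (exists c C : R, [/\ 0 < c, 0 < C & forall x q, c * H x q - C <= Lhat H x q]) ->
  (* (A4) *)
  0 < alpha ->
  (* (A5) *)
  (exists C : R, forall x q,
     enorm (DxH H x q) <= C * H x q + C /\ fnorm (DxxH H x q) <= C * H x q + C) ->
  (forall delta : R, 0 < delta -> exists Cd : R, forall x q (M : 'M[R]_d),
     M^T = M ->
     \tr (DpxH H x q *m M) <= delta * \tr (DppH H x q *m (M *m M)) + Cd * H x q) ->
  (* (A6) *)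
  (exists kappa0 : R, 0 < kappa0 /\ forall x, kappa0 <= m0 x) ->
  (* (A7) *)
  0 < mu < 1 ->
  (exists c1 C1 c2 C2 : R, [/\ 0 <= c1, 0 <= C1, 0 <= c2, 0 <= C2 &
     forall x q, c1 * enorm q `^ (2 + mu) + C1 <= H x q /\
                 H x q <= c2 * enorm q `^ (2 + mu) + C2]) ->
  (* (A8) *)
  (exists C : R, forall x q,
     enorm (DpH H x q) ^+ 2 <= C * enorm q `^ mu * H x q + C) ->
  (* (A9) *)
  (exists C : R, forall x q,
     fnorm (DpxH H x q) ^+ 2 <= C * H x q `^ ((2 + 2 * mu) / (2 + mu)) /\
     forall M : 'M[R]_d, M^T = M ->
       fnorm (DppH H x q *m M) ^+ 2
         <= C * H x q `^ (mu / (2 + mu)) * \tr (DppH H x q *m M *m M)) ->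
  (* mollifier and exponent p > d *)
  is_mollifier eta ->
  d%:R < p ->
  exists C : R, forall (eps : R) (u m : 'rV[R]_d -> R -> R),
    0 < eps ->
    is_solution H alpha eta eps uT m0 T u m ->
    grad_supnorm T u <=
      C + C * supnorm T u
      + C * Lp_supnorm T p (fun x t => g_eps alpha eta eps (m ^~ t) x)
          * grad_supnorm T u `^ mu * (1 + supnorm T u).
Proof.
move=> T0 sH pH cvxH _ H1 suT puT _ _ _ _ [c [C3 [c0 C30 hL]]] _ [C5 hC5] _ _ /andP[mu0 _]
  [c1 [C1 [c2 [C2 [_ _ c20 C20 hA7]]]]] [C8 hC8] _ [_ eta0 _ _ _] dp.
have [CL CL0 Hlip] := H_lip_p sH H1 mu0 c20 C20 (fun x q => (hA7 x q).2) hC8.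
have Hscale := H_scale_ge sH cvxH hL.
have [Cx Cx0 Hx] := H_growth_x sH H1 (fun x q => (hC5 x q).1).
have sW := @smoothC_fst R d uT suT; have pW := @tperiodic_derive R d uT puT.
set W := (fun z : ('rV[R]_d * R)%type => uT z.1 : R^o) in sW pW.
have [LT LT0 hLT] : exists2 B, 0 <= B & forall j x t, 0 <= t <= T -> `|'D_(ev R j, 0) W (x, t)| <= B.
  apply: (@family_bound R d (fun j B => forall x t, 0 <= t <= T -> `|'D_(ev R j, 0) W (x, t)| <= B)).
    by move=> j b' b'' hb bb y r rT; exact: le_trans (hb y r rT) bb.
  by move=> j; apply: (@tper_bounded R d ('D_(ev R j, 0) W)); [apply: smoothC_continuous; exact: smoothC_derive | exact: tper_derive].
pose G := @gradient_cst R d CL c C3 Cx LT.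
have G1 : 1 <= G by exact: gradient_cst_ge1.
have hc0 := heat_cst_ge0 T dp; set hc := @heat_cst R d p T in hc0.
(* [G] depends on H and the terminal datum, [hc] on d, p and T; both are fixed before [eps]. *)
exists (G * (1 + hc)) => eps u m e0 [sU _ [pu _] [eqn _] [uTE _]].
pose U : 'rV[R]_d * R -> R^o := unc u.
have pU : tper U by move=> x t j; exact: pu.
pose Gk k := 'D_(ev R k, 0) U.
have sG k : smoothC (Gk k) by exact: smoothC_derive.
pose KH : ('rV[R]_d * 'rV[R]_d)%type -> R^o := fun z => H z.1 z.2.
(* The source is read off the equation as an expression in u. Its smoothness then follows from that
   of u and H, without studying the convolutions, and it equals the coupling on [0, T]. *)
pose F : 'rV[R]_d * R -> R^o := cst (-1) * 'D_(0, 1) U + (KH \o graphmap Gk)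
  + cst (-1) * \sum_k 'D_(ev R k, 0) ('D_(ev R k, 0) U).
have FE x t : F (x, t) = - 'D_(0, 1) U (x, t) + H x (\row_k 'D_(ev R k, 0) U (x, t))
   - \sum_k 'D_(ev R k, 0) ('D_(ev R k, 0) U) (x, t).
  by rewrite /F !fctE /= fct_sumE !mulN1r.
have sF : smoothC F.
  apply: (graphclass_smoothC sG); apply: graphclass_add.
    apply: graphclass_add; last exact: graphclass_comp.
    apply: graphclass_mul; apply: graphclass_smooth; first exact: smoothC_cst.
    exact: smoothC_derive.
  apply: graphclass_mul; first by apply: graphclass_smooth; exact: smoothC_cst.
  by apply: graphclass_sum => k; apply: graphclass_smooth; do 2 apply: smoothC_derive.
have pF : tper F.
  move=> x t j; rewrite !FE (tper_derive (0, 1) pU) pH.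
  under [X in _ - X = _]eq_bigr => k _ do
    rewrite (tper_derive (ev R k, 0) (tper_derive (ev R k, 0) pU)).
  rewrite (_ : \row_k _ = \row_k 'D_(ev R k, 0) U (x, t)); first by [].
  by apply/rowP => k; rewrite !mxE (tper_derive (ev R k, 0) pU).
have FG x t : 0 <= t <= T -> F (x, t) = g_eps alpha eta eps (m ^~ t) x.
  move=> tT; have := eqn x t tT; rewrite dtE gradE lapE FE => ->.
  by rewrite addrC addKr.
have F0 x t : 0 <= t <= T -> 0 <= F (x, t).
  move=> tT; rewrite FG //; apply: conv_ge0 => // y; exact: powR_ge0.
have eqU x t : 0 <= t <= T -> 'D_(0, 1) U (x, t) =
    H x (\row_j 'D_(ev R j, 0) U (x, t)) - \sum_j 'D_(ev R j, 0) ('D_(ev R j, 0) U) (x, t) - F (x, t).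
  by move=> _; rewrite FE; ring.
have T00 : 0 <= (0 : R) <= T by rewrite lexx ltW.
set K := grad_supnorm T u; set M := supnorm T u; set L := Lp_supnorm _ _ _.
have [bU bU0 hbU] := tper_bounded T (smoothC_continuous sU) pU.
have UM x t : 0 <= t <= T -> `|U (x, t)| <= M.
  move=> tT; apply: ub_le_sup; last by exists x, t.
  exists bU => _ [y [s [sT ->]]]; exact: hbU.
have M0 : 0 <= M := le_trans (normr_ge0 _) (UM 0 0 T00).
have [bD bD0 hbD] : exists2 B, 0 <= B & forall j x t, 0 <= t <= T -> `|'D_(ev R j, 0) U (x, t)| <= B.
  apply: (@family_bound R d (fun j B => forall x t, 0 <= t <= T -> `|'D_(ev R j, 0) U (x, t)| <= B)).
    by move=> j b' b'' hb bb y r rT; exact: le_trans (hb y r rT) bb.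
  by move=> j; apply: (@tper_bounded R d ('D_(ev R j, 0) U)); [apply: smoothC_continuous; exact: smoothC_derive | exact: tper_derive].
have enle D x t : 0 <= D -> (forall j, `|'D_(ev R j, 0) U (x, t)| <= D) ->
    enorm (grad (u ^~ t) x) <= Num.sqrt d%:R * D.
  by move=> D0 h; apply: enorm_le => // j; rewrite gradE mxE.
have UK j x t : 0 <= t <= T -> `|'D_(ev R j, 0) U (x, t)| <= K.
  move=> tT; apply: (@le_trans _ _ (enorm (grad (u ^~ t) x))).
    by have := enorm_coord (grad (u ^~ t) x) j; rewrite gradE mxE.
  apply: ub_le_sup; last by exists x, t.
  exists (Num.sqrt d%:R * bD) => _ [y [s [sT ->]]]; apply: enle => // k; exact: hbD.
have KU D : 0 <= D -> (forall j x (t : R), 0 <= t <= T -> `|'D_(ev R j, 0) U (x, t)| <= D) ->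
    K <= Num.sqrt d%:R * D.
  move=> D0 h; apply: ge_sup; first by exists (enorm (grad (u ^~ 0) 0)), 0, 0.
  by move=> _ [y [s [sT ->]]]; apply: enle => // j; exact: h.
have L0 : 0 <= L.
  rewrite /L /Lp_supnorm; set E := mkset _.
  (* A set without supremum has [sup] equal to 0 by default. *)
  have [hE|hE] := pselect (has_sup E); last by rewrite sup_out.
  have [[r Er] ubE] := hE; apply: le_trans (ub_le_sup ubE Er).
  by case: Er => t [_ ->]; exact: powR_ge0.
have G0 : 0 <= G by exact: le_trans G1.
have Gh0 : G <= G * (1 + hc) by rewrite ler_peMr // lerDl.
have Gh1 : 1 <= G * (1 + hc) by exact: le_trans G1 Gh0.
have GM : 0 <= G * (1 + hc) * M by rewrite mulr_ge0 // (le_trans ler01).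
have GL : 0 <= G * (1 + hc) * L * K `^ mu * (1 + M).
  by nonneg.
have [K1|K1] := leP 1 K; last first.
  by rewrite (le_trans (ltW K1)) // (le_trans Gh1) // -addrA lerDl addr_ge0.
(* In dimension 0 the gradient vanishes, against [K >= 1]. *)
have d0 : (0 < d)%N.
  rewrite lt0n; apply/negP => /eqP dz; have := KU 0 (lexx _); rewrite mulr0 => h.
  have : K <= 0 by apply: h => -[k kd]; exfalso; move: kd; rewrite dz.
  by rewrite leNgt (lt_le_trans ltr01 K1).
have p1 : 1 < p by apply: le_lt_trans dp; rewrite ler1n.
have [b [LF [b0 LF0 hLF]]] := powR_slice_lip T p1 sF pF.
have p0 : 0 < p by exact: lt_trans p1.
have FL t : 0 <= t <= T -> box_int 0 1 (fun x => `|F (x, t)| `^ p) <= L `^ p.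
  move=> tT; set I := box_int _ _ _.
  have I0 : 0 <= I by apply: iint_ge0 => y; exact: powR_ge0.
  have -> : I = (I `^ p^-1) `^ p by rewrite -powRrM mulVf ?gt_eqF // powRr1.
  rewrite ge0_ler_powR ?nnegrE ?powR_ge0 ?(ltW p0) //.
  apply: ub_le_sup; last first.
    exists t; split; first exact: tT.
    rewrite /I (_ : (fun x => `|F (x, t)| `^ p) =
      (fun x => `|g_eps alpha eta eps (m ^~ t) x| `^ p)); first by [].
    by apply/funext => y; rewrite FG.
  (* The sup bound [b] of [F] bounds all the L^p norms, so that [L] is a genuine supremum. *)
  exists ((b `^ p) `^ p^-1) => _ [s [sT ->]].
  have [Fb lp] := hLF s sT.
  rewrite ge0_ler_powR ?nnegrE ?powR_ge0 ?invr_ge0 ?(ltW p0) //.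
    by apply: iint_ge0 => y; exact: powR_ge0.
  rewrite (_ : (fun x => `|g_eps alpha eta eps (m^~ s) x| `^ p) = (fun y => `|F (y, s)| `^ p)); last first.
    by apply/funext => y; rewrite FG.
  apply: (iint_le _ (leqnn d) lp) => y.
  by rewrite ge0_ler_powR ?nnegrE ?(ltW p0).
have UT x i s : `|U (x + s *: ev R i, T) - U (x, T)| <= LT * `|s|.
  rewrite /U /unc /= !uTE.
  have := @space_osc R d W LT i x T s sW (fun y => hLT i y T _).
  by apply; rewrite lexx (ltW T0).
have := @gradient_estimate R d H mu CL c C3 Cx LT H1 mu0 CL0 c0 C30 Cx0 LT0 Hlip Hscale Hx
  U F T p L K M sU pU sF pF T0 eqU F0 dp L0 FL K1 UK KU M0 UM UT.
rewrite -/G -/hc => /le_trans; apply.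
have g1 : 0 <= G * hc by rewrite mulr_ge0.
have g2 : 0 <= G * hc * M by rewrite mulr_ge0.
have g3 : 0 <= G * (L * K `^ mu * (1 + M)).
  by rewrite !mulr_ge0 ?powR_ge0 // addr_ge0.
move: g1 g2 g3; lra.
Qed.
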